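(* Let $p\geq 2$ and $s>s_p^\star$, where $s_p^\star=1/4$ if $p\leq 4$ and $s_p^\star=1/2-1/p$ if $p>4$. Let $R_s(x)=\sum_{n=1}^\infty n^{-2s}e^{2\pi i n^2 x}$ on $\mathbb T=\mathbb R/\mathbb Z$. Then, as $N\to\infty$, \[ F_{R_s,p}(N)\simeq \begin{cases} 1, & p<4,\\ \log N, & p=4,\\ N^{p/4-1}, & p>4,\end{cases} \] where the implicit constants do not depend on $N$.
   Context: $\mathbb T=\mathbb R/\mathbb Z$ and $\|\cdot\|_p$ denotes the $L^p(\mathbb T)$ norm. For $s\le 1/2$ the series defining $R_s$ is not absolutely convergent; $R_s$ is then understood as the limit in $L^p(\mathbb T)$ of its partial sums. For $f(x)=\sum_{n\in\mathbb Z}a_ne^{2\pi i n x}$, the high-pass filter is $f_{\geq N}(x)=\sum_{|n|\geq N}a_ne^{2\pi i n x}$; for $R_s$ this means $(R_s)_{\ge N}(x)=\sum_{n\ge1,\ n^2\ge N} n^{-2s}e^{2\pi i n^2x}$. The flatness in the sense of high-pass filters is $F_{f,p}(N)=\|f_{\geq N}\|_{p}^p/\|f_{\geq N}\|_{2}^p$. $A\simeq B$ means $c B\le A\le CB$ for constants $c,C>0$. *)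

(* Defs.v *)
From HB Require Import structures.
From mathcomp Require Import all_boot all_order all_algebra.
From mathcomp Require Import all_classical all_reals all_analysis.
Set Implicit Arguments. Unset Strict Implicit. Unset Printing Implicit Defensive.
Import Order.TTheory GRing.Theory Num.Theory.
Import numFieldNormedType.Exports.
Local Open Scope classical_set_scope.
Local Open Scope ring_scope.

Section Defs.
Variable R : realType.

(* A complex-valued function on T = R/Z is represented by its real and
   imaginary parts (1-periodic functions R -> R); only the values on [0,1]
   matter.  |z|^q = (Re z ^2 + Im z ^2)^(q/2). *)
Definition cabs_pow (a b q : R) : R := powR (a ^+ 2 + b ^+ 2) (q / 2).

Definition Lnorm_pow (q : R) (fr fi : R -> R) : \bar R :=
  (\int[@lebesgue_measure R]_(x in `[(0%R:R), (1%R:R)]) (cabs_pow (fr x) (fi x) q)%:E)%E.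

(* partial sums (up to n = M) of the high-pass filter (R_s)_{>=N}:
   sum_{1 <= n <= M, n^2 >= N} n^{-2s} e^{2 pi i n^2 x} *)
Definition HP_re (s : R) (N M : nat) (x : R) : R :=
  \sum_(1 <= n < M.+1 | (N <= n ^ 2)%N)
     powR (n%:R) (- (2 * s)) * cos (2 * pi * (n ^ 2)%:R * x).
Definition HP_im (s : R) (N M : nat) (x : R) : R :=
  \sum_(1 <= n < M.+1 | (N <= n ^ 2)%N)
     powR (n%:R) (- (2 * s)) * sin (2 * pi * (n ^ 2)%:R * x).

Definition is_HP_limit (p s : R) (N : nat) (gr gi : R -> R) : Prop :=
  measurable_fun `[(0%R:R), (1%R:R)] gr /\ measurable_fun `[(0%R:R), (1%R:R)] gi /\
  (Lnorm_pow p (fun x => HP_re s N M x - gr x) (fun x => HP_im s N M x - gi x))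
    @[M --> \oo] --> 0%E.

Definition flatness (p : R) (gr gi : R -> R) : R :=
  fine (Lnorm_pow p gr gi) / powR (fine (Lnorm_pow 2 gr gi)) (p / 2).

Definition s_star (p : R) : R := if p <= 4 then 1 / 4 else 1 / 2 - 1 / p.

Definition flat_rate (p : R) (N : nat) : R :=
  if p < 4 then 1 else if p == 4 then ln (N%:R) else powR (N%:R) (p / 4 - 1).

End Defs.

(* Main.v *)
Require Import Defs.
From HB Require Import structures.
From mathcomp Require Import all_boot all_order all_algebra cyclic.
From mathcomp Require Import all_classical all_reals all_analysis measurable_realfun.
From mathcomp Require Import ring lra zify.
Import Order.TTheory GRing.Theory Num.Theory.
Import numFieldNormedType.Exports.
Local Open Scope ring_scope.

(* The filter n^2 >= N amounts to n >= K with K of order N^{1/2}.  The tail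
   sum_{n >= K} n^{-2s} e(n^2 x) has L^2 norm of order K^{1/2-2s} by Parseval, so
   everything reduces to its L^p norm.

   Upper bound.  Weyl differencing, applied to a block of length L smoothed by
   trapezoidal weights, bounds the square of the block pointwise by
   sum_{m < 16L} L / (1 + L ||mx||)^2 (||.|| the distance to the integers).
   If q is the best denominator of x below 16L, this is at most a constant times
   min(L^2/q, L + 1/||qx||); integrating the power p/2 over all arcs a/q gives
   L^{1/2} for 2 < p < 4, an extra (log L)^{1/4} at p = 4, and L^{1-2/p} for p > 4.
   A sharp interval is a sum of trapezoids with dyadically growing ramps, whose
   norms form a geometric series, and Abel summation inserts the weights n^{-2s}.

   Lower bound.  For p < 4 Hoelder's inequality compares with L^2.  For p = 4 the
   norm counts solutions of n^2 + l^2 = m^2 + k^2 in [K, 2K], of which an explicit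
   parametrized family provides K^2 log K.  For p > 4 testing against a Fejer
   kernel of degree 8K^2 detects the peak at x = 0. *)

(** * Distance to the nearest integer *)

Section CircleDistance.
Variable R : realType.
Implicit Types (x y : R).

(** Differencing a sharp block gives the kernel min(L, 1/||mx||), whose sum over m costs a logarithm
    and would spoil the exact orders. Ramps of length L improve it to min(L, 1/(L ||mx||^2)), which
    sums over spaced points without loss; hence the trapezoids. The resulting bound is uniform in
    the linear and constant terms of the phase, even if they depend on x, so translates of a block
    and, after a shift by pi/2, imaginary parts are covered by one estimate for real cosine sums.
    The condition on s says exactly that the exponent of a block norm is below 2s; this makes Abel
    summation converge and the partial sums Cauchy. All norm bounds hold for partial sums with
    constants independent of the upper end, so they pass to any L^p limit at the price of a constant
    factor. That a limit exists is the completeness of L^p, obtained from an almost everywhere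
    convergent subsequence and Fatou. A bound ||f||_p <= b is always written as an integral at most
    b^p, and the Hoelder, Jensen and Minkowski arguments all reduce to the tangent line of t^p. *)

Definition dist y : R := `|y - (Num.floor (y + 2^-1))%:~R|.

Lemma dist_ge0 y : 0 <= dist y. Proof. exact: normr_ge0. Qed.

Lemma dist_le_half y : dist y <= 2^-1.
Proof.
rewrite /dist; have := floor_itv (y + 2^-1); rewrite intrD => /andP[h1 h2].
by rewrite ler_norml; apply/andP; split; lra.
Qed.

Lemma dist_le y (k : int) : dist y <= `|y - k%:~R|.
Proof.
have [->|kn] := eqVneq k (Num.floor (y + 2^-1)); first exact: lexx.
have h : 1 <= `|(Num.floor (y + 2^-1))%:~R - k%:~R : R|.
  rewrite -intrB -intr_norm -[1]/(1%:~R) ler_int.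
  by rewrite -gtz0_ge1 normr_gt0 subr_eq0 eq_sym.
have := ler_distD y (Num.floor (y + 2^-1))%:~R (k%:~R : R).
have := dist_le_half y; rewrite /dist (distrC (Num.floor _)%:~R y).
by move=> h1 h2; lra.
Qed.

Lemma cos_periodz (k : int) y : cos (2 * pi * k%:~R + y) = cos y.
Proof.
have H (n : nat) (z : R) : cos (2 * pi * n%:R + z) = cos z.
  rewrite addrC -(periodicn (@cosD2pi R) n z); congr (cos (_ + _)).
  by rewrite mulr_natr mulr_natl.
case: k => n; first exact: H.
have <- := H n.+1 (2 * pi * (Negz n)%:~R + y).
rewrite NegzE mulrNz mulrN addrA subrr add0r //.
Qed.

(** On [0, 1] the mean value theorem gives slope at least cos 1; beyond 1, monotonicity and u <=
    pi/2 < 2 cost the factor 2. *)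
Lemma sin_ge_linear (u : R) : 0 <= u <= pi / 2 -> cos 1 / 2 * u <= sin u.
Proof.
move=> /andP[u0 u1]; have c1 := cos1_gt0 R.
have lin (t : R) : 0 <= t <= 1 -> cos 1 * t <= sin t.
  move=> /andP[t0 t1]; have [->|tn] := eqVneq t 0; first by rewrite sin0 mulr0.
  have t0' : 0 < t by rewrite lt0r tn.
  have [|c cin] := @MVT R sin cos 0 t t0' (fun x _ => is_derive_sin x).
    by apply: continuous_subspaceT; exact: continuous_sin.
  rewrite sin0 !subr0 => ->; rewrite ler_pM2r //.
  move: cin; rewrite in_itv /= => /andP[c0 ct].
  have ph := pihalf_ge1 R.
  by rewrite leNgt ltr_cos ?in_itv /= -?leNgt; (try apply/andP; try split); lra.
have [u1'|u1'] := leP u 1.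
  by apply: le_trans (lin u _); [rewrite ler_wpM2r//; lra | rewrite u0 u1'].
have s1 := lin 1; have := pihalf_lt2 R => p2.
have s2 : sin 1 <= sin u.
  have ph := pihalf_ge1 R.
  by rewrite leNgt ltr_sin ?in_itv /= -?leNgt; (try apply/andP; try split); lra.
have {}s1 : cos 1 * 1 <= sin 1 :> R by apply: s1; rewrite ler01 lexx.
have : cos 1 * u <= cos 1 * 2 :> R by rewrite ler_pM2l//; lra.
by lra.
Qed.

(** The right side is |1 - e(y)|^2 = 4 sin^2(pi [dist y]), with e(y) = exp(2 pi i y). *)
Lemma cos_dist : exists2 c : R, 0 < c &
  forall y, c * dist y ^+ 2 <= 2 - 2 * cos (2 * pi * y).
Proof.
have c1 := cos1_gt0 R; have p1 := pihalf_ge1 R.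
exists (cos 1 ^+ 2); first by rewrite exprn_gt0.
move=> y; set k := Num.floor (y + 2^-1).
set d := dist y; have d0 : 0 <= d := dist_ge0 y; have d1 := dist_le_half y.
have -> : cos (2 * pi * y) = cos (2 * (pi * d)).
  have -> : 2 * pi * y = 2 * pi * k%:~R + 2 * pi * (y - k%:~R) by ring.
  rewrite cos_periodz /d /dist -/k.
  have [h|h] := ger0P (y - k%:~R); first by congr cos; ring.
  by rewrite -cosN; congr cos; ring.
rewrite (mulr_natl (pi * d) 2) cos_mulr2n (cos2sin2 (pi * d)).
have hs : cos 1 / 2 * (pi * d) <= sin (pi * d).
  apply: sin_ge_linear; apply/andP; split; first by rewrite mulr_ge0 // pi_ge0.
  by rewrite ler_pM2l ?pi_gt0 // .
have h0 : cos 1 * d <= 2 * (cos 1 / 2 * (pi * d)).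
  have : 0 <= cos 1 * d * (pi - 1) by rewrite !mulr_ge0 // ?ltW //; lra.
  by lra.
have h1 : cos 1 * d <= 2 * sin (pi * d) by lra.
have : (cos 1 * d) ^+ 2 <= (2 * sin (pi * d)) ^+ 2.
  have cd0 : 0 <= cos 1 * d by rewrite mulr_ge0 // ltW.
  by rewrite ler_sqr // nnegrE (le_trans cd0 h1).
by rewrite !exprMn -[_ *+ 2]mulr_natl; lra.
Qed.

End CircleDistance.
Arguments dist {R} y.
Arguments dist_ge0 {R} y.
Arguments dist_le {R} y k.

(** * Sums of decaying weights over spaced points of the circle *)

Section Spacing.
Variable R : realType.
Implicit Types (L d x : R).

(** Comparable to min(L, 1/(L d^2)), the size of a smoothly cut exponential sum of length L whose
    frequency is at distance d from the integers; this form is monotone in d and easy to sum. *)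
Definition bump L d : R := L / (1 + L * d) ^+ 2.

Lemma bump_ge0 L d : 0 <= L -> 0 <= bump L d.
Proof. by move=> L0; rewrite divr_ge0 // sqr_ge0. Qed.

Lemma ler_div_sqr L (a b : R) : 0 <= L -> 0 < a -> a <= b -> L / b ^+ 2 <= L / a ^+ 2.
Proof.
move=> L0 a0 ab; have b0 := lt_le_trans a0 ab.
by rewrite ler_wpM2l // lef_pV2 ?posrE ?exprn_gt0 // lerXn2r // nnegrE ltW.
Qed.

Lemma bump_le L d d' : 0 <= L -> 0 <= d -> d <= d' -> bump L d' <= bump L d.
Proof.
move=> L0 d0 dd; apply: ler_div_sqr => //; first by rewrite ltr_pwDl // mulr_ge0.
by rewrite lerD2l ler_wpM2l.
Qed.

(** Comparison with the integral of L/(1 + L d t)^2. The strengthened induction carries the first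
    term L and the exact integral d^-1 (1 - 1/(1 + L d K)). *)
Lemma sum_bump L d (K : nat) : 0 < L -> 0 < d ->
  \sum_(0 <= k < K) bump L (d * k%:R) <= L + d^-1.
Proof.
move=> L0 d0; suff H : \sum_(0 <= k < K.+1) bump L (d * k%:R)
    <= L + d^-1 * (1 - (1 + L * (d * K%:R))^-1).
  case: K H => [|K] H; first by rewrite big_geq // addr_ge0 ?invr_ge0 ?ltW.
  rewrite big_nat_recr //= in H.
  have h1 := bump_ge0 L (d * K.+1%:R) (ltW L0).
  have h2 : 0 <= d^-1 * (1 + L * (d * K.+1%:R))^-1.
    by rewrite mulr_ge0 ?invr_ge0 ?addr_ge0 ?mulr_ge0 ?ltW.
  by move: H; rewrite mulrBr mulr1; lra.
elim: K => [|K IH].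
  by rewrite big_nat1 !mulr0 addr0 invr1 subrr mulr0 addr0 /bump mulr0 addr0 expr1n divr1.
rewrite big_nat_recr //=; apply: le_trans (lerD IH (lexx _)) _.
rewrite -addrA lerD2l; set a := 1 + L * (d * K%:R); set b := 1 + L * (d * K.+1%:R).
have a1 : 0 < a by rewrite ltr_pwDl // mulr_ge0 ?mulr_ge0 // ltW.
have ab : b = a + L * d by rewrite /a /b -natr1; ring.
have b1 : 0 < b by rewrite ab addr_gt0 // mulr_gt0.
rewrite -subr_ge0 /bump -/b.
have -> : d^-1 * (1 - b^-1) - (d^-1 * (1 - a^-1) + L / b ^+ 2) = L ^+ 2 * d / (a * b ^+ 2).
  by rewrite ab; field; rewrite -ab !gt_eqF.
by rewrite divr_ge0 ?mulr_ge0 ?sqr_ge0 ?ltW.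
Qed.

Lemma ler_sum_inj_lt (g : nat -> R) (P : pred nat) (f : nat -> nat) (n K : nat) :
  (forall k, 0 <= g k) -> (forall i, P i -> (i < n)%N -> (f i < K)%N) ->
  {in [pred i | P i && (i < n)%N] &, injective f} ->
  \sum_(0 <= i < n | P i) g (f i) <= \sum_(0 <= k < K) g k.
Proof.
move=> g0 fK finj; rewrite -big_filter; set s := [seq i <- _ | _].
have us : uniq (map f s).
  rewrite map_inj_in_uniq ?filter_uniq ?iota_uniq // => i j.
  by rewrite !mem_filter !mem_index_iota /= => h1 h2; apply: finj; rewrite inE.
have tK k : k \in map f s -> (k < K)%N.
  by case/mapP => i; rewrite mem_filter mem_index_iota /= => /andP[Pi ilt] ->; exact: fK.
rewrite -(big_map f predT g); set t := map f s in us tK *.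
have -> : \sum_(k <- t) g k = \sum_(0 <= k < K | k \in t) g k.
  rewrite -[RHS]big_filter; apply: perm_big; apply: uniq_perm => //.
    by rewrite filter_uniq // iota_uniq.
  move=> k; rewrite mem_filter mem_index_iota /=.
  by case kt : (k \in t) => //=; rewrite tK.
by rewrite big_mkcond /=; apply: ler_sum => k _; case: ifP.
Qed.

Lemma ler_sum_inj (g : nat -> R) (S : R) (P : pred nat) (f : nat -> nat) (n : nat) :
  (forall k, 0 <= g k) -> (forall K, \sum_(0 <= k < K) g k <= S) ->
  {in [pred i | P i && (i < n)%N] &, injective f} ->
  \sum_(0 <= i < n | P i) g (f i) <= S.
Proof.
move=> g0 gS finj; apply: le_trans (gS (\max_(i < n) f i).+1).
apply: ler_sum_inj_lt => // i _ ilt; rewrite ltnS.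
exact: (@leq_bigmax _ (fun i : 'I_n => f i) (Ordinal ilt)).
Qed.

(** Points whose signed residues have the same sign occupy distinct cells of width d: two in one
    cell would put some m x with 0 < m < n within d of an integer. The two signs give the factor
    2. *)
Lemma sum_bump_spaced L d x (a n : nat) : 0 < L -> 0 < d ->
  (forall m, (0 < m < n)%N -> d <= dist (m%:R * x)) ->
  \sum_(0 <= i < n) bump L (dist ((a + i)%:R * x)) <= 2 * (L + d^-1).
Proof.
move=> L0 d0 sp.
pose r i : int := Num.floor ((a + i)%:R * x + 2^-1).
pose y i : R := (a + i)%:R * x - (r i)%:~R.
pose f i := Num.truncn (`|y i| / d).
have fP i : d * (f i)%:R <= `|y i| < d * (f i)%:R + d.
  have : 0 <= `|y i| / d by rewrite divr_ge0 ?normr_ge0 // ltW.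
  move/truncn_itv; rewrite -/(f i) ler_pdivlMr // ltr_pdivrMr // -natr1 mulrDl mul1r.
  by rewrite !(mulrC d).
have inj (P : pred nat) : (forall i j, P i -> P j -> `|y i - y j| = `| `|y i| - `|y j| |) ->
    {in [pred i | P i && (i < n)%N] &, injective f}.
  move=> HP i j; rewrite !inE => /andP[Pi ilt] /andP[Pj jlt] fij.
  wlog lij : i j Pi ilt Pj jlt fij / (i <= j)%N.
    by move=> W; case/orP: (leq_total i j) => h; [exact: W | apply/esym/W].
  apply/eqP; rewrite eqn_leq lij leqNgt; apply/negP => lt_ij.
  have := sp (j - i)%N; have -> : (0 < j - i < n)%N by lia.
  move/(_ isT); apply/negP; rewrite -ltNge.
  apply: le_lt_trans (dist_le _ (r j - r i)) _.
  have -> : (j - i)%:R * x - (r j - r i)%:~R = y j - y i.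
    by rewrite /y natrB // intrB !natrD; ring.
  rewrite HP //; move: (fP i) (fP j); rewrite fij => /andP[h1 h2] /andP[h3 h4].
  by rewrite ltr_norml; apply/andP; split; lra.
have half (P : pred nat) : (forall i j, P i -> P j -> `|y i - y j| = `| `|y i| - `|y j| |) ->
    \sum_(0 <= i < n | P i) bump L (dist ((a + i)%:R * x)) <= L + d^-1.
  move=> HP; apply: le_trans (@ler_sum_inj (fun k => bump L (d * k%:R)) _ P f n _ _ _).
  - apply: ler_sum => i _; apply: bump_le; first exact: ltW.
      by rewrite mulr_ge0 // ltW.
    by case/andP: (fP i).
  - by move=> k; rewrite bump_ge0 // ltW.
  - by move=> K; exact: sum_bump.
  - exact: inj.
rewrite (bigID (fun i => 0 <= y i)) /=.
have h1 := half (fun i => 0 <= y i); have h2 := half (fun i => ~~ (0 <= y i)).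
have -> : 2 * (L + d^-1) = (L + d^-1) + (L + d^-1) by ring.
apply: lerD.
  by apply: h1 => i j i0 j0; rewrite (ger0_norm i0) (ger0_norm j0).
apply: h2 => i j; rewrite -!ltNge => i0 j0; rewrite (ltr0_norm i0) (ltr0_norm j0).
by rewrite -normrN; congr `| _ |; ring.
Qed.

End Spacing.

(** * The best denominator and the Weyl majorant *)

Section MajorArc.
Variable R : realType.
Implicit Types (x : R).

(** The least minimizer is wanted: strictness at smaller m is what [dist_before_argmin] converts
    into a spacing of the points m x with m < q. *)
Lemma exists_least_argmin (h : nat -> R) (Q : nat) : (0 < Q)%N ->
  exists2 q, (0 < q <= Q)%N & (forall m, (0 < m <= Q)%N -> h q <= h m) /\
    (forall m, (0 < m < q)%N -> h q < h m).
Proof.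
move=> Q0; pose P q := (0 < q <= Q)%N && [forall m : 'I_Q, h q <= h m.+1].
have PP q : P q -> (0 < q <= Q)%N /\ forall m, (0 < m <= Q)%N -> h q <= h m.
  move=> /andP[q0 /forallP H]; split=> // -[|m] //= mQ; exact: (H (Ordinal mQ)).
have exP : exists q, P q.
  have [i _ Hi] := @arg_minP _ _ 'I_Q (Ordinal Q0) xpredT (fun i => h i.+1) isT.
  exists i.+1; rewrite /P ltn_ord /=; apply/forallP => m; exact: Hi.
case: (ex_minnP exP) => q Pq qmin; have [qQ qm] := PP _ Pq.
exists q => //; split=> // m /andP[m0 mq]; rewrite ltNge; apply/negP => hmq.
have : P m.
  rewrite /P m0 /=; apply/andP; split; first by apply: leq_trans (ltnW mq) _; case/andP: qQ.
  by apply/forallP => k; apply: le_trans hmq _; apply: qm; rewrite /= ltn_ord.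
by move/qmin; rewrite leqNgt mq.
Qed.

(* If both ||mx|| and ||qx|| were below 1/(2Q), the integer m*a_q - q*a_m would be
   smaller than 1 in absolute value, so m*a_q = q*a_m and ||mx|| = (m/q) ||qx||. *)
Lemma dist_before_argmin x (Q q m : nat) : (0 < q <= Q)%N -> (0 < m < q)%N ->
  dist (q%:R * x) < dist (m%:R * x) -> (2 * Q%:R)^-1 <= dist (m%:R * x).
Proof.
move=> /andP[q0 qQ] /andP[m0 mq] lt_qm; rewrite leNgt; apply/negP => small.
have Q0 : 0 < Q%:R :> R by rewrite ltr0n (leq_trans q0).
set aq := Num.floor (q%:R * x + 2^-1); set am := Num.floor (m%:R * x + 2^-1).
have hq : `|q%:R * x - aq%:~R| = dist (q%:R * x) by [].
have hm : `|m%:R * x - am%:~R| = dist (m%:R * x) by [].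
set eq' := q%:R * x - aq%:~R in hq; set em := m%:R * x - am%:~R in hm.
have qQR : q%:R <= Q%:R :> R by rewrite ler_nat.
have mqR : m%:R <= q%:R :> R by rewrite ler_nat ltnW.
have m0R : 0 < m%:R :> R by rewrite ltr0n.
have q0R : 0 < q%:R :> R by rewrite ltr0n.
have small' : dist (m%:R * x) * Q%:R < 2^-1.
  by move: small; rewrite invfM -ltr_pdivlMr.
have E : (q%:Z * am - m%:Z * aq)%:~R = m%:R * eq' - q%:R * em :> R.
  by rewrite /eq' /em intrB !intrM -!pmulrn; ring.
have lt1 : `|m%:R * eq' - q%:R * em| < 1.
  apply: le_lt_trans (ler_normB _ _) _; rewrite !normrM !normr_nat hq hm.
  have h1 : m%:R * dist (q%:R * x) <= Q%:R * dist (m%:R * x).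
    by apply: ler_pM; rewrite ?dist_ge0 // ?(le_trans mqR) // ltW.
  have h2 : q%:R * dist (m%:R * x) <= Q%:R * dist (m%:R * x).
    by apply: ler_wpM2r; rewrite ?dist_ge0.
  by move: h1 h2 small'; rewrite (mulrC Q%:R); lra.
have Z0 : (q%:Z * am - m%:Z * aq) = 0.
  apply/eqP; rewrite -normr_le0 -ltz1D addr0 -(ltr_int R) intr_norm E.
  exact: lt1.
have E0 : m%:R * eq' = q%:R * em by apply/eqP; rewrite -subr_eq0 -E Z0.
have : m%:R * dist (q%:R * x) = q%:R * dist (m%:R * x).
  by have := congr1 Num.norm E0; rewrite !normrM !normr_nat hq hm.
have : m%:R * dist (q%:R * x) < q%:R * dist (m%:R * x).
  apply: le_lt_trans (_ : q%:R * dist (q%:R * x) < _); last by rewrite ltr_pM2l.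
  by rewrite ler_wpM2r ?dist_ge0.
by move=> + eqq; rewrite eqq ltxx.
Qed.

(** The range 16 L accommodates the frequencies 2 h with h < 8 L that arise from differencing a
    quadratic phase on a support of length 8 L. *)
Definition weyl_majorant (L : nat) x : R :=
  \sum_(0 <= m < 16 * L) bump R L%:R (dist (m%:R * x)).

(** Within q consecutive indices the points are 1/(32 L)-spaced, so a block of length q sums to at
    most 2 (L + 32 L) = 66 L; at most 32 L/q blocks cover the range, and 66 * 32 = 2112. The second
    bound uses the spacing [dist (q x)], valid on the whole range by minimality. *)
Lemma weyl_majorant_arc (L : nat) x : (0 < L)%N ->
  exists2 q, (0 < q <= 16 * L)%N &
    weyl_majorant L x <= 2112 * (L%:R ^+ 2 / q%:R) /\
    (0 < dist (q%:R * x) -> weyl_majorant L x <= 2 * (L%:R + (dist (q%:R * x))^-1)).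
Proof.
move=> L0; have L0R : 0 < L%:R :> R by rewrite ltr0n.
have Q0 : (0 < 16 * L)%N by rewrite muln_gt0.
have [q /andP[q0 qQ] [qmin qlt]] := @exists_least_argmin (fun m => dist (m%:R * x)) _ Q0.
exists q; first by rewrite q0.
have q0R : 0 < q%:R :> R by rewrite ltr0n.
split; last first.
  move=> d0; have := @sum_bump_spaced R L%:R _ x 0 (16 * L) L0R d0.
  by apply=> m /andP[m0 mQ]; apply: qmin; rewrite m0 ltnW.
have block a : \sum_(0 <= i < q) bump R L%:R (dist ((a + i)%:R * x)) <= 66 * L%:R.
  have := @sum_bump_spaced R L%:R (32 * L%:R)^-1 x a q L0R; rewrite invrK.
  have -> : 2 * (L%:R + 32 * L%:R) = 66 * L%:R :> R by ring.
  apply; first by rewrite invr_gt0 mulr_gt0.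
  move=> m mq; have := @dist_before_argmin x (16 * L) q m _ mq (qlt m mq).
  by rewrite q0 qQ natrM mulrA -natrM; apply.
have blocks J : \sum_(0 <= m < J * q) bump R L%:R (dist (m%:R * x)) <= J%:R * (66 * L%:R).
  elim: J => [|J IH]; first by rewrite mul0n big_geq // mul0r.
  rewrite (big_cat_nat (n := J * q)) //=; last by rewrite leq_mul2r leqnSn orbT.
  rewrite -natr1 mulrDl mul1r; apply: lerD => //.
  rewrite -[X in \sum_(X <= _ < _) _]add0n big_addn mulSn addnK.
  by under eq_bigr do rewrite addnC.
set J := ((16 * L) %/ q).+1.
apply: le_trans (le_trans (_ : _ <= \sum_(0 <= m < J * q) bump R L%:R (dist (m%:R * x))) (blocks J)) _.
  rewrite [leRHS](big_cat_nat (n := 16 * L)) //=; last by rewrite ltnW // ltn_ceil.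
  by rewrite lerDl sumr_ge0 // => i _; rewrite bump_ge0 // ltW.
have JR : J%:R <= 32 * L%:R / q%:R :> R.
  rewrite ler_pdivlMr // -!natrM ler_nat /J mulSn.
  by have := leq_trunc_div (16 * L) q; lia.
apply: le_trans (ler_wpM2r _ JR) _; first by rewrite mulr_ge0 // ltW.
by rewrite expr2; lra.
Qed.

End MajorArc.

(** * Weyl differencing with smooth weights *)

Section WeylDifferencing.
Variable R : realType.
Implicit Types (v w : nat -> R).

Definition diff2 v n : R := v n.+2 - 2 * v n.+1 + v n.

(** Green's identity for second differences: n -> cos(n t + c) is an eigenfunction with eigenvalue
    -(2 - 2 cos t), so only boundary terms remain. *)
Lemma sum_diff2_cos v (t c : R) (m : nat) :
  \sum_(0 <= n < m) (diff2 v n + (2 - 2 * cos t) * v n.+1) * cos (n.+1%:R * t + c) =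
  v m.+1 * cos (m%:R * t + c) - v m * cos (m.+1%:R * t + c)
  - (v 1%N * cos c - v 0%N * cos (t + c)).
Proof.
elim: m => [|m IH]; first by rewrite big_geq // !mul0r !mul1r !add0r subrr.
rewrite big_nat_recr //= {}IH.
have -> : m.+2%:R * t + c = (m.+1%:R * t + c) + t by rewrite -[m.+2]addn1 natrD; ring.
have -> : m%:R * t + c = (m.+1%:R * t + c) - t by rewrite -[m.+1]addn1 natrD; ring.
set A := m.+1%:R * t + c; rewrite (cosB A) (cosD A) /diff2; ring.
Qed.

(** Two initial zeros and the vanishing from H on remove the boundary terms. As 2 - 2 cos t is
    quadratic in the distance to the integers, two powers of it are gained. *)
Lemma sum_cos_diff2 v (t c : R) (H : nat) : v 0%N = 0 -> v 1%N = 0 ->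
  (forall n, (H <= n)%N -> v n = 0) ->
  (2 - 2 * cos t) * `|\sum_(0 <= n < H) v n * cos (n%:R * t + c)| <=
  \sum_(0 <= n < H) `|diff2 v n|.
Proof.
move=> v0 v1 vH.
have E : (2 - 2 * cos t) * (\sum_(0 <= n < H) v n * cos (n%:R * t + c)) =
    - \sum_(0 <= n < H) diff2 v n * cos (n.+1%:R * t + c).
  have := sum_diff2_cos v t c H.
  rewrite v0 v1 !vH // !mul0r !subr0 => /eqP.
  under eq_bigr do rewrite mulrDl.
  rewrite big_split /= addr_eq0 => /eqP ->; rewrite opprK.
  rewrite mulr_sumr; have -> : \sum_(0 <= n < H) (2 - 2 * cos t) * (v n * cos (n%:R * t + c)) =
    \sum_(0 <= n < H.+1) (2 - 2 * cos t) * (v n * cos (n%:R * t + c)).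
    by rewrite big_nat_recr //= vH // mul0r mulr0 addr0.
  rewrite big_nat_recl // v0 mul0r mulr0 add0r.
  by apply: eq_bigr => i _; rewrite mulrA.
have c0 : 0 <= 2 - 2 * cos t by have := cos_le1 t; lra.
rewrite -[X in X * _]ger0_norm // -normrM E normrN.
apply: le_trans (ler_norm_sum _ _ _) _; apply: ler_sum => i _.
by rewrite normrM ler_piMr // cos_max.
Qed.

(** A cutoff of height 1, slope 1/L and total second variation 4/L. The last condition bounds a sum
    because a piecewise linear weight concentrates its second difference at its kinks; 4 allows for
    four kinks of size 1/L. *)
Definition tame (L : nat) w := [/\ w 0%N = 0, w 1%N = 0,
  forall n, (8 * L <= n)%N -> w n = 0,
  (forall n, `|w n| <= 1) /\ (forall n, `|w n.+1 - w n| <= L%:R^-1) &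
  forall K, \sum_(0 <= n < K) `|diff2 w n| <= 4 / L%:R].

(** Leibniz rule for the second difference of a product, meant for w(n) w(n + h); l <= 1 bounds b1 +
    (b1 - b0) by 2. *)
Lemma diff2M_le (a0 a1 a2 b0 b1 b2 l : R) : l <= 1 ->
  `|b1| <= 1 -> `|a2| <= 1 -> `|a1 - a0| <= l -> `|b1 - b0| <= l ->
  `|a2 * b2 - 2 * (a1 * b1) + a0 * b0| <=
  2 * l ^+ 2 + 2 * `|a2 - 2 * a1 + a0| + `|b2 - 2 * b1 + b0|.
Proof.
move=> l1 hb ha hd he.
have -> : a2 * b2 - 2 * (a1 * b1) + a0 * b0 =
  2 * ((a1 - a0) * (b1 - b0)) + (a2 - 2 * a1 + a0) * (b1 + (b1 - b0))
  + a2 * (b2 - 2 * b1 + b0) by ring.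
apply: le_trans (ler_normD _ _) _; apply: lerD; last by rewrite normrM ler_piMl.
apply: le_trans (ler_normD _ _) _; apply: lerD.
  rewrite normrM normr_nat ler_pM2l // normrM expr2; exact: ler_pM.
rewrite normrM mulrC ler_wpM2r //; apply: le_trans (ler_normD _ _) _; lra.
Qed.

(** Pairs are grouped by their difference h, as differencing requires; doubling counts the diagonal
    twice, hence the correction. *)
Lemma sum_symmetric (F : nat -> nat -> R) (H : nat) : (forall n m, F n m = F m n) ->
  \sum_(0 <= n < H) \sum_(0 <= m < H) F n m =
  2 * (\sum_(0 <= h < H) \sum_(0 <= n < H - h) F n (n + h)%N) - \sum_(0 <= n < H) F n n.
Proof.
move=> sym; elim: H => [|H IH]; first by rewrite !big_geq // mulr0 subrr.
rewrite [LHS]big_nat_recr //= [in LHS]big_nat_recr //=.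
under eq_bigr do rewrite big_nat_recr //=.
rewrite big_split /= {}IH [\sum_(0 <= n < H.+1) F n n]big_nat_recr //=.
have -> : \sum_(0 <= h < H.+1) \sum_(0 <= n < H.+1 - h) F n (n + h)%N =
    \sum_(0 <= h < H) \sum_(0 <= n < H - h) F n (n + h)%N + \sum_(0 <= n < H.+1) F n H.
  rewrite [X in _ = _ + X]big_nat_rev /= add0n.
  have -> : \sum_(0 <= h < H) \sum_(0 <= n < H - h) F n (n + h)%N =
            \sum_(0 <= h < H.+1) \sum_(0 <= n < H - h) F n (n + h)%N.
    by rewrite [RHS]big_nat_recr //= subnn [X in _ + X]big_geq // addr0.
  rewrite -big_split /=; apply: eq_big_nat => h /andP[_ hH].
  rewrite subSn // big_nat_recr //= subSS; congr (_ + F _ _).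
  by rewrite subnK.
have -> : \sum_(0 <= n < H.+1) F n H = \sum_(0 <= n < H) F n H + F H H by rewrite big_nat_recr.
have -> : \sum_(0 <= n < H) F H n = \sum_(0 <= n < H) F n H by apply: eq_bigr.
by ring.
Qed.

(** The square of the cosine sum is at most the squared modulus of the exponential sum. Grouped by
    h, the latter has phases linear in n with frequency 2 h x; the coefficients y and c enter only
    through a constant phase, whence the uniformity. *)
Lemma weyl_bound : exists2 C : R, 0 < C & forall (L : nat) w (x y c : R),
  (0 < L)%N -> tame L w ->
  (\sum_(0 <= n < 8 * L) w n * cos (2 * pi * x * n%:R ^+ 2 + y * n%:R + c)) ^+ 2
  <= C * weyl_majorant R L x.
Proof.
have [c0 c0_gt0 Hc0] := cos_dist R.
(* The summand 32 serves L d <= 1, where the trivial bound 8 L is at most 32 times the bump; 128/c0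
   serves L d > 1, where second differences decide. *)
pose C1 := 32 + 128 / c0; have C1_gt0 : 0 < C1 by rewrite addr_gt0 // divr_gt0.
exists (2 * C1); first by rewrite mulr_gt0.
move=> L w x y c L0 [w0 w1 wH [wle1 wd] wd2]; set H := (8 * L)%N.
have L0R : 0 < L%:R :> R by rewrite ltr0n.
have L1R : 1 <= L%:R :> R by rewrite ler1n.
pose ph n : R := 2 * pi * x * n%:R ^+ 2 + y * n%:R + c.
pose v h n := w n * w (n + h)%N.
have inner h : `|\sum_(0 <= n < H) v h n * cos (ph (n + h)%N - ph n)|
    <= C1 * bump R L%:R (dist ((2 * h)%:R * x)).
  pose t := 2 * pi * ((2 * h)%:R * x).
  pose c' := 2 * pi * x * h%:R ^+ 2 + y * h%:R.
  have -> : \sum_(0 <= n < H) v h n * cos (ph (n + h)%N - ph n) =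
      \sum_(0 <= n < H) v h n * cos (n%:R * t + c').
    by apply: eq_bigr => n _; congr (_ * cos _); rewrite /ph /t /c' (natrM _ 2 h) (natrD _ n h); ring.
  set S := \sum_(_ <= _ < _) _.
  have S1 : `|S| <= 8 * L%:R.
    apply: le_trans (ler_norm_sum _ _ _) _.
    apply: le_trans (_ : \sum_(0 <= n < H) 1 <= _).
      apply: ler_sum => n _; rewrite normrM -[leRHS]mulr1; apply: ler_pM => //.
        by rewrite normrM -[leRHS]mulr1; apply: ler_pM.
      exact: cos_max.
    by rewrite sumr_const_nat subn0 /H natrM.
  have v0 : v h 0%N = 0 by rewrite /v w0 mul0r.
  have v1 : v h 1%N = 0 by rewrite /v w1 mul0r.
  have vH n : (H <= n)%N -> v h n = 0 by move=> Hn; rewrite /v wH // mul0r.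
  have S2 : c0 * dist ((2 * h)%:R * x) ^+ 2 * `|S| <= 32 / L%:R.
    apply: le_trans (_ : (2 - 2 * cos t) * `|S| <= _).
      by rewrite ler_wpM2r.
    apply: le_trans (sum_cos_diff2 (v h) t c' H v0 v1 vH) _.
    apply: le_trans (_ : \sum_(0 <= n < H)
       (2 * L%:R^-1 ^+ 2 + 2 * `|diff2 w n| + `|diff2 w (n + h)%N|) <= _).
      apply: ler_sum => n _; rewrite /diff2 /v !addSn; apply: diff2M_le => //.
      by rewrite invf_le1.
    rewrite !big_split /= -mulr_sumr sumr_const_nat subn0.
    have h1 := wd2 H.
    have h2 : \sum_(0 <= n < H) `|diff2 w (n + h)%N| <= 4 / L%:R.
      apply: (@ler_sum_inj R (fun k => `|diff2 w k|) _ xpredT (fun n => (n + h)%N)) => //.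
      by move=> i j _ _ /addIn.
    have -> : L%:R^-1 ^+ 2 *+ H = 8 / L%:R :> R.
      by rewrite -(mulr_natr _ H) /H natrM; field; rewrite gt_eqF.
    have Li : 0 <= L%:R^-1 :> R by rewrite invr_ge0.
    rewrite -mulr_sumr; lra.
  move: S2; set d := dist _; have d0 : 0 <= d := dist_ge0 _.
  rewrite /bump => S2; have [Ld|Ld] := leP (L%:R * d) 1.
    have Ld1 : 0 < 1 + L%:R * d by rewrite ltr_pwDl // mulr_ge0 // ltW.
    have hb : L%:R / 4 <= L%:R / (1 + L%:R * d) ^+ 2.
      have -> : 4 = 2 ^+ 2 :> R by rewrite -natrX.
      by apply: ler_div_sqr => //; lra.
    have k : 0 <= 128 / c0 * (L%:R / (1 + L%:R * d) ^+ 2).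
      by rewrite !mulr_ge0 ?invr_ge0 ?sqr_ge0 ?(ltW L0R) ?(ltW c0_gt0).
    rewrite /C1 mulrDl; lra.
  have dp : 0 < d by move: Ld; rewrite lt0r d0 andbT; apply: contraTN => /eqP ->; rewrite mulr0; lra.
  have hb : (4 * L%:R * d ^+ 2)^-1 <= L%:R / (1 + L%:R * d) ^+ 2.
    have -> : (4 * L%:R * d ^+ 2)^-1 = L%:R / (2 * (L%:R * d)) ^+ 2.
      by field; rewrite !gt_eqF.
    by apply: ler_div_sqr => //; lra.
  have h3 : `|S| <= 128 / c0 * (4 * L%:R * d ^+ 2)^-1.
    have -> : 128 / c0 * (4 * L%:R * d ^+ 2)^-1 = 32 / L%:R / (c0 * d ^+ 2).
      by field; rewrite !gt_eqF.
    by rewrite ler_pdivlMr ?mulr_gt0 ?exprn_gt0 // mulrC.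
  apply: le_trans h3 _; apply: le_trans (ler_wpM2l _ hb) _; first by rewrite divr_ge0 // ltW.
  rewrite ler_wpM2r ?divr_ge0 ?sqr_ge0 ?ltW // /C1; lra.
pose F n m := w n * w m * cos (ph m - ph n).
have sq : (\sum_(0 <= n < H) w n * cos (ph n)) ^+ 2 <= \sum_(0 <= n < H) \sum_(0 <= m < H) F n m.
  have -> : \sum_(0 <= n < H) \sum_(0 <= m < H) F n m =
    (\sum_(0 <= n < H) w n * cos (ph n)) ^+ 2 + (\sum_(0 <= n < H) w n * sin (ph n)) ^+ 2.
    rewrite !expr2 !mulr_suml -big_split /=; apply: eq_bigr => n _.
    rewrite !mulr_sumr -big_split /=; apply: eq_bigr => m _.
    by rewrite /F cosB; ring.
  by rewrite lerDl sqr_ge0.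
apply: le_trans sq _; rewrite sum_symmetric; last first.
  by move=> n m; rewrite /F -cosN opprB (mulrC (w n)).
apply: le_trans (_ : 2 * (\sum_(0 <= h < H) C1 * bump R L%:R (dist ((2 * h)%:R * x))) <= _).
  rewrite lerBlDr; apply: ler_wpDr.
    apply: sumr_ge0 => n _; rewrite /F subrr cos0 mulr1 -expr2; exact: sqr_ge0.
  rewrite ler_pM2l //; apply: ler_sum_nat => h /andP[_ hH].
  apply: le_trans (ler_norm _) _; apply: le_trans (inner h).
  rewrite [X in _ <= `|X|](big_cat_nat (n := (H - h)%N)) //=; last exact: leq_subr.
  have -> : \sum_(H - h <= n < H) v h n * cos (ph (n + h)%N - ph n) = 0.
    rewrite big_nat big1 // => n /andP[hn _]; rewrite /v (wH (n + h)%N) ?mulr0 ?mul0r //; lia.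
  by rewrite addr0.
rewrite -mulr_sumr mulrA ler_pM2l ?mulr_gt0 //.
apply: (@ler_sum_inj_lt R (fun k => bump R L%:R (dist (k%:R * x))) xpredT (fun h => (2 * h)%N)).
- by move=> k; rewrite bump_ge0 // ltW.
- by move=> h _; rewrite /H; lia.
- by move=> i j _ _ /eqP; rewrite eqn_mul2l => /eqP.
Qed.

End WeylDifferencing.

(** * Convexity inequalities for real powers *)

Section PowerInequalities.
Variable R : realType.
Implicit Types (p t u : R).

Lemma powRD_gt0 (x a b : R) : 0 < x -> x `^ (a + b) = x `^ a * x `^ b.
Proof. by move=> x0; rewrite powRD // (gt_eqF x0) implybT. Qed.

Lemma powR_exprn (x a : R) (n : nat) : 0 <= x -> (x ^+ n) `^ a = (x `^ a) ^+ n.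
Proof. by move=> x0; rewrite -!powR_mulrn ?powR_ge0 // powRAC. Qed.

Lemma geometric_sum (t : R) (n : nat) :
  (\sum_(0 <= i < n) t ^+ i) * (1 - t) = 1 - t ^+ n.
Proof.
elim: n => [|n IH]; first by rewrite big_geq // mul0r expr0 subrr.
by rewrite big_nat_recr //= mulrDl IH exprS; ring.
Qed.

Lemma sum_nat_eq0 (m n : nat) (F : nat -> R) :
  (forall i, (m <= i < n)%N -> F i = 0) -> \sum_(m <= i < n) F i = 0.
Proof. by move=> F0; rewrite big_nat big1. Qed.

(** Young's inequality for t and u^(p-1) with exponents p and p/(p-1); this route includes u = 0. It
    later yields Minkowski, the comparison of L^q with L^p, and the test against a Fejer kernel. *)
Lemma powR_tangent p t u : 1 <= p -> 0 <= t -> 0 <= u ->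
  u `^ p + p * u `^ (p - 1) * (t - u) <= t `^ p.
Proof.
move=> p1 t0 u0; have [->|pn] := eqVneq p 1.
  by rewrite subrr powRr0 !powRr1 // mulr1 mul1r addrC subrK.
have p1' : 0 < p - 1 by rewrite subr_gt0 lt_neqAle eq_sym pn.
have p0 : 0 < p by lra.
have Y := @conjugate_powR R t (u `^ (p - 1)) p (p / (p - 1)) t0 (powR_ge0 _ _) p0.
have {Y} : t * u `^ (p - 1) <= t `^ p / p + (u `^ (p - 1)) `^ (p / (p - 1)) / (p / (p - 1)).
  apply: Y; first by rewrite divr_gt0.
  by field; rewrite !gt_eqF.
have -> : (u `^ (p - 1)) `^ (p / (p - 1)) = u `^ p.
  by rewrite -powRrM; congr (_ `^ _); field; rewrite gt_eqF.
have U := mulr_powRB1 u0 p0.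
rewrite -(ler_pM2l p0) => Y.
have E : p * (t `^ p / p + u `^ p / (p / (p - 1))) = t `^ p + (p - 1) * u `^ p.
  by field; rewrite !gt_eqF.
move: Y; rewrite E -U; lra.
Qed.

(** Jensen for the ratios h_k/b_k with weights b_k/B, B being the sum of the b_k. Choosing b_k as a
    bound for the norm of h_k makes its integral the Minkowski inequality. *)
Lemma powR_sum_convex p (n : nat) (b h : nat -> R) : 1 <= p ->
  (forall k, 0 < b k) -> (forall k, 0 <= h k) ->
  (\sum_(0 <= k < n.+1) h k) `^ p <=
  \sum_(0 <= k < n.+1) (\sum_(0 <= i < n.+1) b i) `^ p * (b k / (\sum_(0 <= i < n.+1) b i) / b k `^ p) * h k `^ p.
Proof.
move=> p1 b0 h0; set B := \sum_(0 <= i < n.+1) b i; set S := \sum_(0 <= k < n.+1) h k.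
have B0 : 0 < B.
  rewrite /B big_nat_recl //; apply: ltr_pwDl => //; apply: sumr_ge0 => i _; exact: ltW.
have S0 : 0 <= S by apply: sumr_ge0 => i _.
have p0 : 0 < p by lra.
pose u := S / B; have u0 : 0 <= u by rewrite divr_ge0 // ltW.
have tang k : b k / B * (u `^ p + p * u `^ (p - 1) * (h k / b k - u)) <=
    b k / B / b k `^ p * h k `^ p.
  rewrite -(mulrA (b k / B)) ler_pM2l ?divr_gt0 //.
  have -> : (b k `^ p)^-1 * h k `^ p = (h k / b k) `^ p.
    rewrite powRM // ?invr_ge0 ?(ltW (b0 k)) // mulrC -(powR_inv1 (ltW (b0 k))) -powRrM.
    by rewrite mulN1r powRN.
  by apply: powR_tangent => //; rewrite divr_ge0 // ltW.
have -> : S `^ p = B `^ p * u `^ p.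
  by rewrite /u -powRM ?divr_ge0 ?(ltW B0) // mulrC divfK // gt_eqF.
under eq_bigr do rewrite -mulrA.
rewrite -/B -mulr_sumr ler_pM2l ?powR_gt0 //.
apply: le_trans (_ : \sum_(0 <= k < n.+1)
   b k / B * (u `^ p + p * u `^ (p - 1) * (h k / b k - u)) <= _); last first.
  by apply: ler_sum => k _; exact: tang.
have -> : \sum_(0 <= k < n.+1) b k / B * (u `^ p + p * u `^ (p - 1) * (h k / b k - u)) =
  \sum_(0 <= k < n.+1) (b k * (u `^ p / B - p * u `^ (p - 1) * u / B) +
    h k * (p * u `^ (p - 1) / B)).
  by apply: eq_bigr => k _; field; rewrite !gt_eqF.
rewrite big_split /= -!mulr_suml -/B -/S.
rewrite le_eqVlt; apply/orP; left; apply/eqP.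
have -> : S = u * B by rewrite /u divfK // gt_eqF.
by field; rewrite gt_eqF.
Qed.

Lemma powR_diff (e x : R) : 0 < x ->
  exists2 c, x < c < x + 1 & (x + 1) `^ e - x `^ e = e * c `^ (e - 1).
Proof.
move=> x0; have xx : x < x + 1 by rewrite ltrDl.
have [||c cin] := @MVT R (fun t => t `^ e) (fun t => e * t `^ (e - 1)) x (x + 1) xx.
- move=> t; rewrite in_itv /= => /andP[xt _]; apply: is_derive1_powR; exact: lt_trans xt.
- apply: derivable_within_continuous => t; rewrite in_itv /= => /andP[xt _].
  by apply: derivable_powR; rewrite in_itv /= andbT (lt_le_trans x0).
by rewrite addrAC subrr add0r mulr1 => E; exists c => //; move: cin; rewrite in_itv.
Qed.

End PowerInequalities.

(** * Powers of L^p norms and the Minkowski inequality *)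

Section LpNorm.
Variable R : realType.
Implicit Types (p : R) (f : R -> R).

Local Notation I01 := (`[0%R : R, 1%R : R]%classic).
Local Notation mfun01 := (@measurable_fun _ _ (measurableTypeR R) (measurableTypeR R) I01).

Definition Lp_pow p f : \bar R :=
  (\int[@lebesgue_measure R]_(x in `[0%R:R, 1%R:R]) (`|f x| `^ p)%:E)%E.

Lemma measurable_I01 : measurable (I01 : set (measurableTypeR R)).
Proof. exact: measurable_itv. Qed.

Lemma measure_I01 : lebesgue_measure I01 = 1%E.
Proof. by rewrite lebesgue_measure_itv /= lte01 oppr0 adde0. Qed.

Lemma integral01_cst (c : R) :
  (\int[@lebesgue_measure R]_(x in `[0%R:R, 1%R:R]) c%:E = c%:E)%E.
Proof.
rewrite integral_cst; last exact: measurable_I01.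
by rewrite [X in (_ * X)%E]measure_I01 mule1.
Qed.

Lemma measurable_Lp_pow p f : mfun01 f ->
  mfun01 (fun x => `|f x| `^ p).
Proof.
move=> mf; apply: (@measurableT_comp _ _ _ _ _ _ (@powR R ^~ p)) => //.
exact: measurableT_comp.
Qed.

Lemma le_Lp_pow p f g : 0 <= p -> mfun01 f -> mfun01 g ->
  (forall x, I01 x -> `|f x| <= `|g x|) -> (Lp_pow p f <= Lp_pow p g)%E.
Proof.
move=> p0 mf mg fg; apply: ge0_le_integral => //.
- by apply/measurable_EFinP; exact: measurable_Lp_pow.
- by apply/measurable_EFinP; exact: measurable_Lp_pow.
- by move=> x Ix; rewrite lee_fin ge0_ler_powR // ?nnegrE ?fg.
Qed.

Lemma Lp_pow_ge0 p f : (0 <= Lp_pow p f)%E.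
Proof. by apply: integral_ge0 => x _; rewrite lee_fin powR_ge0. Qed.

(** Integrating [powR_sum_convex] with the norm bounds as weights gives B^p times the sum of b_k/B,
    which is B^p. *)
Lemma minkowski_sum p (n : nat) (b : nat -> R) (f : R -> R) (H : nat -> R -> R) :
  1 <= p -> (forall k, 0 < b k) -> mfun01 f ->
  (forall k, mfun01 (H k)) ->
  (forall x, I01 x -> `|f x| <= \sum_(0 <= k < n.+1) `|H k x|) ->
  (forall k, (k < n.+1)%N -> (Lp_pow p (H k) <= (b k `^ p)%:E)%E) ->
  (Lp_pow p f <= ((\sum_(0 <= k < n.+1) b k) `^ p)%:E)%E.
Proof.
move=> p1 b0 mf mH fH Hb; have p0 : 0 <= p by lra.
set B := \sum_(0 <= i < n.+1) b i.
have B0 : 0 < B.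
  rewrite /B big_nat_recl //; apply: ltr_pwDl => //; apply: sumr_ge0 => i _; exact: ltW.
pose c k := B `^ p * (b k / B / b k `^ p).
have c0 k : 0 <= c k.
  by rewrite /c !mulr_ge0 ?invr_ge0 ?powR_ge0 // ltW.
have mI := measurable_I01.
apply: le_trans (_ : \int[@lebesgue_measure R]_(x in I01)
   (\sum_(0 <= k < n.+1) ((c k)%:E * (`|H k x| `^ p)%:E)%E)%R <= _)%E.
  apply: ge0_le_integral => //.
  - by apply/measurable_EFinP; exact: measurable_Lp_pow.
  - apply: emeasurable_sum => k; apply: measurable_funeM; apply/measurable_EFinP; exact: measurable_Lp_pow.
  - move=> x Ix; rewrite sumEFin lee_fin.
    apply: le_trans (powR_sum_convex R p n b (fun k => `|H k x|) p1 b0 (fun k => normr_ge0 (H k x))).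
    by rewrite ge0_ler_powR // ?nnegrE ?sumr_ge0 // fH.
rewrite ge0_integral_sum //; last 2 first.
- by move=> k; apply: measurable_funeM; apply/measurable_EFinP; exact: measurable_Lp_pow.
- by move=> k x _; rewrite lee_fin mulr_ge0 // powR_ge0.
apply: le_trans (_ : \sum_(0 <= k < n.+1) ((c k)%:E * (b k `^ p)%:E) <= _)%E.
  rewrite !big_nat; apply: lee_sum => k /andP[_ kn].
  rewrite ge0_integralZl_EFin //; last first.
    by apply/measurable_EFinP; exact: measurable_Lp_pow.
  by apply: lee_wpmul2l; rewrite ?lee_fin //; exact: Hb.
rewrite sumEFin lee_fin le_eqVlt; apply/orP; left; apply/eqP.
transitivity (\sum_(0 <= k < n.+1) B `^ p / B * b k).
  apply: eq_bigr => k _; rewrite /c; field.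
  by rewrite !gt_eqF ?powR_gt0.
by rewrite -mulr_sumr -/B divfK // gt_eqF.
Qed.

Lemma minkowski p (b1 b2 : R) f g h : 1 <= p -> 0 < b1 -> 0 < b2 ->
  mfun01 f -> mfun01 g -> mfun01 h ->
  (forall x, I01 x -> `|f x| <= `|g x| + `|h x|) ->
  (Lp_pow p g <= (b1 `^ p)%:E)%E -> (Lp_pow p h <= (b2 `^ p)%:E)%E ->
  (Lp_pow p f <= ((b1 + b2) `^ p)%:E)%E.
Proof.
move=> p1 b10 b20 mf mg mh fgh hg hh.
have := @minkowski_sum p 1 (fun k => if k == 0%N then b1 else b2) f
  (fun k => if k == 0%N then g else h) p1 _ mf _ _ _.
rewrite big_nat_recl // big_nat1 /=; apply.
- by case.
- by case.
- by move=> x Ix; rewrite big_nat_recl // big_nat1 /=; exact: fgh.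
- by case=> [|[|]].
Qed.

End LpNorm.

(** * Integrating the majorant over arcs around rationals *)

Section MajorantIntegral.
Variable R : realType.
Local Notation I01 := (`[0%R : R, 1%R : R]%classic).
Local Notation mfun01 := (@measurable_fun _ _ (measurableTypeR R) (measurableTypeR R) I01).
Local Notation int01 f := (\int[@lebesgue_measure R]_(x in `[0%R:R, 1%R:R]) (f x)%:E)%E.

(** With A = L^2/q, the index i is the least dyadic level with ||q x|| <= 2/(A/2^i): at i = 0 the
    bound by A applies, otherwise minimality gives 1/||q x|| <= A/2^i. The crude bound i <= L^2 only
    makes the family of arcs finite. *)
Lemma weyl_majorant_near_rational : exists2 C : R, 0 < C &
  forall (L : nat) (x : R), (0 < L)%N -> 0 <= x <= 1 ->
  exists q i a : nat, [/\ (0 < q <= 16 * L)%N, (i <= L ^ 2)%N, (a <= q)%N,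
    `|q%:R * x - a%:R| <= 2 / (L%:R ^+ 2 / q%:R / 2 ^+ i) &
    weyl_majorant R L x <= C * (L%:R + L%:R ^+ 2 / q%:R / 2 ^+ i)].
Proof.
have := @weyl_majorant_arc R; have : 2 <= 2112%:R :> R by rewrite ler_nat.
move: 2112%:R => C C2 ARC; exists C; first by lra.
move=> L x L0 /andP[x0 x1]; have L0R : 0 < L%:R :> R by rewrite ltr0n.
have [q /andP[q0 qQ] [W1 W2]] := ARC L x L0.
have C0 : 0 < C by lra.
have q0R : 0 < q%:R :> R by rewrite ltr0n.
set A : R := L%:R ^+ 2 / q%:R; have A0 : 0 < A by rewrite divr_gt0 // exprn_gt0.
set d := dist (q%:R * x) in W2.
have d12 : d <= 2^-1 := dist_le_half R _.
set z := Num.floor (q%:R * x + 2^-1).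
have z0 : 0 <= z by rewrite floor_ge0 addr_ge0 // mulr_ge0.
have zq : z <= q%:Z.
  rewrite -ltzD1 -(ltr_int R) intrD.
  apply: le_lt_trans (floor_le _) _.
  have : q%:R * x <= q%:R by rewrite ler_piMr // ltW.
  by rewrite -pmulrn; lra.
pose a := `|z|%N.
have aE : a%:R = z%:~R :> R by rewrite /a natr_absz ger0_norm.
have aq : (a <= q)%N by rewrite -lez_nat /a gez0_abs.
have dE : d = `|q%:R * x - a%:R| by rewrite aE.
have AL : A <= L%:R ^+ 2.
  by rewrite ler_pdivrMr // ler_peMr ?sqr_ge0 // ler1n.
pose P i := d <= 2 / (A / 2 ^+ i).
have PL : P (L ^ 2)%N.
  rewrite /P; apply: le_trans d12 _.
  have -> : 2 / (A / 2 ^+ (L ^ 2)) = 2 * 2 ^+ (L ^ 2) / A.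
    by field; rewrite expf_neq0 // gt_eqF.
  rewrite ler_pdivlMr //.
  have : A <= 2 ^+ (L ^ 2).
    apply: le_trans AL _; rewrite -!natrX ler_nat; apply: ltnW; exact: ltn_expl.
  lra.
have exP : exists i, P i by exists (L ^ 2)%N.
case: (ex_minnP exP) => i Pi imin.
exists q, i, a; split => //; first by rewrite q0.
- exact: imin.
- by rewrite -dE.
case: i Pi imin => [|i] Pi imin.
  rewrite expr0 divr1; apply: le_trans W1 _; rewrite ler_pM2l // lerDr ltW //.
have dlt : 2 / (A / 2 ^+ i) < d.
  by rewrite ltNge; apply/negP => /imin; rewrite ltnn.
have u0 : 0 < A / 2 ^+ i by rewrite divr_gt0 // exprn_gt0.
have d0 : 0 < d by apply: lt_trans dlt; rewrite divr_gt0.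
apply: le_trans (W2 d0) _.
have dinv : d^-1 <= A / 2 ^+ i.+1.
  have -> : A / 2 ^+ i.+1 = (2 / (A / 2 ^+ i))^-1.
    by rewrite exprS; field; rewrite expf_neq0 // gt_eqF.
  have w0 : 0 < 2 / (A / 2 ^+ i) by rewrite divr_gt0.
  by rewrite lef_pV2 ?posrE //; exact: ltW.
have dp : 0 < d^-1 by rewrite invr_gt0.
by apply: ler_pM => //; [rewrite addr_ge0 // ltW | rewrite lerD2l].
Qed.

Lemma integral01_sum_le (m n : nat) (F : nat -> R -> R) (v : nat -> R) :
  (forall k, mfun01 (F k)) -> (forall k x, 0 <= F k x) ->
  (forall k, (m <= k < n)%N -> (int01 (F k) <= (v k)%:E)%E) ->
  (int01 (fun x => (\sum_(m <= k < n) F k x)%R) <= (\sum_(m <= k < n) v k)%:E)%E.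
Proof.
move=> mF F0 Fv; have mI := measurable_I01 R.
under eq_integral do rewrite -sumEFin.
rewrite ge0_integral_sum //.
- by rewrite -sumEFin !big_nat; apply: lee_sum => k; exact: Fv.
- by move=> k; apply/measurable_EFinP; exact: mF.
- by move=> k x _; rewrite lee_fin.
Qed.

Lemma integral01_indic_le (c a t q : R) : 0 <= c -> 0 < q -> 0 < t ->
  (int01 (fun x => (c * \1_(`[(a - t) / q, (a + t) / q]%classic : set R) x)%R) <=
   (c * (2 * t / q))%:E)%E.
Proof.
move=> c0 q0 t0; have mI := measurable_I01 R.
set S := (X in \1_X).
have mS : measurable (S : set (measurableTypeR R)) by exact: measurable_itv.
under eq_integral do rewrite EFinM.
rewrite ge0_integralZl_EFin //; last first.
  by apply/measurable_EFinP; apply: measurable_funTS; exact: measurable_indic.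
rewrite integral_indic // EFinM; apply: lee_wpmul2l; first by rewrite lee_fin.
apply: le_trans (_ : lebesgue_measure S <= _)%E.
  by apply: le_measure; rewrite ?inE //; exact: measurableI.
rewrite /S lebesgue_measure_itv /= lte_fin.
case: ifP => _; last by rewrite lee_fin !mulr_ge0 ?invr_ge0 // ltW.
rewrite -EFinB lee_fin; suff -> : (a + t) / q - (a - t) / q = 2 * t / q by [].
by rewrite -mulrBl; congr (_ / _); ring.
Qed.

Lemma sum_geo_le (th : R) (n : nat) : 0 <= th -> th < 1 ->
  \sum_(0 <= i < n) th ^+ i <= (1 - th)^-1.
Proof.
move=> t0 t1; have h : 0 < 1 - th by rewrite subr_gt0.
rewrite -[leRHS]mul1r ler_pdivlMr //.
by rewrite geometric_sum lerBlDr lerDl exprn_ge0.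
Qed.

(** Where u = L^2/(q 2^i) exceeds L, x lies in an interval of length 4/(q u) around a/q on which
    |f|^p is of order u^(p/2). The q + 1 <= 2 q numerators give 8 u^(p/2 - 1), and the sum over i is
    geometric. *)
Lemma Lp_weyl_majorant (p C0 : R) : 2 < p -> 0 < C0 -> exists2 C : R, 0 < C &
  forall (L : nat) (f : R -> R), (0 < L)%N -> mfun01 f ->
  (forall x, I01 x -> f x ^+ 2 <= C0 * weyl_majorant R L x) ->
  (Lp_pow R p f <= (C * (L%:R `^ (p / 2) +
     \sum_(1 <= q < (16 * L).+1) (L%:R ^+ 2 / q%:R) `^ (p / 2 - 1)))%:E)%E.
Proof.
move=> p2 C00; have [Cw Cw0 Hw] := weyl_majorant_near_rational; set r := p / 2; have r1 : 1 < r by rewrite /r; lra.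
(* Ratio between consecutive dyadic shells: the height changes by 2^(-r), the measure by 2. It is
   below 1 because p > 2. *)
pose th : R := (2^-1) `^ (r - 1).
have th0 : 0 < th by rewrite powR_gt0 // invr_gt0.
have th1 : th < 1.
  have : (2^-1 : R) `^ (r - 1) < 1 `^ (r - 1).
    by apply: gt0_ltr_powR; rewrite ?subr_gt0 // ?nnegrE // invf_lt1 // ltr1n.
  by rewrite powR1.
pose C2 := (C0 * Cw * 2) `^ r.
have C20 : 0 < C2 by rewrite powR_gt0 // !mulr_gt0.
pose C3 := 1 + 8 * (1 - th)^-1.
have th1' : 0 < (1 - th)^-1 by rewrite invr_gt0 subr_gt0.
have C31 : 1 <= C3 by rewrite /C3; lra.
exists (C2 * C3); first by rewrite mulr_gt0 //; lra.
move=> L f L0 mf Hf; have L0R : 0 < L%:R :> R by rewrite ltr0n.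
have mI := measurable_I01 R.
pose u q i : R := L%:R ^+ 2 / q%:R / 2 ^+ i.
have u0 q i : (0 < q)%N -> 0 < u q i.
  by move=> q0; rewrite !divr_gt0 ?exprn_gt0 // ltr0n.
have u00 q i : 0 <= u q i by rewrite !divr_ge0 ?exprn_ge0 // ltW.
pose S q i a : set R := `[(a%:R - 2 / u q i) / q%:R, (a%:R + 2 / u q i) / q%:R]%classic.
pose F q i a x : R := u q i `^ r * \1_(S q i a) x.
have F0 q i a x : 0 <= F q i a x by rewrite mulr_ge0 ?powR_ge0.
have mF q i a : mfun01 (F q i a).
  apply: measurable_funM => //; apply: measurable_funTS; apply: measurable_indic.
  exact: measurable_itv.
pose G x : R := L%:R `^ r + \sum_(1 <= q < (16 * L).+1) \sum_(0 <= i < (L ^ 2).+1)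
  \sum_(0 <= a < q.+1) F q i a x.
have G1 q x : 0 <= \sum_(0 <= i < (L ^ 2).+1) \sum_(0 <= a < q.+1) F q i a x.
  by apply: sumr_ge0 => i _; apply: sumr_ge0.
have G0 x : 0 <= G x by rewrite addr_ge0 ?powR_ge0 // sumr_ge0.
have mG2 q : mfun01 (fun x => \sum_(0 <= i < (L ^ 2).+1) \sum_(0 <= a < q.+1) F q i a x).
  by apply: measurable_sum => i; apply: measurable_sum => a; exact: mF.
have mG1 : mfun01 (fun x => \sum_(1 <= q < (16 * L).+1) \sum_(0 <= i < (L ^ 2).+1)
     \sum_(0 <= a < q.+1) F q i a x) by apply: measurable_sum => q; exact: mG2.
have mG : mfun01 G by apply: measurable_funD.
have fG x : I01 x -> `|f x| `^ p <= C2 * G x.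
  move=> Ix; have x01 : 0 <= x <= 1 by move: Ix; rewrite /= in_itv.
  have [q [i [a [/andP[q0 qQ] iL aq ha HW]]]] := Hw L x L0 x01.
  have q0R : 0 < q%:R :> R by rewrite ltr0n.
  have -> : `|f x| `^ p = (f x ^+ 2) `^ r.
    rewrite -real_normK ?num_real // -powR_mulrn // -powRrM; congr (_ `^ _).
    by rewrite /r; field.
  have h1 : f x ^+ 2 <= C0 * Cw * 2 * Num.max (L%:R) (u q i).
    apply: le_trans (Hf x Ix) _; rewrite -2!(mulrA C0) ler_pM2l //.
    rewrite -/(u q i) in HW; apply: le_trans HW _; rewrite -(mulrA Cw 2) ler_pM2l //.
    have := le_max (L%:R) (L%:R) (u q i); have := le_max (u q i) (L%:R) (u q i).
    rewrite !lexx orbT /= => h2 h3; lra.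
  apply: le_trans (_ : (C0 * Cw * 2 * Num.max (L%:R) (u q i)) `^ r <= _).
    by rewrite ge0_ler_powR ?nnegrE ?sqr_ge0 // ?(le_trans (sqr_ge0 _) h1) //; lra.
  rewrite powRM; last 2 first.
  - by rewrite !mulr_ge0 // ltW.
  - by rewrite le_max ltW.
  rewrite ler_pM2l //.
  have inS : \1_(S q i a) x = 1 :> R.
    suff Sx : S q i a x by rewrite indicE mem_set.
    rewrite /S /= in_itv /=; apply/andP.
    move: ha; rewrite -/(u q i) ler_norml => /andP[k1 k2].
    by rewrite ler_pdivrMr // ler_pdivlMr // (mulrC x); split; lra.
  have Fle : u q i `^ r <= \sum_(1 <= q < (16 * L).+1) \sum_(0 <= i < (L ^ 2).+1)
     \sum_(0 <= a < q.+1) F q i a x.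
    rewrite (big_cat_nat (n := q)) //=; last by rewrite ltnW.
    rewrite [X in _ <= _ + X]big_ltn ?ltnS //.
    rewrite [X in _ <= _ + (X + _)](big_cat_nat (n := i)) //=; last by rewrite ltnW // ltnS.
    rewrite [X in _ <= _ + (_ + X + _)]big_ltn ?ltnS //.
    rewrite [X in _ <= _ + (_ + (X + _) + _)](big_cat_nat (n := a)) //=; last by rewrite ltnW // ltnS.
    rewrite [X in _ <= _ + (_ + (_ + X + _) + _)]big_ltn ?ltnS //.
    have -> : F q i a x = u q i `^ r by rewrite /F inS mulr1.
    have s1 m n : 0 <= \sum_(m <= q < n) \sum_(0 <= i < (L ^ 2).+1) \sum_(0 <= a < q.+1) F q i a x.
      by apply: sumr_ge0.
    have s2 m n : 0 <= \sum_(m <= i < n) \sum_(0 <= a < q.+1) F q i a x.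
      by apply: sumr_ge0 => j _; apply: sumr_ge0.
    have s3 m n : 0 <= \sum_(m <= a < n) F q i a x by apply: sumr_ge0.
    have := s1 1%N q; have := s1 q.+1 (16 * L).+1; have := s2 0%N i; have := s2 i.+1 (L ^ 2).+1.
    have := s3 0%N a; have := s3 a.+1 q.+1; lra.
  rewrite /G; have [_|_] := leP (L%:R) (u q i).
    by apply: le_trans Fle _; rewrite lerDr powR_ge0.
  by rewrite lerDl; apply: sumr_ge0.
apply: le_trans (_ : int01 (fun x => (C2 * G x)%R) <= _)%E.
  apply: ge0_le_integral => //.
  - by apply/measurable_EFinP; exact: measurable_Lp_pow.
  - by apply/measurable_EFinP; apply: measurable_funM.
under eq_integral do rewrite EFinM.
rewrite ge0_integralZl_EFin; first last.
- exact: ltW.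
- by apply/measurable_EFinP.
- by move=> x _; rewrite lee_fin.
- exact: mI.
rewrite -[in leRHS]mulrA [in leRHS]EFinM; apply: lee_wpmul2l; first by rewrite lee_fin ltW.
under eq_integral do rewrite EFinD.
rewrite ge0_integralD; first last.
- by apply/measurable_EFinP.
- by move=> x _; rewrite lee_fin sumr_ge0.
- by apply/measurable_EFinP; exact: measurable_cst.
- by move=> x _; rewrite lee_fin powR_ge0.
- exact: mI.
rewrite integral01_cst mulrDr EFinD; apply: leeD.
  by rewrite lee_fin ler_peMl // powR_ge0.
apply: le_trans (_ : (\sum_(1 <= q < (16 * L).+1) 8 * (1 - th)^-1 * (L%:R ^+ 2 / q%:R) `^ (r - 1))%:E <= _)%E; last first.
  rewrite -mulr_sumr lee_fin ler_wpM2r //; first by apply: sumr_ge0 => q _; exact: powR_ge0.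
  by rewrite /C3; lra.
apply: integral01_sum_le => // q /andP[q0 qQ].
have q0R : 0 < q%:R :> R by rewrite ltr0n.
apply: le_trans (_ : (\sum_(0 <= i < (L ^ 2).+1) 8 * (u q i `^ (r - 1)))%:E <= _)%E.
  apply: integral01_sum_le => [i|i x|i _].
  - by apply: measurable_sum => a; exact: mF.
  - by apply: sumr_ge0.
  apply: le_trans (_ : (\sum_(0 <= a < q.+1) 4 / q%:R * (u q i `^ (r - 1)))%:E <= _)%E.
    apply: integral01_sum_le => // a _.
    have t0 : 0 < 2 / u q i by rewrite divr_gt0 // u0.
    apply: le_trans (integral01_indic_le _ a%:R _ _ (powR_ge0 (u q i) r) q0R t0) _.
    rewrite lee_fin -(mulr_powRB1 (u00 q i)); last by lra.
    rewrite le_eqVlt; apply/orP; left; apply/eqP; field.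
    by rewrite !gt_eqF // u0.
  rewrite sumr_const_nat subn0 -(mulr_natl (_ / _ * _)) lee_fin mulrA ler_wpM2r ?powR_ge0 //.
  rewrite mulrA ler_pdivrMr // -natr1.
  have : 1 <= q%:R :> R by rewrite ler1n.
  lra.
rewrite lee_fin.
have -> : \sum_(0 <= i < (L ^ 2).+1) 8 * u q i `^ (r - 1) =
   8 * (L%:R ^+ 2 / q%:R) `^ (r - 1) * \sum_(0 <= i < (L ^ 2).+1) th ^+ i.
  rewrite mulr_sumr; apply: eq_bigr => i _; rewrite -mulrA; congr (_ * _).
  rewrite /u powRM ?divr_ge0 ?exprn_ge0 ?invr_ge0 // ?ltW //; congr (_ * _).
  by rewrite -exprVn powR_exprn ?invr_ge0.
rewrite [leRHS]mulrAC ler_wpM2l ?mulr_ge0 ?powR_ge0 //.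
by apply: sum_geo_le => //; exact: ltW.
Qed.

End MajorantIntegral.

(** * Sums of powers and the order of a block norm *)

Section PowerSums.
Variable R : realType.

Lemma powR_anti (b x y : R) : 0 <= b -> 0 < x -> x <= y -> y `^ (- b) <= x `^ (- b).
Proof.
move=> b0 x0 xy; have y0 := lt_le_trans x0 xy.
by rewrite !powRN lef_pV2 ?posrE ?powR_gt0 // ge0_ler_powR // nnegrE ltW.
Qed.

(** Mean value theorem for t^(-g); the factor 2^(g+1) compares the intermediate point, below n + 1
    <= 2 n, with n. *)
Lemma powR_decr (g : R) (n : nat) : 0 < g -> (0 < n)%N ->
  n%:R `^ (- (g + 1)) <= 2 `^ (g + 1) / g * (n%:R `^ (- g) - n.+1%:R `^ (- g)).
Proof.
move=> g0 n0; have n0R : 0 < n%:R :> R by rewrite ltr0n.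
have [c /andP[nc cn] E] := powR_diff R (- g) n%:R n0R.
have -> : n%:R `^ (- g) - n.+1%:R `^ (- g) = g * c `^ (- (g + 1)).
  by rewrite -natr1 -opprB E mulNr opprK; congr (_ * _ `^ _); ring.
rewrite mulrA divfK ?gt_eqF //.
have c0 : 0 < c := lt_trans n0R nc.
have h : (2 * n%:R) `^ (- (g + 1)) <= c `^ (- (g + 1)).
  apply: powR_anti => //; first by lra.
  have : 1 <= n%:R :> R by rewrite ler1n.
  lra.
rewrite -(ler_pM2l (powR_gt0 (g + 1) (ltr0n R 2))) in h.
by apply: le_trans h; rewrite powRM // mulrA (powRN 2) mulfV ?mul1r // gt_eqF // powR_gt0.
Qed.

Lemma sum_powR_tail (g : R) (K M : nat) : 0 < g -> (0 < K)%N ->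
  \sum_(K <= n < M) n%:R `^ (- (g + 1)) <= 2 `^ (g + 1) / g * K%:R `^ (- g).
Proof.
move=> g0 K0; have c0 : 0 <= 2 `^ (g + 1) / g by rewrite divr_ge0 ?powR_ge0 // ltW.
have [MK|KM] := leqP M K; first by rewrite big_geq // mulr_ge0 ?powR_ge0.
apply: le_trans (_ : \sum_(K <= n < M) 2 `^ (g + 1) / g * (n%:R `^ (- g) - n.+1%:R `^ (- g)) <= _).
  by apply: ler_sum_nat => n /andP[Kn _]; apply: powR_decr => //; exact: leq_trans Kn.
rewrite -mulr_sumr ler_wpM2l //.
have -> : \sum_(K <= n < M) (n%:R `^ (- g) - n.+1%:R `^ (- g)) =
    - \sum_(K <= n < M) (n.+1%:R `^ (- g) - n%:R `^ (- g)).
  by rewrite -sumrN; apply: eq_bigr => n _; rewrite opprB.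
rewrite (telescope_sumr (fun n => n%:R `^ (- g))) ?(ltnW KM) // opprB.
by rewrite lerBlDr lerDl powR_ge0.
Qed.

Lemma sum_powR_lt1 (b : R) (Q : nat) : 0 < b -> b < 1 ->
  \sum_(1 <= q < Q.+1) q%:R `^ (- b) <= Q%:R `^ (1 - b) / (1 - b).
Proof.
move=> b0 b1; have e0 : 0 < 1 - b by lra.
elim: Q => [|Q IH]; first by rewrite big_geq // divr_ge0 ?powR_ge0 // ltW.
rewrite big_nat_recr //=; apply: le_trans (lerD IH (lexx _)) _.
rewrite -lerBrDl -mulrBl ler_pdivlMr //.
case: Q {IH} => [|Q]; first by rewrite powR0 ?gt_eqF // !powR1 subr0 mul1r; lra.
have Q0 : 0 < Q.+1%:R :> R by rewrite ltr0n.
have [c /andP[nc cn] E] := powR_diff R (1 - b) Q.+1%:R Q0.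
rewrite -(natr1 Q.+1) in cn E *; rewrite E mulrC ler_pM2l //.
have -> : 1 - b - 1 = - b by ring.
by apply: powR_anti; rewrite ?ltW // (lt_trans Q0).
Qed.

Lemma sum_harmonic_le (Q : nat) : (0 < Q)%N ->
  \sum_(1 <= q < Q.+1) q%:R^-1 <= 1 + ln Q%:R :> R.
Proof.
case: Q => // Q _; elim: Q => [|Q IH]; first by rewrite big_nat1 invr1 ln1 addr0.
rewrite big_nat_recr //=; apply: le_trans (lerD IH (lexx _)) _.
rewrite -addrA lerD2l.
have h : -1 < - Q.+2%:R^-1 :> R by rewrite ltrN2 invf_lt1 // ltr1n.
have := le_ln1Dx h.
have -> : 1 - Q.+2%:R^-1 = Q.+1%:R / Q.+2%:R :> R.
  have Qn : Q.+2%:R != 0 :> R by rewrite pnatr_eq0.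
  by apply: (mulIf Qn); rewrite mulrBl divfK // mulVf // mul1r -(natr1 Q.+1) addrK.
rewrite ln_div ?posrE ?ltr0n // => hl.
by rewrite -lerBrDr addrC -lerBlDr.
Qed.

(* L^expo p * logfactor p L is the order of the L^p norm of a block of L
   consecutive terms e(n^2 x). *)
Definition expo (p : R) : R := if p <= 4 then 1 / 2 else 1 - 2 / p.
Definition logfactor (p x : R) : R := if p == 4 then (1 + ln x) `^ (1 / 4) else 1.

Lemma expo_gt0 p : 2 < p -> 0 < expo p.
Proof.
move=> p2; rewrite /expo; case: ifP => // _.
by rewrite subr_gt0 ltr_pdivrMr; lra.
Qed.

Lemma logfactor_ge1 p x : 1 <= x -> 1 <= logfactor p x.
Proof.
move=> x1; rewrite /logfactor; case: ifP => // _.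
have lx : 0 <= ln x by rewrite ln_ge0.
have : 1 `^ (1 / 4) <= (1 + ln x) `^ (1 / 4).
  by apply: ge0_ler_powR; rewrite ?nnegrE ?addr_ge0 ?lerDl // divr_ge0.
by rewrite powR1.
Qed.

Lemma logfactor_le p x y : 1 <= x -> x <= y -> logfactor p x <= logfactor p y.
Proof.
move=> x1 xy; rewrite /logfactor; case: ifP => // _.
have x0 : 0 <= ln x by rewrite ln_ge0.
have y0 : 0 <= ln y by rewrite ln_ge0 // (le_trans x1).
rewrite ge0_ler_powR // ?nnegrE ?addr_ge0 // lerD2l ler_ln ?posrE //; lra.
Qed.

(** The sum of q^(-(p/2 - 1)) up to 16 L is a power of L for p < 4, making both terms of order
    L^(p/2); it is harmonic at p = 4; it is bounded for p > 4, where L^(p-2) dominates. *)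
Lemma majorant_sum_le p : 2 < p -> exists2 C : R, 0 < C & forall L : nat, (0 < L)%N ->
  L%:R `^ (p / 2) + \sum_(1 <= q < (16 * L).+1) (L%:R ^+ 2 / q%:R) `^ (p / 2 - 1) <=
  C * (L%:R `^ expo p * logfactor p L%:R) `^ p.
Proof.
move=> p2; set r := p / 2; have r1 : 1 < r by rewrite /r; lra.
have p0 : 0 < p by lra.
have termE (L q : nat) : (L%:R ^+ 2 / q%:R) `^ (r - 1) =
    L%:R `^ (2 * (r - 1)) * q%:R `^ (- (r - 1)) :> R.
  rewrite powRM ?exprn_ge0 ?invr_ge0 // powRN -powR_mulrn // -powRrM.
  by rewrite -powR_inv1 // -powRrM mulN1r powRN.
have sumE (L : nat) : \sum_(1 <= q < (16 * L).+1) (L%:R ^+ 2 / q%:R) `^ (r - 1) =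
    L%:R `^ (2 * (r - 1)) * \sum_(1 <= q < (16 * L).+1) q%:R `^ (- (r - 1)) :> R.
  by rewrite mulr_sumr; apply: eq_bigr => q _; exact: termE.
have [p4|p4|p4] := ltgtP p 4.
- have e0 : 0 < 1 - (r - 1) by rewrite /r; lra.
  exists (1 + 16 `^ (1 - (r - 1)) / (1 - (r - 1))).
    by rewrite addr_gt0 // divr_gt0 // powR_gt0.
  move=> L L0; have L0R : 0 < L%:R :> R by rewrite ltr0n.
  rewrite sumE /expo /logfactor (ltW p4) lt_eqF // mulr1 -powRrM.
  have -> : 1 / 2 * p = r by rewrite /r; ring.
  rewrite [leRHS]mulrDl mul1r lerD2l.
  have h := @sum_powR_lt1 (r - 1) (16 * L).
  apply: le_trans (ler_wpM2l (powR_ge0 _ _) (h _ _)) _; try (rewrite /r; lra).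
  have E : L%:R `^ (2 * (r - 1)) * L%:R `^ (1 - (r - 1)) = L%:R `^ r :> R.
    by rewrite -powRD_gt0 //; congr (_ `^ _); ring.
  rewrite natrM powRM // -E le_eqVlt; apply/orP; left; apply/eqP.
  by ring.
- have e0 : 0 < r - 1 - 1 by rewrite /r; lra.
  exists (1 + 2 `^ (r - 1) / (r - 1 - 1)).
    by rewrite addr_gt0 // divr_gt0 // powR_gt0.
  move=> L L0; have L1R : 1 <= L%:R :> R by rewrite ler1n.
  have np4 : (p <= 4) = false by apply/negbTE; rewrite -ltNge.
  rewrite sumE /expo /logfactor np4 gt_eqF // mulr1 -powRrM.
  have -> : (1 - 2 / p) * p = 2 * (r - 1) by rewrite /r; field; rewrite gt_eqF.
  rewrite [leRHS]mulrDl mul1r; apply: lerD; first by apply: ler_powR => //; rewrite /r; lra.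
  rewrite mulrC ler_wpM2r ?powR_ge0 //.
  have := sum_powR_tail (r - 1 - 1) 1 (16 * L).+1 e0 isT.
  by rewrite subrK powR1 mulr1.
- have rE : r = 2 by rewrite /r p4; field.
  (* The harmonic sum is at most 1 + ln 16 + ln L <= 17 + ln L, and the separate term L^2 adds one
     more. *)
  exists 18 => // L L0; have L1R : 1 <= L%:R :> R by rewrite ler1n.
  rewrite sumE /expo /logfactor p4 lexx eqxx rE.
  have lnL : 0 <= ln (L%:R : R) by rewrite ln_ge0.
  have -> : (L%:R `^ (1 / 2) * (1 + ln L%:R) `^ (1 / 4)) `^ 4 = L%:R ^+ 2 * (1 + ln L%:R) :> R.
    rewrite powRM ?powR_ge0 // -!powRrM.
    have -> : 1 / 2 * 4 = 2 :> R by field.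
    have -> : 1 / 4 * 4 = 1 :> R by field.
    by rewrite powRr1 ?addr_ge0 // powR_mulrn.
  have -> : 2 * (2 - 1) = 2 :> R by ring.
  have -> : 2 - 1 = 1 :> R by ring.
  rewrite powR_mulrn //.
  have h : \sum_(1 <= q < (16 * L).+1) q%:R `^ (- 1) <= 17 + ln L%:R :> R.
    have h16 := ln_sublinear (ltr0n R 16).
    have LL : (0 < 16 * L)%N by rewrite muln_gt0.
    have := sum_harmonic_le _ LL; rewrite natrM lnM ?posrE //; last by lra.
    under [X in X <= _ -> _]eq_bigr do rewrite -powR_inv1 //.
    lra.
  have L20 : 0 <= L%:R ^+ 2 :> R by rewrite sqr_ge0.
  apply: le_trans (lerD (lexx _) (ler_wpM2l L20 h)) _.
  have : 0 <= L%:R ^+ 2 * ln L%:R :> R by rewrite mulr_ge0.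
  lra.
Qed.

End PowerSums.

(** * Trapezoidal weights *)

Section Trapezoid.
Variable R : realType.

(* In n: zero up to 1, slope 1/D on [1, 1+u] and -1/D on [1+v, 1+u+v], zero
   afterwards; the truncated subtractions produce the four kinks. *)
Definition trapezoid (u v D n : nat) : R :=
  (((n - 1) + (n - (1 + u + v)))%:R - ((n - (1 + u)) + (n - (1 + v)))%:R) / D%:R.

(** The second difference lives on the four kinks and has size 1/D <= 1/L at each, which is the
    bound 4/L; u <= D and u <= v keep the height at most 1. *)
Lemma tame_trapezoid (u v D L : nat) : (0 < L)%N -> (L <= D)%N -> (u <= D)%N ->
  (u <= v)%N -> (u + v < 8 * L)%N -> tame R L (trapezoid u v D).
Proof.
move=> L0 LD uD uv uvL; have D0 : (0 < D)%N by apply: leq_trans LD.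
have D0R : 0 < D%:R :> R by rewrite ltr0n.
have L0R : 0 < L%:R :> R by rewrite ltr0n.
have LDR : D%:R^-1 <= L%:R^-1 :> R by rewrite lef_pV2 ?posrE // ler_nat.
pose P n := ((n - 1) + (n - (1 + u + v)))%N; pose Q n := ((n - (1 + u)) + (n - (1 + v)))%N.
have TE n : trapezoid u v D n = ((P n)%:R - (Q n)%:R) / D%:R by [].
have zero n : P n = Q n -> trapezoid u v D n = 0 by move=> E; rewrite TE E subrr mul0r.
split.
- by apply: zero; rewrite /P /Q; lia.
- by apply: zero; rewrite /P /Q; lia.
- by move=> n hn; apply: zero; rewrite /P /Q; lia.
- split=> n.
    have h1 : (Q n <= P n)%N by rewrite /P /Q; lia.
    have h2 : (P n <= Q n + D)%N by rewrite /P /Q; lia.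
    rewrite TE ger0_norm ?divr_ge0 ?subr_ge0 ?ler_nat //.
    by rewrite ler_pdivrMr // mul1r lerBlDl -natrD ler_nat.
  apply: le_trans LDR; rewrite !TE -mulrBl normrM (gtr0_norm (_ : 0 < D%:R^-1)) ?invr_gt0 //.
  rewrite -[leRHS]mul1r ler_pM2r ?invr_gt0 //.
  have h1 : (P n.+1 + Q n <= Q n.+1 + P n + 1)%N by rewrite /P /Q; lia.
  have h2 : (Q n.+1 + P n <= P n.+1 + Q n + 1)%N by rewrite /P /Q; lia.
  move: h1 h2; rewrite -!(ler_nat R) !natrD => h1 h2.
  by rewrite ler_norml; apply/andP; split; lra.
move=> K.
have ind a : \sum_(0 <= n < K) (n.+1 == a)%:R <= 1 :> R.
  case: a => [|a]; first by rewrite big1.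
  under eq_bigr do rewrite eqSS.
  have [aK|Ka] := ltnP a K.
    rewrite (bigD1_seq a) ?mem_index_iota ?iota_uniq //= eqxx big1 ?addr0 // => i /negPf ->.
    by [].
  by rewrite big_nat big1 // => i /andP[_ iK]; rewrite ltn_eqF // (leq_trans iK).
apply: le_trans (_ : \sum_(0 <= n < K) ((n.+1 == 1)%:R + (n.+1 == 1 + u + v)%N%:R +
    (n.+1 == 1 + u)%N%:R + (n.+1 == 1 + v)%N%:R) / D%:R <= _).
  apply: ler_sum => n _; rewrite /diff2 !TE.
  (* The second difference of the truncated n - a is the indicator of n + 1 = a. *)
  have s2 a : ((n.+2 - a)%:R = 2 * (n.+1 - a)%:R - (n - a)%:R + (n.+1 == a)%:R :> R)%R.
    apply/eqP; rewrite addrAC -subr_eq opprK -!natrM -!natrD eqr_nat; apply/eqP.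
    by case: eqP; lia.
  set X := (_ + _ in leLHS).
  have -> : X = ((n.+1 == 1)%:R + (n.+1 == 1 + u + v)%N%:R - (n.+1 == 1 + u)%N%:R - (n.+1 == 1 + v)%N%:R) / D%:R.
    by rewrite /X /P /Q !natrD !s2; ring.
  rewrite normrM (gtr0_norm (_ : 0 < D%:R^-1)) ?invr_gt0 // ler_wpM2r ?invr_ge0 //.
  apply: le_trans (ler_normB _ _) _; rewrite normr_nat lerD2r.
  apply: le_trans (ler_normB _ _) _; rewrite normr_nat lerD2r.
  by rewrite ger0_norm.
rewrite -mulr_suml !big_split /=.
have := ind 1%N; have := ind (1 + u + v)%N; have := ind (1 + u)%N; have := ind (1 + v)%N.
move=> h1 h2 h3 h4; apply: ler_pM; rewrite ?invr_ge0 //; last by lra.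
by rewrite !addr_ge0 // sumr_ge0.
Qed.

Lemma trapezoid_supp (u v D n : nat) : (u + v < n)%N -> trapezoid u v D n = 0.
Proof.
move=> h; rewrite /trapezoid.
have -> : ((n - 1) + (n - (1 + u + v)) = (n - (1 + u)) + (n - (1 + v)))%N by lia.
by rewrite subrr mul0r.
Qed.

Lemma trapezoid_low (u v D n : nat) : (n <= 1)%N -> trapezoid u v D n = 0.
Proof.
move=> h; rewrite /trapezoid.
have -> : ((n - 1) + (n - (1 + u + v)) = (n - (1 + u)) + (n - (1 + v)))%N by lia.
by rewrite subrr mul0r.
Qed.

(** Ramps of length one mean no smoothing: this is the level from which the doubling of ramps
    starts. *)
Lemma trapezoid_sharp (k n : nat) : (1 < k)%N ->
  trapezoid 1 (k - 1) 1 n = ((1 < n)%N && (n <= k)%N)%:R.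
Proof.
move=> k1; rewrite /trapezoid divr1; apply/eqP; rewrite subr_eq -natrD eqr_nat; apply/eqP.
by case: (ltnP 1 n); case: (leqP n k) => /=; lia.
Qed.

(* Doubling the slope length of a trapezoid removes one tent at each edge. *)
Lemma trapezoid_double (L k n : nat) : (0 < L)%N -> (4 * L <= k)%N ->
  trapezoid L (k - L) L n = trapezoid (2 * L) (k - 2 * L) (2 * L) n +
    (trapezoid L L (2 * L) n + trapezoid L L (2 * L) (n - (k - 2 * L))).
Proof.
move=> L0 Lk; have L0R : L%:R != 0 :> R by rewrite pnatr_eq0 -lt0n.
rewrite /trapezoid -!subnDA.
have -> : (1 + L + (k - L) = 1 + k)%N by lia.
have -> : (1 + 2 * L + (k - 2 * L) = 1 + k)%N by lia.
have -> : (k - 2 * L + 1 = 1 + (k - 2 * L))%N by lia.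
have -> : (k - 2 * L + (1 + L + L) = 1 + k)%N by lia.
have -> : (k - 2 * L + (1 + L) = 1 + (k - L))%N by lia.
have -> : (1 + L + L = 1 + 2 * L)%N by lia.
rewrite !(natrM _ 2 L) !natrD; set a := (n - 1)%:R; set b := (n - (1 + k))%:R.
set c := (n - (1 + L))%:R; set d := (n - (1 + (k - L)))%:R.
set e := (n - (1 + 2 * L))%:R; set f := (n - (1 + (k - 2 * L)))%:R.
by field.
Qed.

End Trapezoid.

(** * L^p norms of sums over an interval *)

Section IntervalSums.
Variable R : realType.
Local Notation I01 := (`[0%R : R, 1%R : R]%classic).
Local Notation mfun01 := (@measurable_fun _ _ (measurableTypeR R) (measurableTypeR R) I01).

Lemma measurable_cos_comp (f : R -> R) : mfun01 f -> mfun01 (fun x => cos (f x)).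
Proof.
move=> mf; apply: (@measurableT_comp _ _ _ _ _ _ (@cos R)) => //.
apply: continuous_measurable_fun; exact: continuous_cos.
Qed.

Lemma measurable_id01 : mfun01 (fun x => x).
Proof. exact: measurable_id. Qed.

Lemma measurable_mulC (f : R -> R) (c : R) : mfun01 f -> mfun01 (fun x => c * f x).
Proof. by move=> mf; apply: measurable_funM => //; exact: measurable_cst. Qed.

Definition quad_phase (x y c : R) (n : nat) : R := 2 * pi * x * n%:R ^+ 2 + y * n%:R + c.

Lemma measurable_quad (y c : R -> R) (n : nat) : mfun01 y -> mfun01 c ->
  mfun01 (fun x => cos (quad_phase x (y x) (c x) n)).
Proof.
move=> my mc; apply: measurable_cos_comp; rewrite /quad_phase.
apply: measurable_funD => //; apply: measurable_funD.
  apply: measurable_funM; last exact: measurable_cst.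
  by apply: measurable_mulC; exact: measurable_id01.
by apply: measurable_funM => //; exact: measurable_cst.
Qed.

Lemma measurable_weighted_sum (N : nat) (w : nat -> R) (y c : R -> R) : mfun01 y -> mfun01 c ->
  mfun01 (fun x => \sum_(0 <= n < N) w n * cos (quad_phase x (y x) (c x) n)).
Proof.
move=> my mc; apply: measurable_sum => n; apply: measurable_mulC.
exact: measurable_quad.
Qed.

Definition Lp_size (p : R) (l : R) : R := l `^ expo R p * logfactor R p l.

Lemma Lp_size_gt0 p l : 1 <= l -> 0 < Lp_size p l.
Proof.
move=> l1; apply: mulr_gt0; first by rewrite powR_gt0 // (lt_le_trans _ l1).
exact: lt_le_trans ltr01 (logfactor_ge1 _ _ _ l1).
Qed.

(** [y] and [c] are functions of x because translating a block by s adds 4 pi s x to the linear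
    coefficient of the phase. *)
Lemma tame_Lp p : 2 < p -> exists2 B : R, 0 < B &
  forall (L : nat) w (y c : R -> R), (0 < L)%N -> tame R L w -> mfun01 y -> mfun01 c ->
  (Lp_pow R p (fun x => (\sum_(0 <= n < 8 * L) w n * cos (quad_phase x (y x) (c x) n))%R) <=
   ((B * Lp_size p L%:R) `^ p)%:E)%E.
Proof.
move=> p2; have p0 : 0 < p by lra.
have [C0 C00 H0] := weyl_bound R.
have [C1 C10 H1] := Lp_weyl_majorant R p C0 p2 C00.
have [C2 C20 H2] := majorant_sum_le R p p2.
have C12 : 0 < C1 * C2 by rewrite mulr_gt0.
exists ((C1 * C2) `^ p^-1); first by rewrite powR_gt0.
move=> L w y c L0 tw my mc.
apply: le_trans (H1 L _ L0 _ _) _.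
- exact: measurable_weighted_sum.
- by move=> x _; exact: H0.
have s0 : 0 <= Lp_size p L%:R by rewrite ltW // Lp_size_gt0 // ler1n.
rewrite lee_fin powRM ?powR_ge0 // -powRrM mulVf ?gt_eqF // powRr1 ?(ltW C12) //.
rewrite -mulrA ler_pM2l //; exact: H2.
Qed.

Lemma sum_beyond_support (f : nat -> R) (N1 N2 : nat) :
  (forall n, (N1 <= n)%N -> f n = 0) -> (forall n, (N2 <= n)%N -> f n = 0) ->
  \sum_(0 <= n < N1) f n = \sum_(0 <= n < N2) f n.
Proof.
wlog N12 : N1 N2 / (N1 <= N2)%N.
  by move=> W; case/orP: (leq_total N1 N2) => h h1 h2; [exact: W | apply/esym/W].
move=> h1 _; rewrite [RHS](big_cat_nat (n := N1)) //= [X in _ + X]sum_nat_eq0 ?addr0 //.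
by move=> n /andP[hn _]; exact: h1.
Qed.

Lemma sum_shifted (t e : nat -> R) (s N : nat) : t 0%N = 0 -> (s <= N)%N ->
  \sum_(0 <= m < N) t (m - s)%N * e m = \sum_(0 <= i < N - s) t i * e (i + s)%N.
Proof.
move=> t0 sN; rewrite (big_cat_nat (n := s)) //= [X in X + _]sum_nat_eq0 ?add0r; last first.
  by move=> m /andP[_ ms]; rewrite (eqP (ltnW ms)) t0 mul0r.
rewrite -[X in \sum_(X <= _ < _) _]add0n big_addn.
by apply: eq_bigr => i _; rewrite addnK.
Qed.

(** [trapezoid_double] applied J times: each scale 2^j leaves one tent at either edge, and what
    remains is a trapezoid with ramps of length 2^J. *)
Lemma sharp_decomposition (e : nat -> R) (k N J : nat) : (2 ^ J.+1 <= k)%N ->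
  \sum_(0 <= m < N) trapezoid R 1 (k - 1) 1 m * e m =
  \sum_(0 <= j < J) (\sum_(0 <= m < N) trapezoid R (2 ^ j) (2 ^ j) (2 * 2 ^ j) m * e m +
    \sum_(0 <= m < N) trapezoid R (2 ^ j) (2 ^ j) (2 * 2 ^ j) (m - (k - 2 * 2 ^ j)) * e m) +
  \sum_(0 <= m < N) trapezoid R (2 ^ J) (k - 2 ^ J) (2 ^ J) m * e m.
Proof.
elim: J => [|J IH] hk; first by rewrite [X in _ = X + _]big_geq // add0r expn0.
rewrite IH; last by apply: leq_trans hk; rewrite leq_exp2l.
rewrite [X in _ = X + _]big_nat_recr //= -addrA; congr (_ + _).
rewrite -!big_split /=; apply: eq_bigr => m _; rewrite -!(mulrDl _ _ (e m)); congr (_ * _).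
rewrite trapezoid_double ?expn_gt0 //; last by rewrite !expnS in hk *; lia.
by rewrite expnS addrC.
Qed.

(** Substitution n = m + a - 2: a tame weight must vanish at 0 and 1, so the block starts at m = 2
    and ends at m = l + 1. *)
Lemma interval_sum_trapezoid (a l : nat) (x c : R) :
  \sum_(a <= n < a + l) cos (2 * pi * (n ^ 2)%:R * x + c) =
  \sum_(0 <= m < l.+2) trapezoid R 1 (l.+1 - 1) 1 m *
    cos (quad_phase x (4 * pi * (a%:R - 2) * x) (2 * pi * (a%:R - 2) ^+ 2 * x + c) m).
Proof.
case: l => [|l].
  rewrite addn0 big_geq // sum_nat_eq0 // => m /andP[_ m2].
  by rewrite trapezoid_low ?mul0r.
rewrite [RHS](big_cat_nat (n := 2)) //= [X in X + _]sum_nat_eq0 ?add0r; last first.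
  by move=> m /andP[_ m2]; rewrite trapezoid_low ?mul0r.
rewrite -[X in \sum_(X <= _ < a + _) _]add0n big_addn addKn.
rewrite -[X in _ = \sum_(X <= _ < _) _]add0n big_addn !subSS subn0.
apply: eq_big_nat => i /andP[_ il].
have := trapezoid_sharp R l.+2 (i + 2) isT; rewrite subSS subn0 => ->.
have -> : (1 < i + 2)%N && (i + 2 <= l.+2)%N by lia.
rewrite mul1r; congr cos; rewrite /quad_phase natrX !natrD; ring.
Qed.

(** The tents at scale 2^j have norm of order 2^(j [expo p]) up to the logarithmic factor; as
    [expo p] is positive, the series is dominated by its last scale, comparable to the length l. *)
Lemma interval_Lp p : 2 < p -> exists2 C : R, 0 < C &
  forall (a l : nat) (c : R), (0 < l)%N ->
  (Lp_pow R p (fun x => (\sum_(a <= n < a + l) cos (2 * pi * (n ^ 2)%:R * x + c))%R) <=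
   ((C * Lp_size p l%:R) `^ p)%:E)%E.
Proof.
move=> p2; have [B B0 HB] := tame_Lp p p2.
have p1 : 1 <= p by lra.
pose al := expo R p; have al0 : 0 < al := expo_gt0 R p p2.
pose tau : R := 2 `^ al.
have tau1 : 1 < tau.
  have : 1 `^ al < 2 `^ al :> R by apply: gt0_ltr_powR; rewrite ?nnegrE // ltr1n.
  by rewrite powR1.
have geo (J : nat) : \sum_(0 <= j < J.+1) tau ^+ j <= tau ^+ J.+1 / (tau - 1).
  have t1 : 0 < tau - 1 by lra.
  by rewrite ler_pdivlMr // -opprB mulrN geometric_sum opprB lerBlDr lerDl.
exists (2 * B * (tau / (tau - 1))).
  by rewrite !mulr_gt0 ?invr_gt0 ?subr_gt0 // (lt_trans ltr01).
move=> a l c l0; set k := l.+1.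
(* The lower bound on k gives the last trapezoid a plateau (u <= v), the upper bound fits its
   support into 8 * 2^J. *)
have [J /andP[Jk kJ]] : exists J, (2 ^ J.+1 <= k < 2 ^ J.+2)%N.
  exists (trunc_log 2 k).-1.
  have k1 : (1 < k)%N by [].
  have := trunc_logP (ltnSn 1) (ltnW k1); have := trunc_log_ltn k (ltnSn 1).
  have : (0 < trunc_log 2 k)%N by rewrite trunc_log_gt0.
  by case: (trunc_log 2 k) => // J _ /= -> ->.
have l1 : 1 <= l%:R :> R by rewrite ler1n.
pose y x : R := 4 * pi * (a%:R - 2) * x.
pose c' x : R := 2 * pi * (a%:R - 2) ^+ 2 * x + c.
have my : mfun01 y by apply: measurable_mulC; exact: measurable_id01.
have mc : mfun01 c'.
  apply: measurable_funD; last exact: measurable_cst.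
  by apply: measurable_mulC; exact: measurable_id01.
pose e x m := cos (quad_phase x (y x) (c' x) m).
pose A j x := \sum_(0 <= m < k.+1) trapezoid R (2 ^ j) (2 ^ j) (2 * 2 ^ j) m * e x m.
pose A' j x := \sum_(0 <= m < k.+1) trapezoid R (2 ^ j) (2 ^ j) (2 * 2 ^ j) (m - (k - 2 * 2 ^ j)) * e x m.
pose T x := \sum_(0 <= m < k.+1) trapezoid R (2 ^ J) (k - 2 ^ J) (2 ^ J) m * e x m.
pose b j := B * Lp_size p (2 ^ j)%:R.
have b0 j : 0 < b j by rewrite mulr_gt0 // Lp_size_gt0 // ler1n expn_gt0.
have mA j : mfun01 (A j) by apply: measurable_weighted_sum.
have mA' j : mfun01 (A' j) by apply: measurable_weighted_sum.
have mT : mfun01 T by apply: measurable_weighted_sum.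
have tt j : tame R (2 ^ j) (trapezoid R (2 ^ j) (2 ^ j) (2 * 2 ^ j)).
  have := expn_gt0 2 j; rewrite /= => h.
  by apply: tame_trapezoid; lia.
have LA j : (j < J)%N -> (Lp_pow R p (A j) <= (b j `^ p)%:E)%E.
  move=> jJ; have h := expn_gt0 2 j.
  have jk : (2 * 2 ^ j <= k)%N.
    by apply: leq_trans Jk; rewrite -expnS leq_exp2l // ltnW.
  have := HB (2 ^ j)%N _ y c' h (tt j) my mc.
  suff -> : (fun x => \sum_(0 <= n < 8 * 2 ^ j) trapezoid R (2 ^ j) (2 ^ j) (2 * 2 ^ j) n *
    cos (quad_phase x (y x) (c' x) n)) = A j by [].
  apply/funext => x; apply: sum_beyond_support => n hn; rewrite trapezoid_supp ?mul0r //; lia.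
have LA' j : (j < J)%N -> (Lp_pow R p (A' j) <= (b j `^ p)%:E)%E.
  move=> jJ; have h := expn_gt0 2 j.
  have jk : (2 * 2 ^ j <= k)%N.
    by apply: leq_trans Jk; rewrite -expnS leq_exp2l // ltnW.
  set s := (k - 2 * 2 ^ j)%N.
  (* The right-hand tent is moved to the origin; the translation by s changes the linear and
     constant terms as follows. *)
  have my' : mfun01 (fun x => 4 * pi * s%:R * x + y x).
    by apply: measurable_funD => //; apply: measurable_mulC; exact: measurable_id01.
  have mc'' : mfun01 (fun x => 2 * pi * s%:R ^+ 2 * x + (s%:R * y x + c' x)).
    apply: measurable_funD; first by apply: measurable_mulC; exact: measurable_id01.
    by apply: measurable_funD => //; apply: measurable_mulC.
  have := HB (2 ^ j)%N _ _ _ h (tt j) my' mc''.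
  set F := (fun x => _); suff -> : F = A' j by [].
  apply/funext => x; rewrite /A' -/s sum_shifted; last 2 first.
  - by rewrite trapezoid_low.
  - by rewrite /s; lia.
  rewrite /F; transitivity (\sum_(0 <= i < k.+1 - s) trapezoid R (2 ^ j) (2 ^ j) (2 * 2 ^ j) i *
     cos (quad_phase x (4 * pi * s%:R * x + y x) (2 * pi * s%:R ^+ 2 * x + (s%:R * y x + c' x)) i)).
    by apply: sum_beyond_support => n hn; rewrite trapezoid_supp ?mul0r //; rewrite /s in hn *; lia.
  apply: eq_bigr => i _; congr (_ * cos _); rewrite /quad_phase natrD; ring.
have LT : (Lp_pow R p T <= (b J `^ p)%:E)%E.
  have h := expn_gt0 2 J.
  have tT : tame R (2 ^ J) (trapezoid R (2 ^ J) (k - 2 ^ J) (2 ^ J)).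
    by rewrite !expnS in Jk kJ; apply: tame_trapezoid => //; lia.
  have := HB (2 ^ J)%N _ y c' h tT my mc.
  suff -> : (fun x => \sum_(0 <= n < 8 * 2 ^ J) trapezoid R (2 ^ J) (k - 2 ^ J) (2 ^ J) n *
    cos (quad_phase x (y x) (c' x) n)) = T by [].
  rewrite !expnS in Jk kJ.
  apply/funext => x; apply: sum_beyond_support => n hn; rewrite trapezoid_supp ?mul0r //; lia.
pose H j := if (j < J)%N then (fun x => A j x + A' j x) else T.
have mH j : mfun01 (H j).
  rewrite /H; case: ifP => _; last exact: mT.
  apply: measurable_funD; [exact: mA | exact: mA'].
have bb j : 0 < 2 * b j by rewrite mulr_gt0.
have LH j : (j < J.+1)%N -> (Lp_pow R p (H j) <= ((2 * b j) `^ p)%:E)%E.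
  rewrite /H ltnS leq_eqVlt => /orP[/eqP ->|jJ].
    rewrite ltnn; apply: le_trans LT _; rewrite lee_fin ge0_ler_powR ?nnegrE ?ltW //; first by lra.
    by rewrite ltr_pMl // ltr1n.
  rewrite jJ; have -> : 2 * b j = b j + b j by ring.
  apply: (minkowski R p _ _ _ _ _ p1 (b0 j) (b0 j) _ (mA j) (mA' j) _ (LA j jJ) (LA' j jJ)).
    apply: measurable_funD; [exact: mA | exact: mA'].
  by move=> x _; exact: ler_normD.
set f := (fun x => _).
have fE x : f x = \sum_(0 <= j < J) (A j x + A' j x) + T x.
  rewrite /f interval_sum_trapezoid -/k; exact: sharp_decomposition.
have mf : mfun01 f.
  have -> : f = (fun x => \sum_(0 <= j < J) (A j x + A' j x) + T x) by apply/funext => x; exact: fE.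
  apply: measurable_funD; last exact: mT.
  apply: measurable_sum => j; apply: measurable_funD; [exact: mA | exact: mA'].
apply: le_trans (minkowski_sum R p J (fun j => 2 * b j) f H p1 bb mf mH _ LH) _.
  have HJ : H J = T by rewrite /H ltnn.
  move=> x _; rewrite fE big_nat_recr //= HJ.
  apply: le_trans (ler_normD _ _) _; rewrite lerD2r.
  apply: le_trans (ler_norm_sum _ _ _) _; rewrite !big_nat; apply: ler_sum => j /andP[_ jJ].
  by rewrite /H jJ.
rewrite lee_fin ge0_ler_powR ?nnegrE //; first by lra.
- by apply: sumr_ge0 => j _; exact: ltW.
- have h0 : 0 < Lp_size p l%:R := Lp_size_gt0 p _ l1.
  have h1 : 0 < 2 * B * (tau / (tau - 1)).
    by rewrite !mulr_gt0 ?invr_gt0 ?subr_gt0 // (lt_trans ltr01).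
  by rewrite mulr_ge0 // ltW.
have Jl : (2 ^ J <= l)%N by rewrite !expnS in Jk kJ; have := expn_gt0 2 J; lia.
apply: le_trans (_ : \sum_(0 <= j < J.+1) 2 * B * logfactor R p l%:R * tau ^+ j <= _).
  rewrite !big_nat; apply: ler_sum => j /andP[_ jJ].
  rewrite /b /Lp_size -/al.
  have -> : (2 ^ j)%:R `^ al = tau ^+ j :> R.
    by rewrite natrX powR_exprn.
  have lj : logfactor R p (2 ^ j)%:R <= logfactor R p l%:R.
    apply: logfactor_le; first by rewrite ler1n expn_gt0.
    by rewrite ler_nat; apply: leq_trans Jl; rewrite leq_exp2l.
  have -> : 2 * (B * (tau ^+ j * logfactor R p (2 ^ j)%:R)) =
    2 * B * tau ^+ j * logfactor R p (2 ^ j)%:R by ring.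
  have -> : 2 * B * logfactor R p l%:R * tau ^+ j = 2 * B * tau ^+ j * logfactor R p l%:R by ring.
  by rewrite ler_wpM2l // !mulr_ge0 ?exprn_ge0 ?powR_ge0 // ltW.
rewrite -mulr_sumr /Lp_size -/al.
have lf0 : 0 <= logfactor R p l%:R by apply: le_trans ler01 (logfactor_ge1 _ _ _ l1).
apply: le_trans (ler_wpM2l _ (geo J)) _; first by rewrite !mulr_ge0 // ltW.
have -> : 2 * B * logfactor R p l%:R * (tau ^+ J.+1 / (tau - 1)) =
  2 * B * (tau / (tau - 1)) * logfactor R p l%:R * tau ^+ J by rewrite exprS; ring.
have -> : 2 * B * (tau / (tau - 1)) * (l%:R `^ al * logfactor R p l%:R) =
  2 * B * (tau / (tau - 1)) * logfactor R p l%:R * l%:R `^ al by ring.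
apply: ler_wpM2l.
  by rewrite !mulr_ge0 ?invr_ge0 ?subr_ge0 ?(ltW tau1) ?(ltW B0) // (le_trans ler01) // ltW.
have -> : tau ^+ J = (2 ^ J)%:R `^ al.
  by rewrite natrX powR_exprn.
by rewrite ge0_ler_powR ?nnegrE ?ler_nat // ltW.
Qed.

End IntervalSums.

(** * Upper bound for the weighted tail *)

Section TailUpperBound.
Variable R : realType.
Local Notation I01 := (`[0%R : R, 1%R : R]%classic).
Local Notation mfun01 := (@measurable_fun _ _ (measurableTypeR R) (measurableTypeR R) I01).

Lemma Lp_pow_scale (p c : R) (f : R -> R) : 0 <= c -> mfun01 f ->
  Lp_pow R p (fun x => c * f x) = ((c `^ p)%:E * Lp_pow R p f)%E.
Proof.
move=> c0 mf; rewrite /Lp_pow.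
under eq_integral do rewrite normrM (ger0_norm c0) powRM // EFinM.
rewrite ge0_integralZl_EFin //.
- by apply/measurable_EFinP; exact: measurable_Lp_pow.
- exact: powR_ge0.
Qed.

Lemma abel_summation (a e : nat -> R) (K m : nat) :
  \sum_(K <= n < K + m.+1) a n * e n =
  \sum_(0 <= i < m) (a (K + i)%N - a (K + i.+1)%N) * \sum_(K <= n < K + i.+1) e n +
  a (K + m)%N * \sum_(K <= n < K + m.+1) e n.
Proof.
elim: m => [|m IH].
  by rewrite [X in _ = X + _]big_geq // add0r addn1 addn0 !big_nat1.
rewrite addnS big_nat_recr /=; last by rewrite leq_addr.
rewrite {}IH big_nat_recr //= [X in _ = _ + _ * X]big_nat_recr /=; last by rewrite leq_addr.
ring.
Qed.

Lemma Lp_size_le p (x y : R) : 2 < p -> 1 <= x -> x <= y -> Lp_size R p x <= Lp_size R p y.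
Proof.
move=> p2 x1 xy; have x0 : 0 <= x by apply: le_trans x1.
have y0 : 0 <= y by apply: le_trans xy.
apply: ler_pM; rewrite ?powR_ge0 //.
- by apply: le_trans ler01 (logfactor_ge1 _ _ _ x1).
- by rewrite ge0_ler_powR // ?nnegrE // ltW // expo_gt0.
- exact: logfactor_le.
Qed.

(** Differences of n^(-2s) are of order n^(-2s-1) and the block from K to n has norm O(D n^al), so
    Abel summation leaves the sum of n^(al-2s-1), convergent as al < 2s. A free exponent [al] leaves
    room to absorb a logarithm. *)
Lemma tail_Lp p s al : 2 < p -> 0 < s -> al < 2 * s -> exists2 C : R, 0 < C &
  forall (K M : nat) (D c : R), (0 < K)%N -> 0 < D ->
  (forall l : nat, (K <= l)%N -> Lp_size R p l%:R <= D * l%:R `^ al) ->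
  (Lp_pow R p (fun x => (\sum_(K <= n < M) n%:R `^ (- (2 * s)) *
      cos (2 * pi * (n ^ 2)%:R * x + c))%R) <=
   ((C * D * K%:R `^ (al - 2 * s)) `^ p)%:E)%E.
Proof.
move=> p2 s0 als; have p1 : 1 <= p by lra.
have [C1 C10 H1] := interval_Lp R p p2.
pose g := 2 * s - al; have g0 : 0 < g by rewrite /g; lra.
pose C2 := 2 * s * (2 `^ (g + 1) / g) + 1.
have C20 : 0 < C2.
  by rewrite /C2 addr_gt0 // !mulr_gt0 ?powR_gt0 ?invr_gt0.
exists (C1 * C2); first exact: mulr_gt0.
move=> K M D c K0 D0 HD; have K0R : 0 < K%:R :> R by rewrite ltr0n.
have [MK|KM] := leqP M K.
  rewrite (_ : (fun x => _) = fun=> 0); last by apply/funext => x; rewrite big_geq.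
  rewrite /Lp_pow; have pn0 : p != 0 by rewrite gt_eqF //; lra.
  under eq_integral do rewrite normr0 (powR0 pn0).
  by rewrite integral0 lee_fin powR_ge0.
have -> : M = (K + (M - K).-1.+1)%N by rewrite prednK ?subn_gt0 // subnKC // ltnW.
set m := (M - K).-1; pose a n : R := n%:R `^ (- (2 * s)).
pose S i x : R := \sum_(K <= n < K + i.+1) cos (2 * pi * (n ^ 2)%:R * x + c).
have mcos n : mfun01 (fun x => cos (2 * pi * (n ^ 2)%:R * x + c)).
  apply: measurable_cos_comp; apply: measurable_funD; last exact: measurable_cst.
  by apply: measurable_mulC; exact: measurable_id01.
have mS i : mfun01 (S i) by apply: measurable_sum => n; exact: mcos.
pose d i := if (i < m)%N then a (K + i)%N - a (K + i.+1)%N else a (K + i)%N.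
have apos n : (0 < n)%N -> 0 < a n by move=> n0; rewrite powR_gt0 // ltr0n.
have d0 i : 0 < d i.
  rewrite /d; case: ifP => _; last by apply: apos; rewrite addn_gt0 K0.
  rewrite subr_gt0 /a !powRN ltf_pV2 ?posrE ?powR_gt0 ?ltr0n ?addn_gt0 ?K0 //.
  by rewrite gt0_ltr_powR ?nnegrE ?mulr_gt0 // ltr_nat addnS.
have SB i : (Lp_pow R p (S i) <= ((C1 * (D * (K + i)%:R `^ al)) `^ p)%:E)%E.
  apply: le_trans (H1 K i.+1 c isT) _; rewrite lee_fin.
  have l1 : 1 <= i.+1%:R :> R by rewrite ler1n.
  have s1 := Lp_size_gt0 R p _ l1.
  have h : Lp_size R p i.+1%:R <= D * (K + i)%:R `^ al.
    apply: le_trans (HD (K + i)%N _); last exact: leq_addr.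
    by apply: Lp_size_le => //; rewrite ler_nat -add1n leq_add2r.
  rewrite ge0_ler_powR ?nnegrE //; first by lra.
  - by rewrite mulr_ge0 // ltW.
  - by rewrite !mulr_ge0 ?powR_ge0 // ltW.
  - by rewrite ler_pM2l.
pose b i := d i * (C1 * (D * (K + i)%:R `^ al)).
have b0 i : 0 < b i by rewrite !mulr_gt0 // powR_gt0 // ltr0n addn_gt0 K0.
have Ka : al - 2 * s = - g by rewrite /g; ring.
set f := (fun x => _).
have fE x : f x = \sum_(0 <= i < m.+1) d i * S i x.
  rewrite /f (abel_summation a) big_nat_recr //= {2}/d ltnn; congr (_ + _).
  by apply: eq_big_nat => i /andP[_ im]; rewrite /d im.
have mH i : mfun01 (fun x => d i * S i x) by apply: measurable_mulC.
have mf : mfun01 f.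
  have -> : f = (fun x => \sum_(0 <= i < m.+1) d i * S i x) by apply/funext => x.
  by apply: measurable_sum => i; exact: mH.
apply: le_trans (minkowski_sum R p m b f (fun i x => d i * S i x) p1 b0 mf mH _ _) _.
- by move=> x _; rewrite fE; exact: ler_norm_sum.
- move=> i _; rewrite Lp_pow_scale ?(ltW (d0 i)) // /b powRM ?(ltW (d0 i)) //; last first.
    by rewrite !mulr_ge0 ?powR_ge0 // ltW.
  by rewrite EFinM; apply: lee_wpmul2l; rewrite ?lee_fin ?powR_ge0 //; exact: SB.
rewrite lee_fin ge0_ler_powR ?nnegrE //; first by lra.
- by apply: sumr_ge0 => i _; exact: ltW.
- by rewrite !mulr_ge0 ?powR_ge0 // ltW.
have bE i : b i = C1 * D * (d i * (K + i)%:R `^ al) by rewrite /b; ring.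
under eq_bigr do rewrite bE.
rewrite -mulr_sumr.
have -> : C1 * C2 * D * K%:R `^ (al - 2 * s) = C1 * D * (C2 * K%:R `^ (- g)) by rewrite Ka; ring.
rewrite ler_pM2l ?mulr_gt0 // big_nat_recr //= /C2 mulrDl mul1r; apply: lerD; last first.
  rewrite /d ltnn /a -powRD_gt0 ?ltr0n ?addn_gt0 ?K0 //.
  have -> : - (2 * s) + al = - g by rewrite /g; ring.
  by apply: powR_anti; rewrite ?(ltW g0) // ler_nat leq_addr.
apply: le_trans (_ : \sum_(0 <= i < m) 2 * s * (K + i)%:R `^ (- (g + 1)) <= _).
  rewrite !big_nat; apply: ler_sum => i /andP[_ im]; rewrite /d im.
  have Ki : 0 < (K + i)%:R :> R by rewrite ltr0n addn_gt0 K0.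
  have [t /andP[t1 t2] E] := powR_diff R (- (2 * s)) (K + i)%:R Ki.
  have -> : a (K + i)%N - a (K + i.+1)%N = 2 * s * t `^ (- (2 * s + 1)).
    rewrite /a addnS -(natr1 (K + i)) -opprB E mulNr opprK; congr (_ * _ `^ _); ring.
  have h : t `^ (- (2 * s + 1)) <= (K + i)%:R `^ (- (2 * s + 1)).
    by apply: powR_anti; [lra | | exact: ltW].
  rewrite -(mulrA (2 * s)) ler_pM2l ?mulr_gt0 //.
  apply: le_trans (ler_wpM2r (powR_ge0 _ _) h) _.
  by rewrite -powRD_gt0 // le_eqVlt; apply/orP; left; apply/eqP; congr (_ `^ _); rewrite /g; ring.
rewrite -mulr_sumr -(mulrA (2 * s)) ler_pM2l ?mulr_gt0 //.
have -> : \sum_(0 <= i < m) (K + i)%:R `^ (- (g + 1)) = \sum_(K <= n < K + m) n%:R `^ (- (g + 1)) :> R.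
  rewrite -[X in _ = \sum_(X <= _ < _) _]add0n big_addn addKn.
  by apply: eq_bigr => i _; rewrite addnC.
exact: sum_powR_tail.
Qed.

(** Measured from x rather than from 1, the logarithm at x stays an exact factor and only its growth
    beyond x is paid for by a small power. The constant comes from ln t <= t^(4 eps)/(4 eps),
    followed by a fourth root. *)
Lemma logfactor_growth (p eps : R) : 0 < eps -> exists2 C : R, 0 < C &
  forall x y : R, 1 <= x -> x <= y ->
  logfactor R p y <= C * logfactor R p x * (y / x) `^ eps.
Proof.
move=> e0; pose C := 1 + (4 * eps)^-1.
have ei : 0 < (4 * eps)^-1 by rewrite invr_gt0 mulr_gt0.
have C1 : 1 <= C by rewrite /C; lra.
exists (C `^ (1 / 4)); first by rewrite powR_gt0 //; lra.
move=> x y x1 xy; have x0 : 0 < x by lra.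
set t := y / x; have t1 : 1 <= t by rewrite ler_pdivlMr // mul1r.
have t0 : 0 < t by lra.
have tp e : 0 <= e -> 1 <= t `^ e.
  by move=> e0'; have := ler_powR t1 e0'; rewrite powRr0.
rewrite /logfactor; case: ifP => _; last first.
  rewrite mulr1 -[leLHS]mulr1; apply: ler_pM => //; last by apply: tp; exact: ltW.
  have : 1 `^ (1 / 4) <= C `^ (1 / 4) by apply: ge0_ler_powR; rewrite ?nnegrE //; lra.
  by rewrite powR1.
have lx : 0 <= ln x by rewrite ln_ge0.
have lt : 0 <= ln t by rewrite ln_ge0.
have ly : ln y = ln x + ln t.
  by rewrite -lnM ?posrE // /t mulrC divfK // gt_eqF.
have h : 1 + ln t <= C * t `^ (4 * eps).
  have h1 := tp (4 * eps) ltac:(lra).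
  have h2 : ln (t `^ (4 * eps)) < t `^ (4 * eps) by apply: ln_sublinear; rewrite powR_gt0.
  rewrite ln_powR in h2.
  have h3 : ln t <= (4 * eps)^-1 * t `^ (4 * eps).
    by rewrite -ler_pdivrMl ?invr_gt0 ?mulr_gt0 // invrK ltW.
  rewrite /C mulrDl mul1r; lra.
have -> : t `^ eps = (t `^ (4 * eps)) `^ (1 / 4).
  by rewrite -powRrM; congr (_ `^ _); field.
rewrite -!powRM ?powR_ge0 ?mulr_ge0 //; try lra.
rewrite ge0_ler_powR ?nnegrE //; first by rewrite ly; lra.
- by rewrite !mulr_ge0 ?powR_ge0 //; lra.
rewrite ly mulrAC -subr_ge0.
have : 0 <= ln x * ln t by rewrite mulr_ge0.
have : (1 + ln t) * (1 + ln x) <= C * t `^ (4 * eps) * (1 + ln x) by rewrite ler_wpM2r //; lra.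
lra.
Qed.

(** Half of the gap 2s - [expo p] is spent on the growth of the logarithm; the factor K^(-eps) in
    [D] cancels the K^eps due to the enlarged exponent. *)
Lemma tail_upper p s : 2 < p -> s_star p < s -> exists2 C : R, 0 < C &
  forall (K M : nat) (c : R), (0 < K)%N ->
  (Lp_pow R p (fun x => (\sum_(K <= n < M) n%:R `^ (- (2 * s)) *
      cos (2 * pi * (n ^ 2)%:R * x + c))%R) <=
   ((C * logfactor R p K%:R * K%:R `^ (expo R p - 2 * s)) `^ p)%:E)%E.
Proof.
move=> p2 hs; have p0 : 0 < p by lra.
(* In both ranges of p, [expo p] is twice [s_star p]. *)
have als : expo R p < 2 * s.
  move: hs; rewrite /s_star /expo; by case: ifP => _; lra.
have al0 := expo_gt0 R p p2; have s0 : 0 < s by lra.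
pose eps := (2 * s - expo R p) / 2.
have e0 : 0 < eps by rewrite /eps; lra.
have [C1 C10 H1] := logfactor_growth p eps e0.
have [C2 C20 H2] := tail_Lp p s (expo R p + eps) p2 s0 ltac:(rewrite /eps; lra).
exists (C2 * C1); first exact: mulr_gt0.
move=> K M c K0; have K0R : 0 < K%:R :> R by rewrite ltr0n.
have K1R : 1 <= K%:R :> R by rewrite ler1n.
have lf1 := logfactor_ge1 R p K%:R K1R.
pose D := C1 * logfactor R p K%:R * K%:R `^ (- eps).
have D0 : 0 < D by rewrite !mulr_gt0 ?powR_gt0 //; lra.
apply: le_trans (H2 K M D c K0 D0 _) _.
  move=> l Kl; have l0R : 0 < l%:R :> R by rewrite ltr0n (leq_trans K0).
  rewrite /Lp_size.
  have h := H1 K%:R l%:R K1R; rewrite ler_nat in h.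
  apply: le_trans (ler_wpM2l (powR_ge0 _ _) (h Kl)) _.
  rewrite /D powRD_gt0 // powRM ?invr_ge0 ?(ltW l0R) //.
  have -> : K%:R^-1 `^ eps = K%:R `^ (- eps).
    by rewrite -powR_inv1 ?(ltW K0R) // -powRrM mulN1r.
  by rewrite le_eqVlt; apply/orP; left; apply/eqP; ring.
rewrite lee_fin le_eqVlt; apply/orP; left; apply/eqP; congr (_ `^ _).
rewrite /D.
have -> : K%:R `^ (expo R p + eps - 2 * s) = K%:R `^ eps * K%:R `^ (expo R p - 2 * s).
  by rewrite -powRD_gt0 //; congr (_ `^ _); ring.
have E : K%:R `^ (- eps) * K%:R `^ eps = 1 by rewrite -powRD_gt0 // addNr powRr0.
set X := K%:R `^ (- eps) in E *; set Y := K%:R `^ eps in E *; set Z := K%:R `^ _.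
have -> : C2 * (C1 * logfactor R p K%:R * X) * (Y * Z) =
  C2 * C1 * logfactor R p K%:R * Z * (X * Y) by ring.
by rewrite E mulr1.
Qed.

End TailUpperBound.

(** * Means of trigonometric polynomials *)

Section TrigMeans.
Variable R : realType.
Local Notation I01 := (`[0%R : R, 1%R : R]%classic).
Local Notation int01 f := (\int[@lebesgue_measure R]_(x in `[0%R:R, 1%R:R]) (f x)%:E)%E.

(** Continuity is carried along so that means of sums and multiples can be assembled without
    separate integrability arguments. *)
Definition has_mean (f : R -> R) (v : R) : Prop := continuous f /\ int01 f = v%:E.

Lemma continuous_integrable01 (f : R -> R) : continuous f ->
  (@lebesgue_measure R).-integrable I01 (EFin \o f).
Proof.
move=> cf; apply: continuous_compact_integrable; first exact: segment_compact.
exact: continuous_subspaceT.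
Qed.

Lemma has_mean_add (f g : R -> R) (u v : R) : has_mean f u -> has_mean g v ->
  has_mean (fun x => f x + g x) (u + v).
Proof.
move=> [cf If] [cg Ig]; split; first by move=> x; apply: continuousD; [exact: cf | exact: cg].
have mI := measurable_I01 R.
under eq_integral do rewrite EFinD.
by rewrite integralD_EFin ?If ?Ig //; exact: continuous_integrable01.
Qed.

Lemma has_mean_scale (f : R -> R) (c u : R) : has_mean f u ->
  has_mean (fun x => c * f x) (c * u).
Proof.
move=> [cf If]; split.
  by move=> x; apply: continuousM; [exact: cst_continuous | exact: cf].
under eq_integral do rewrite EFinM.
by rewrite integralZl ?If //; exact: continuous_integrable01.
Qed.

Lemma has_mean_cst (c : R) : has_mean (fun=> c) c.
Proof. by split; [exact: cst_continuous | exact: integral01_cst]. Qed.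

Lemma has_mean_sum (I : Type) (s : seq I) (F : I -> R -> R) (v : I -> R) :
  (forall i, has_mean (F i) (v i)) ->
  has_mean (fun x => \sum_(i <- s) F i x) (\sum_(i <- s) v i).
Proof.
move=> HF; elim: s => [|i s IH].
  rewrite big_nil (_ : (fun x => _) = fun=> 0); first exact: has_mean_cst.
  by apply/funext => x; rewrite big_nil.
rewrite big_cons (_ : (fun x => _) = fun x => F i x + \sum_(j <- s) F j x).
  exact: has_mean_add.
by apply/funext => x; rewrite big_cons.
Qed.

Lemma eq_has_mean (f g : R -> R) (u v : R) : f =1 g -> u = v -> has_mean f u -> has_mean g v.
Proof. by move=> /funext -> ->. Qed.

Lemma sin_2pi_int (k : int) : sin (2 * pi * k%:~R) = 0 :> R.
Proof. by rewrite -cosBpihalf cos_periodz cosN cos_pihalf. Qed.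

Lemma has_mean_cos (k : int) : has_mean (fun x => cos (2 * pi * k%:~R * x)) (k == 0)%:R.
Proof.
have [->|k0] := eqVneq k 0.
  apply: eq_has_mean (has_mean_cst 1) => // x.
  by rewrite mulr0 mul0r cos0.
have cc : continuous (fun x : R => cos (2 * pi * k%:~R * x)).
  move=> x; apply: (@continuous_comp _ _ _ (fun x => 2 * pi * k%:~R * x) (@cos R)).
    exact: mulrl_continuous.
  exact: continuous_cos.
split=> //.
have w0 : 2 * pi * k%:~R != 0 :> R.
  by rewrite mulf_neq0 ?intr_eq0 // mulf_neq0 ?pnatr_eq0 // gt_eqF ?pi_gt0.
set w : R := 2 * pi * k%:~R in cc w0 *.
pose F x := w^-1 * sin (w * x).
have dF x : is_derive x (1 : R) F (cos (w * x)).
  rewrite /F; apply: is_derive_eq.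
  by rewrite /GRing.scale /= mulr1 mulrCA mulVf // mulr1.
rewrite (@continuous_FTC2 R _ F 0 1 ltr01).
- rewrite /F mulr0 sin0 mulr1 mulr0 {2}/w sin_2pi_int mulr0 -EFinB subr0.
  by [].
- exact: continuous_subspaceT.
- have cF x : {for x, continuous F}.
    by apply: differentiable_continuous; apply/derivable1_diffP; have [] := dF x.
  split.
  + by move=> x _; have [] := dF x.
  + by apply: cvg_at_right_filter; exact: cF.
  + by apply: cvg_at_left_filter; exact: cF.
- by move=> x _; rewrite derive1E; exact: (@derive_val _ _ _ _ _ _ _ (dF x)).
Qed.

End TrigMeans.

Lemma cos_add_cos_sub (R : realType) (u v x : R) :
  cos (2 * pi * (u + v) * x) + cos (2 * pi * (u - v) * x) =
  2 * (cos (2 * pi * u * x) * cos (2 * pi * v * x)).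
Proof.
have -> : 2 * pi * (u + v) * x = 2 * pi * u * x + 2 * pi * v * x by ring.
have -> : 2 * pi * (u - v) * x = 2 * pi * u * x - 2 * pi * v * x by ring.
rewrite cosD cosB; ring.
Qed.

(** * Second and fourth moments *)

Section SquareNorm.
Variable R : realType.
Implicit Types (a : nat -> R) (r : seq nat).

Definition cos_sum a r (x : R) : R := \sum_(n <- r) a n * cos (2 * pi * (n ^ 2)%:R * x).
Definition sin_sum a r (x : R) : R := \sum_(n <- r) a n * sin (2 * pi * (n ^ 2)%:R * x).

Lemma square_modulus a r x : cos_sum a r x ^+ 2 + sin_sum a r x ^+ 2 =
  \sum_(n <- r) \sum_(m <- r) a n * a m * cos (2 * pi * ((n ^ 2)%:Z - (m ^ 2)%:Z)%:~R * x).
Proof.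
rewrite /cos_sum /sin_sum !expr2 !mulr_suml -big_split /=; apply: eq_bigr => n _.
rewrite !mulr_sumr -big_split /=; apply: eq_bigr => m _.
rewrite intrB -!pmulrn mulrBr mulrBl cosB; ring.
Qed.

(** Parseval: distinct naturals have distinct squares, so only the diagonal of the expansion
    survives. *)
Lemma mean_square a r : uniq r ->
  has_mean R (fun x => cos_sum a r x ^+ 2 + sin_sum a r x ^+ 2) (\sum_(n <- r) a n ^+ 2).
Proof.
move=> ur; apply: (@eq_has_mean R (fun x => \sum_(n <- r) \sum_(m <- r)
   a n * a m * cos (2 * pi * ((n ^ 2)%:Z - (m ^ 2)%:Z)%:~R * x)) _
   (\sum_(n <- r) \sum_(m <- r) a n * a m * ((n ^ 2)%:Z - (m ^ 2)%:Z == 0)%:R)).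
- by move=> x; rewrite square_modulus.
- rewrite !big_seq; apply: eq_bigr => n nr.
  rewrite (bigD1_seq n) //= subrr eqxx mulr1 big1 ?addr0 // => m mn.
  rewrite subr_eq0 eqz_nat eqn_exp2r // eq_sym (negPf mn) mulr0 //.
- apply: has_mean_sum => n; apply: has_mean_sum => m.
  by apply: has_mean_scale; exact: has_mean_cos.
Qed.

Definition quadruple_count r : R :=
  \sum_(n <- r) \sum_(m <- r) \sum_(k <- r) \sum_(l <- r) ((n ^ 2 + l ^ 2 == m ^ 2 + k ^ 2)%N)%:R.

Lemma ler_sum_cat (r1 r2 : seq nat) (F G : nat -> R) :
  (forall i, i \in r1 -> F i <= G i) -> (forall i, 0 <= G i) ->
  \sum_(i <- r1) F i <= \sum_(i <- r1 ++ r2) G i.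
Proof.
move=> FG G0; rewrite big_cat /= -[leLHS]addr0; apply: lerD; last exact: sumr_ge0.
by rewrite !big_seq; apply: ler_sum.
Qed.

(** Multiplying two expansions of the squared modulus and using cos A cos B = (cos(A+B) +
    cos(A-B))/2 gives nonnegative contributions only. The A - B resonances with all indices in [r1]
    are kept; the 1/2 is that of the product formula. *)
Lemma mean_fourth a (r1 r2 : seq nat) (c : R) : 0 <= c -> (forall n, 0 <= a n) ->
  (forall n, n \in r1 -> c <= a n) ->
  exists2 v : R, c ^+ 4 / 2 * quadruple_count r1 <= v &
  has_mean R (fun x => (cos_sum a (r1 ++ r2) x ^+ 2 + sin_sum a (r1 ++ r2) x ^+ 2) ^+ 2) v.
Proof.
move=> c0 a0 ca; set r := r1 ++ r2.
pose w n m k l := a n * a m * (a k * a l).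
have w0 n m k l : 0 <= w n m k l by rewrite !mulr_ge0.
pose u n m : int := (n ^ 2)%:Z - (m ^ 2)%:Z.
pose t n m k l : R := w n m k l / 2 * ((u n m + u k l == 0)%:R + (u n m - u k l == 0)%:R).
have t0 n m k l : 0 <= t n m k l by rewrite !mulr_ge0 ?invr_ge0 ?addr_ge0.
pose v := \sum_(n <- r) \sum_(m <- r) \sum_(k <- r) \sum_(l <- r) t n m k l.
exists v; last first.
  apply: (@eq_has_mean R (fun x => \sum_(n <- r) \sum_(m <- r) \sum_(k <- r) \sum_(l <- r)
    (w n m k l / 2 * (cos (2 * pi * (u n m + u k l)%:~R * x) + cos (2 * pi * (u n m - u k l)%:~R * x)))) _ v) => //.
    move=> x; rewrite square_modulus expr2 mulr_suml; apply: eq_bigr => n _.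
    rewrite mulr_suml; apply: eq_bigr => m _; rewrite mulr_sumr; apply: eq_bigr => k _.
    rewrite mulr_sumr; apply: eq_bigr => l _; rewrite -/(u n m) -/(u k l) /w.
    rewrite intrD (intrB _ (u n m)) cos_add_cos_sub.
    by field.
  apply: has_mean_sum => n; apply: has_mean_sum => m; apply: has_mean_sum => k.
  apply: has_mean_sum => l; apply: has_mean_scale; apply: has_mean_add; exact: has_mean_cos.
rewrite /quadruple_count /v mulr_sumr; apply: ler_sum_cat => [n nr|n]; last first.
  by do 3![apply: sumr_ge0 => ? _].
rewrite mulr_sumr; apply: ler_sum_cat => [m mr|m]; last by do 2![apply: sumr_ge0 => ? _].
rewrite mulr_sumr; apply: ler_sum_cat => [k kr|k]; last by apply: sumr_ge0.
rewrite mulr_sumr; apply: ler_sum_cat => [l lr|l]; last by [].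
have cw : c ^+ 4 <= w n m k l.
  have -> : c ^+ 4 = c * c * (c * c) by ring.
  by rewrite /w; apply: ler_pM; rewrite ?mulr_ge0 //; apply: ler_pM; rewrite ?ca.
have -> : (n ^ 2 + l ^ 2 == m ^ 2 + k ^ 2)%N = (u n m - u k l == 0).
  by rewrite /u; apply/eqP/eqP; lia.
apply: ler_pM; rewrite ?divr_ge0 ?exprn_ge0 //.
  by rewrite ler_pM2r ?invr_gt0.
by rewrite lerDr.
Qed.

End SquareNorm.

(** * Lower bound by testing against a Fejer kernel *)

Section FejerLowerBound.
Variable R : realType.
Local Notation I01 := (`[0%R : R, 1%R : R]%classic).
Local Notation mfun01 := (@measurable_fun _ _ (measurableTypeR R) (measurableTypeR R) I01).
Local Notation int01 f := (\int[@lebesgue_measure R]_(x in `[0%R:R, 1%R:R]) (f x)%:E)%E.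

Definition fejer (Q : nat) (x : R) : R :=
  Q%:R^-1 * \sum_(0 <= i < Q) \sum_(0 <= j < Q) cos (2 * pi * (i%:Z - j%:Z)%:~R * x).

Lemma fejerE Q x : fejer Q x = Q%:R^-1 *
  ((\sum_(0 <= i < Q) cos (2 * pi * i%:R * x)) ^+ 2 +
   (\sum_(0 <= i < Q) sin (2 * pi * i%:R * x)) ^+ 2).
Proof.
rewrite /fejer; congr (_ * _).
rewrite !expr2 !mulr_suml -big_split /=; apply: eq_bigr => n _.
rewrite !mulr_sumr -big_split /=; apply: eq_bigr => m _.
by rewrite intrB -!pmulrn mulrBr mulrBl cosB.
Qed.

Lemma fejer_ge0 Q x : 0 <= fejer Q x.
Proof. by rewrite fejerE mulr_ge0 ?invr_ge0 // addr_ge0 ?sqr_ge0. Qed.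

Lemma fejer_le Q x : (0 < Q)%N -> fejer Q x <= Q%:R.
Proof.
move=> Q0; have Q0R : 0 < Q%:R :> R by rewrite ltr0n.
rewrite /fejer -ler_pdivlMl ?invr_gt0 // invrK.
apply: le_trans (_ : \sum_(0 <= i < Q) \sum_(0 <= j < Q) 1 <= _).
  by apply: ler_sum => i _; apply: ler_sum => j _; exact: cos_le1.
by rewrite !sumr_const_nat !subn0 mulr_natl.
Qed.

Lemma fejer_mean Q : (0 < Q)%N -> has_mean R (fejer Q) 1.
Proof.
move=> Q0; have Q0R : 0 < Q%:R :> R by rewrite ltr0n.
apply: (@eq_has_mean R (fejer Q) _ (Q%:R^-1 * \sum_(0 <= i < Q) \sum_(0 <= j < Q) ((i%:Z - j%:Z)%R == 0)%:R)) => //.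
  rewrite -[RHS](mulVf (lt0r_neq0 Q0R)); congr (_ * _).
  transitivity (\sum_(0 <= i < Q) (1 : R)); last by rewrite sumr_const_nat subn0.
  apply: eq_big_nat => i /andP[_ iQ].
  rewrite (bigD1_seq i) ?mem_index_iota ?iota_uniq //= subrr eqxx big1 ?addr0 // => j ji.
  by rewrite subr_eq0 eqz_nat eq_sym (negPf ji).
apply: has_mean_scale; apply: has_mean_sum => i; apply: has_mean_sum => j; exact: has_mean_cos.
Qed.

(** The n^2-th Fourier coefficient of the kernel is (Q - n^2)/Q when positive, from the pairs j = i
    + n^2, and 0 otherwise. All contributions are nonnegative, so the terms of [r2] can be
    discarded. *)
Lemma fejer_cos_sum (a : nat -> R) (r1 r2 : seq nat) (Q : nat) : (0 < Q)%N ->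
  (forall n, 0 <= a n) ->
  exists2 v : R, \sum_(n <- r1) a n * ((Q%:R - (n ^ 2)%:R) / Q%:R) <= v &
  has_mean R (fun x => cos_sum R a (r1 ++ r2) x * fejer Q x) v.
Proof.
set r := r1 ++ r2; move=> Q0 a0; have Q0R : 0 < Q%:R :> R by rewrite ltr0n.
pose v := \sum_(n <- r) (a n / 2 / Q%:R) * \sum_(0 <= i < Q) \sum_(0 <= j < Q)
  ((((n ^ 2)%:Z + (i%:Z - j%:Z))%R == 0)%:R + (((n ^ 2)%:Z - (i%:Z - j%:Z))%R == 0)%:R).
exists v; last first.
  apply: (@eq_has_mean R (fun x => \sum_(n <- r) (a n / 2 / Q%:R) * \sum_(0 <= i < Q) \sum_(0 <= j < Q)
    (cos (2 * pi * ((n ^ 2)%:Z + (i%:Z - j%:Z))%:~R * x) + cos (2 * pi * ((n ^ 2)%:Z - (i%:Z - j%:Z))%:~R * x))) _ v) => //.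
    move=> x; rewrite /cos_sum mulr_suml; apply: eq_bigr => n _.
    rewrite /fejer mulrA !mulr_sumr; apply: eq_bigr => i _.
    rewrite !mulr_sumr; apply: eq_bigr => j _.
    set k := (i%:Z - j%:Z)%R; rewrite intrD (intrB _ (n ^ 2)%:Z) -!pmulrn.
    rewrite cos_add_cos_sub.
    by field; rewrite gt_eqF.
  apply: has_mean_sum => n; apply: has_mean_scale; apply: has_mean_sum => i.
  apply: has_mean_sum => j; apply: has_mean_add; exact: has_mean_cos.
apply: ler_sum_cat => n; last first.
  apply: mulr_ge0; first by rewrite !divr_ge0.
  by do 2![apply: sumr_ge0 => ? _]; rewrite addr_ge0.
move=> _.
have cnt1 : Q%:R - (n ^ 2)%:R <= \sum_(0 <= i < Q) \sum_(0 <= j < Q) (((n ^ 2)%:Z + (i%:Z - j%:Z))%R == 0)%:R :> R.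
  have [nQ|Qn] := leqP Q (n ^ 2)%N.
    apply: le_trans (_ : 0 <= _); first by rewrite subr_le0 ler_nat.
    by do 2![apply: sumr_ge0 => ? _].
  rewrite (big_cat_nat (n := (Q - n ^ 2)%N)) ?leq_subr //=.
  rewrite -natrB ?(ltnW Qn) // -[leLHS]addr0; apply: lerD; last by do 2![apply: sumr_ge0 => ? _].
  have -> : (Q - n ^ 2)%N%:R = \sum_(0 <= i < (Q - n ^ 2)%N) (1 : R).
    by rewrite sumr_const_nat subn0.
  apply: ler_sum_nat => i /andP[_ iQ].
  rewrite ltn_subRL addnC in iQ.
  rewrite (bigD1_seq (i + n ^ 2)%N) ?mem_index_iota ?iota_uniq //=.
  have -> : ((n ^ 2)%:Z + (i%:Z - (i + n ^ 2)%N%:Z))%R == 0 by apply/eqP; lia.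
  by rewrite lerDl; apply: sumr_ge0.
have cnt2 : Q%:R - (n ^ 2)%:R <= \sum_(0 <= i < Q) \sum_(0 <= j < Q) (((n ^ 2)%:Z - (i%:Z - j%:Z))%R == 0)%:R :> R.
  rewrite exchange_big /=; apply: le_trans cnt1 _.
  by apply: ler_sum => i _; apply: ler_sum => j _; rewrite opprB.
under [X in _ <= _ * X]eq_bigr do rewrite big_split /=.
rewrite big_split /=.
have -> : a n * ((Q%:R - (n ^ 2)%:R) / Q%:R) =
  a n / 2 / Q%:R * ((Q%:R - (n ^ 2)%:R) + (Q%:R - (n ^ 2)%:R)).
  by field; rewrite gt_eqF.
by apply: ler_wpM2l; [rewrite !mulr_ge0 ?invr_ge0 ?(ltW Q0R) | exact: lerD].
Qed.

(** Jensen for the probability density [fejer Q]: t^p is at most the integral of |h|^p against the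
    kernel, and the kernel is at most Q. *)
Lemma Lp_lower_fejer (p t : R) (a : nat -> R) (r1 r2 : seq nat) (h : R -> R) (Q : nat) :
  1 <= p -> (0 < Q)%N -> (forall n, 0 <= a n) -> 0 <= t ->
  t <= \sum_(n <- r1) a n * ((Q%:R - (n ^ 2)%:R) / Q%:R) ->
  mfun01 h -> (forall x, I01 x -> `|cos_sum R a (r1 ++ r2) x| <= `|h x|) ->
  ((t `^ p / Q%:R)%:E <= Lp_pow R p h)%E.
Proof.
move=> p1 Q0 a0 t0 ht mh hle; have Q0R : 0 < Q%:R :> R by rewrite ltr0n.
have [v vt [cv Iv]] := fejer_cos_sum a r1 r2 Q Q0 a0.
have [cF IF] := fejer_mean Q Q0.
(* z -> al + be z is the tangent line of z^p at t. *)
pose al := t `^ p - p * t `^ (p - 1) * t; pose be := p * t `^ (p - 1).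
have be0 : 0 <= be by rewrite mulr_ge0 ?powR_ge0 //; lra.
have [cG IG] : has_mean R (fun x => al * fejer Q x + be * (cos_sum R a (r1 ++ r2) x * fejer Q x)) (al * 1 + be * v).
  by apply: has_mean_add; apply: has_mean_scale; split.
have tp : t `^ p <= al * 1 + be * v.
  have : be * t <= be * v by rewrite ler_wpM2l // (le_trans ht).
  by rewrite /al /be; lra.
have pw x : I01 x -> al * fejer Q x + be * (cos_sum R a (r1 ++ r2) x * fejer Q x) <= Q%:R * `|h x| `^ p.
  move=> Ix.
  have T := powR_tangent R p `|h x| t p1 (normr_ge0 _) t0.
  have F0 := fejer_ge0 Q x; have FQ := fejer_le Q x Q0.
  have h1 : cos_sum R a (r1 ++ r2) x <= `|h x| by apply: le_trans (ler_norm _) (hle x Ix).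
  have h2 : be * cos_sum R a (r1 ++ r2) x <= be * `|h x| by rewrite ler_wpM2l.
  have h3 : al + be * cos_sum R a (r1 ++ r2) x <= `|h x| `^ p by move: T; rewrite /al -/be; lra.
  have h4 : (al + be * cos_sum R a (r1 ++ r2) x) * fejer Q x <= `|h x| `^ p * fejer Q x by rewrite ler_wpM2r.
  have h5 : `|h x| `^ p * fejer Q x <= `|h x| `^ p * Q%:R by rewrite ler_wpM2l ?powR_ge0.
  lra.
have mI := measurable_I01 R.
have [Lfin|Linf] := eqVneq (Lp_pow R p h) +oo%E; first by rewrite Lfin leey.
have L0 := Lp_pow_ge0 R p h.
have : (int01 (fun x => (al * fejer Q x + be * (cos_sum R a (r1 ++ r2) x * fejer Q x))%R) <=
        Q%:R%:E * Lp_pow R p h)%E.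
  rewrite /Lp_pow -ge0_integralZl_EFin //; last by apply/measurable_EFinP; exact: measurable_Lp_pow.
  apply: le_integral => //.
  - exact: continuous_integrable01.
  - apply: integrableZl => //; apply/integrableP; split.
      by apply/measurable_EFinP; exact: measurable_Lp_pow.
    under eq_integral do rewrite gee0_abs ?lee_fin ?powR_ge0 //.
    by rewrite ltey.
  - by move=> x; rewrite inE /= => Ix; rewrite -EFinM lee_fin; exact: pw.
rewrite IG => H.
have : ((t `^ p)%:E <= Q%:R%:E * Lp_pow R p h)%E by apply: le_trans H; rewrite lee_fin.
case: (Lp_pow R p h) L0 Linf => [y| |] //= _ _.
by rewrite -EFinM !lee_fin ler_pdivrMr // mulrC.
Qed.

End FejerLowerBound.

(** * A logarithmic lower bound for a sum of greatest common divisors *)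

Section GcdSum.
Variable R : realType.

Lemma sum_inv_sq_le (D : nat) : \sum_(1 <= e < D.+1) (e%:R ^+ 2)^-1 <= 2 :> R.
Proof.
suff H : forall D : nat, \sum_(1 <= e < D.+2) (e%:R ^+ 2)^-1 <= 2 - D.+1%:R^-1 :> R.
  case: D => [|D]; first by rewrite big_geq.
  by apply: le_trans (H D) _; rewrite lerBlDr lerDl invr_ge0.
elim=> [|{}D IH]; first by rewrite big_nat1 expr1n invr1; lra.
rewrite big_nat_recr //=; apply: le_trans (lerD IH (lexx _)) _.
have D0 : 0 < D.+1%:R :> R by rewrite ltr0n.
rewrite -(natr1 D.+1); set d := D.+1%:R in D0 *.
have d1 : 0 < d + 1 by lra.
rewrite -subr_ge0.
have -> : 2 - (d + 1)^-1 - (2 - d^-1 + ((d + 1) ^+ 2)^-1) = (d * (d + 1) ^+ 2)^-1.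
  by field; rewrite !gt_eqF.
by rewrite invr_ge0 mulr_ge0 ?sqr_ge0 // ltW.
Qed.

Lemma ln_le_harmonic (D : nat) : ln D.+1%:R <= \sum_(1 <= n < D.+1) n%:R^-1 :> R.
Proof.
elim: D => [|D IH]; first by rewrite ln1 big_geq.
rewrite big_nat_recr //=; apply: le_trans (lerD IH (lexx _)).
have D0 : 0 < D.+1%:R :> R by rewrite ltr0n.
have -> : D.+2%:R = D.+1%:R * (1 + D.+1%:R^-1) :> R.
  by rewrite mulrDr mulr1 mulfV ?gt_eqF // natr1.
have i0 : 0 < D.+1%:R^-1 :> R by rewrite invr_gt0.
rewrite lnM ?posrE // ?addr_gt0 // lerD2l; apply: le_ln1Dx.
by apply: lt_trans i0; rewrite ltrN10.
Qed.

(** Write 1/n as the sum over d | n of phi(d)/n^2 and put n = d e: the sum over e of 1/e^2 is at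
    most 2. Hence the sum of phi(d)/d^2 grows at least like (ln D)/2. *)
Lemma sum_totient_sq (D : nat) :
  \sum_(1 <= n < D.+1) n%:R^-1 <= 2 * \sum_(1 <= d < D.+1) (totient d)%:R / d%:R ^+ 2 :> R.
Proof.
have tot n : (0 < n <= D)%N ->
    n%:R = \sum_(1 <= d < D.+1) (totient d)%:R * (d %| n)%:R :> R.
  move=> /andP[n0 nD]; rewrite -[in LHS](sum_totient_dvd n) natr_sum.
  rewrite -(big_mkord (fun d => (d %| n)%N) (fun d => (totient d)%:R)).
  rewrite big_mkcond big_ltn //=; have -> : (0 %| n)%N = false by rewrite dvd0n gtn_eqF.
  rewrite add0r [RHS](big_cat_nat (n := n.+1)) //= [X in _ = _ + X]sum_nat_eq0 ?addr0; last first.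
    by move=> i /andP[ni _]; rewrite gtnNdvd // mulr0.
  by apply: eq_bigr => d _; case: ifP; rewrite ?mulr1 ?mulr0.
have -> : \sum_(1 <= n < D.+1) n%:R^-1 =
    \sum_(1 <= n < D.+1) \sum_(1 <= d < D.+1) (totient d)%:R * ((d %| n)%:R / n%:R ^+ 2) :> R.
  apply: eq_big_nat => n nD; have n0 : n%:R != 0 :> R by rewrite pnatr_eq0; lia.
  under eq_bigr do rewrite mulrA.
  by rewrite -mulr_suml -tot //; field.
rewrite exchange_big /= mulr_sumr; apply: ler_sum_nat => d /andP[d0 dD].
have d0R : 0 < d%:R :> R by rewrite ltr0n.
rewrite -mulr_sumr mulrCA ler_wpM2l //.
pose g e : R := if e == 0%N then 0 else (d%:R ^+ 2)^-1 * (e%:R ^+ 2)^-1.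
have g0 e : 0 <= g e by rewrite /g; case: ifP => // _; rewrite mulr_ge0 ?invr_ge0 ?sqr_ge0.
apply: le_trans (_ : \sum_(0 <= n < D.+1 | (0 < n)%N && (d %| n)%N) g (n %/ d)%N <= _).
  rewrite [leRHS]big_mkcond [leRHS]big_ltn //= add0r; apply: ler_sum_nat => n /andP[n0 _].
  rewrite n0 /=; case: ifP => [dn|_]; last by rewrite mul0r.
  have q0 : (0 < n %/ d)%N by rewrite divn_gt0 // dvdn_leq.
  have E : d%:R * (n %/ d)%N%:R = n%:R :> R by rewrite -natrM mulnC divnK.
  by rewrite /g gtn_eqF // -E exprMn invfM mul1r.
apply: le_trans (ler_sum_inj_lt R g _ _ _ D.+1 g0 _ _) _.
- by move=> n _ nD; apply: leq_ltn_trans nD; exact: leq_div.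
- move=> i j; rewrite !inE => /andP[/andP[_ di] _] /andP[/andP[_ dj] _] E.
  by rewrite -(divnK di) -(divnK dj) E.
rewrite big_ltn // {1}/g eqxx add0r.
have -> : \sum_(1 <= e < D.+1) g e = (d%:R ^+ 2)^-1 * \sum_(1 <= e < D.+1) (e%:R ^+ 2)^-1.
  by rewrite mulr_sumr; apply: eq_big_nat => e /andP[e0 _]; rewrite /g gtn_eqF.
rewrite mulrC; apply: ler_wpM2r; first by rewrite invr_ge0 sqr_ge0.
exact: sum_inv_sq_le.
Qed.

(** The interval contains at least floor(2D/d) multiples of d, and this is at least D/d because d <=
    D. *)
Lemma multiples_count (D d : nat) : (0 < d <= D)%N ->
  D%:R / d%:R <= \sum_(8 * D <= x < (10 * D).+1) (d %| x)%:R :> R.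
Proof.
move=> /andP[d0 dD]; have d0R : 0 < d%:R :> R by rewrite ltr0n.
set q := ((2 * D) %/ d)%N.
apply: le_trans (_ : q%:R <= _).
  rewrite ler_pdivrMr // -natrM ler_nat.
  have := ltn_ceil (2 * D) d0; rewrite -/q mulSn; lia.
pose g x : R := ((8 * D <= x)%N && (d %| x)%N)%:R.
have -> : \sum_(8 * D <= x < (10 * D).+1) (d %| x)%:R = \sum_(0 <= x < (10 * D).+1) g x.
  rewrite [RHS](big_cat_nat (n := (8 * D)%N)) //=; last by lia.
  rewrite [X in _ = X + _]sum_nat_eq0 ?add0r.
    by apply: eq_big_nat => x /andP[h _]; rewrite /g h.
  by move=> x /andP[_ h]; rewrite /g leqNgt h.
pose f j := ((((8 * D) %/ d).+1 + j) * d)%N.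
have f8 j : (8 * D <= f j)%N.
  by rewrite /f mulnDl; apply: leq_trans (leq_addr _ _); rewrite ltnW // ltn_ceil.
apply: le_trans (_ : \sum_(0 <= j < q | predT j) g (f j) <= _).
  have -> : q%:R = \sum_(0 <= j < q) (1 : R) by rewrite sumr_const_nat subn0.
  by apply: ler_sum_nat => j _; rewrite /g f8 /f dvdn_mull.
apply: ler_sum_inj_lt => //.
- move=> j _ jq; rewrite ltnS /f.
  have h1 := leq_trunc_div (8 * D) d; have h2 := leq_trunc_div (2 * D) d.
  have h3 : ((8 * D) %/ d + j.+1 <= (8 * D) %/ d + q)%N by rewrite leq_add2l.
  have : (((8 * D) %/ d + j.+1) * d <= ((8 * D) %/ d + q) * d)%N by rewrite leq_mul2r h3 orbT.
  rewrite addnS addSn => h4; apply: leq_trans h4 _; rewrite mulnDl.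
  by apply: leq_trans (leq_add h1 h2) _; rewrite -mulnDl.
- by move=> i j _ _ /eqP; rewrite /f eqn_mul2r gtn_eqF //= eqn_add2l => /eqP.
Qed.

(** The gcd is the sum of phi(d) over its divisors d. Keeping d <= D and exchanging sums leaves
    phi(d) times the number of pairs of multiples of d, at least (D/d)^2. *)
Lemma sum_gcd_ge (D : nat) : (0 < D)%N ->
  D%:R ^+ 2 * (ln D%:R / 2) <=
  \sum_(8 * D <= x < (10 * D).+1) \sum_(8 * D <= z < (10 * D).+1) (gcdn x z)%:R :> R.
Proof.
move=> D0; have D0R : 0 < D%:R :> R by rewrite ltr0n.
set X := index_iota (8 * D) (10 * D).+1.
apply: le_trans (_ : \sum_(x <- X) \sum_(z <- X)
   \sum_(1 <= d < D.+1) (totient d)%:R * ((d %| x)%:R * (d %| z)%:R) <= _); last first.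
  rewrite !big_nat; apply: ler_sum => x /andP[xD _]; rewrite !big_nat; apply: ler_sum => z _.
  set g := gcdn x z; have g0 : (0 < g)%N by rewrite gcdn_gt0; lia.
  rewrite -[in leRHS](sum_totient_dvd g) natr_sum -(big_mkord (fun d => (d %| g)%N) (fun d => (totient d)%:R)).
  have -> : \sum_(1 <= d < D.+1) (totient d)%:R * ((d %| x)%:R * (d %| z)%:R) =
     \sum_(1 <= d < D.+1) (if (d %| g)%N then (totient d)%:R else 0) :> R.
    apply: eq_bigr => d _; rewrite dvdn_gcd; case: (d %| x)%N; case: (d %| z)%N;
      by rewrite /= ?mulr1 ?mulr0 ?mul0r ?mulr0.
  rewrite [leRHS]big_mkcond /= [leRHS]big_ltn // dvd0n gtn_eqF // add0r.
  have T0 d : 0 <= (if (d %| g)%N then (totient d)%:R else 0) :> R by case: ifP.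
  have [gD|Dg] := leqP g.+1 D.+1; last first.
    by rewrite [leRHS](big_cat_nat (n := D.+1)) ?(ltnW Dg) //= lerDl sumr_ge0.
  rewrite (big_cat_nat (n := g.+1)) //= [X in _ + X]sum_nat_eq0 ?addr0 // => i /andP[gi _].
  by rewrite gtnNdvd.
have -> : \sum_(x <- X) \sum_(z <- X) \sum_(1 <= d < D.+1) (totient d)%:R * ((d %| x)%:R * (d %| z)%:R) =
   \sum_(1 <= d < D.+1) (totient d)%:R * (\sum_(x <- X) (d %| x)%:R) ^+ 2 :> R.
  under eq_bigr do rewrite exchange_big /=.
  rewrite exchange_big /=; apply: eq_bigr => d _; rewrite expr2 mulr_suml mulr_sumr.
  apply: eq_bigr => x _; rewrite mulr_sumr mulr_sumr; apply: eq_bigr => z _; ring.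
apply: le_trans (_ : \sum_(1 <= d < D.+1) (totient d)%:R * (D%:R / d%:R) ^+ 2 <= _); last first.
  rewrite !big_nat; apply: ler_sum => d dD; rewrite ler_wpM2l //.
  by rewrite lerXn2r ?nnegrE ?divr_ge0 ?sumr_ge0 // multiples_count.
have -> : \sum_(1 <= d < D.+1) (totient d)%:R * (D%:R / d%:R) ^+ 2 =
   D%:R ^+ 2 * \sum_(1 <= d < D.+1) (totient d)%:R / d%:R ^+ 2 :> R.
  rewrite mulr_sumr; apply: eq_bigr => d _; rewrite expr_div_n; ring.
rewrite ler_pM2l ?exprn_gt0 //.
have := sum_totient_sq D; have := ln_le_harmonic D.
have : ln D%:R <= ln D.+1%:R :> R by rewrite ler_ln ?posrE ?ltr0n // ler_nat.
lra.
Qed.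

End GcdSum.

(** * Counting solutions of n^2 + l^2 = m^2 + k^2 *)

Section QuadrupleCount.
Local Open Scope nat_scope.

(* With g = gcd(x, z), the four numbers below satisfy
   n^2 - m^2 = 4x (z/g) t = 4z (x/g) t = k^2 - l^2 for t = 7g - i. *)
Definition quadruple (u : nat * nat * nat) : nat * nat * (nat * nat) :=
  let: (x, z, i) := u in let g := gcdn x z in
  let y := (z %/ g) * (7 * g - i) in let w := (x %/ g) * (7 * g - i) in
  ((y + x, y - x), (w + z, w - z)).

(** Since i <= g/2, the multiplier (7 g - i)/g lies in [6.5, 7], while x lies in [8D, 10D]: 6.5 * 8
    = 52 and 7 * 10 = 70. *)
Lemma quadruple_scale (x g i D : nat) : 0 < g -> g %| x -> 2 * i <= g -> 8 * D <= x <= 10 * D ->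
  52 * D <= (x %/ g) * (7 * g - i) <= 70 * D.
Proof.
move=> g0 gx ig /andP[x1 x2].
have E : (x %/ g) * (7 * g - i) = 7 * x - (x %/ g) * i.
  by rewrite mulnBr mulnCA divnK.
have h : 2 * ((x %/ g) * i) <= x.
  by rewrite mulnCA -[X in _ <= X](divnK gx) leq_mul2l ig orbT.
by rewrite E; move: (x %/ g * i) h => b h; lia.
Qed.

Lemma sum_diff_inj (a b a' b' : nat) : b <= a -> b' <= a' ->
  a + b = a' + b' -> a - b = a' - b' -> a = a' /\ b = b'.
Proof. by lia. Qed.

Lemma quadruple_eq (x z i n m k l : nat) :
  x <= (z %/ gcdn x z) * (7 * gcdn x z - i) -> z <= (x %/ gcdn x z) * (7 * gcdn x z - i) ->
  quadruple (x, z, i) = ((n, m), (k, l)) -> n ^ 2 + l ^ 2 = m ^ 2 + k ^ 2.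
Proof.
rewrite /quadruple; set g := gcdn x z; set t := 7 * g - i => hx hz [<- <- <- <-].
have E : x * ((z %/ g) * t) = z * ((x %/ g) * t).
  rewrite !mulnA; congr (_ * _).
  by rewrite muln_divA ?dvdn_gcdr // muln_divA ?dvdn_gcdl // mulnC.
move: E hx hz; set y := _ * t; set w := _ * t => E hx hz.
rewrite -{1}(subnK hx) -{2}(subnK hz).
set m' := y - x; set l' := w - z.
have hy : y = m' + x by rewrite subnK.
have hw : w = l' + z by rewrite subnK.
have -> : (m' + x + x) ^ 2 = m' ^ 2 + 4 * (x * (m' + x)) by ring.
have -> : (l' + z + z) ^ 2 = l' ^ 2 + 4 * (z * (l' + z)) by ring.
by rewrite -hy -hw E addnAC addnA.
Qed.

Variable R : realType.
Local Open Scope ring_scope.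

(** Each pair (x, z) with gcd g admits at least g/2 values of i. The solution determines x, y, z, w
    by sums and differences, and then i through y, so the map is injective. All four numbers lie in
    [42D, 80D], inside [K, 2K]. *)
Lemma quadruple_count_gcd (D K : nat) : (39 <= D)%N -> (40 * D <= K < 40 * D + 40)%N ->
  (\sum_(8 * D <= x < (10 * D).+1) \sum_(8 * D <= z < (10 * D).+1) (gcdn x z)%:R) / 2 <=
  quadruple_count R (index_iota K (2 * K).+1).
Proof.
move=> D39 /andP[K1 K2]; set r := index_iota K (2 * K).+1; set X := index_iota (8 * D) (10 * D).+1.
pose B := (10 * D).+1.
pose cond (u : nat * nat * nat) := (2 * u.2 <= gcdn u.1.1 u.1.2)%N.
pose V := [seq (x, z) | x <- X, z <- X].
pose S3 := [seq u <- [seq (v, i) | v <- V, i <- index_iota 0 B] | cond u].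
pose sol (q : nat * nat * (nat * nat)) := (q.1.1 ^ 2 + q.2.2 ^ 2 == q.1.2 ^ 2 + q.2.1 ^ 2)%N.
pose P2 := [seq (n, m) | n <- r, m <- r].
pose S4 := [seq q <- [seq (u, v) | u <- P2, v <- P2] | sol q].
have q4 : quadruple_count R r = (size S4)%:R.
  rewrite size_filter -sum1_count natr_sum big_mkcond /= big_allpairs.
  rewrite big_allpairs; apply: eq_bigr => n _; apply: eq_bigr => m _.
  rewrite big_allpairs; apply: eq_bigr => k _; apply: eq_bigr => l _.
  by rewrite /sol /=; case: ifP.
have q3 : (\sum_(x <- X) \sum_(z <- X) (gcdn x z)%:R) / 2 <= (size S3)%:R :> R.
  rewrite size_filter -sum1_count natr_sum [leRHS]big_mkcond [leRHS]big_allpairs [leRHS]big_allpairs.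
  rewrite mulr_suml !big_nat; apply: ler_sum => x /andP[x1 x2].
  rewrite mulr_suml !big_nat; apply: ler_sum => z _.
  set g := gcdn x z; have gB : (g < B)%N.
    by apply: leq_ltn_trans x2; apply: dvdn_leq; [lia | exact: dvdn_gcdl].
  rewrite (big_cat_nat (n := (g./2).+1)) //=; last by rewrite ltnS; lia.
  apply: le_trans (_ : \sum_(0 <= i < (g./2).+1) (1 : R) <= _).
    rewrite sumr_const_nat subn0 ler_pdivrMr // -natrM ler_nat.
    by have := odd_double_half g; lia.
  rewrite -[leLHS]addr0; apply: lerD; last by apply: sumr_ge0 => i _; case: ifP.
  rewrite !big_nat; apply: ler_sum => i /andP[_ ig].
  suff -> : cond (x, z, i) by [].
  rewrite /cond /= -/g; have := odd_double_half g; lia.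
apply: le_trans q3 _; rewrite q4 ler_nat.
have memX x : x \in X -> (8 * D <= x <= 10 * D)%N by rewrite mem_index_iota.
have S3P x z i : (x, z, i) \in S3 -> [/\ (8 * D <= x <= 10 * D)%N, (8 * D <= z <= 10 * D)%N & (2 * i <= gcdn x z)%N].
  rewrite mem_filter => /andP[c /allpairsP[[v j] /= [hv _ [E1 E2]]]].
  rewrite -{}E1 in hv; case/allpairsP: hv => [[x' z'] /= [hx hz [Ex Ez]]].
  move: c; rewrite /cond /= Ex Ez => c; by split; [exact: memX | exact: memX | exact: c].
have geo x z i : (x, z, i) \in S3 -> let g := gcdn x z in
   let y := ((z %/ g) * (7 * g - i))%N in let w := ((x %/ g) * (7 * g - i))%N in
   [/\ (0 < g)%N, (52 * D <= y <= 70 * D)%N, (52 * D <= w <= 70 * D)%N, (x <= y)%N & (z <= w)%N].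
  move=> /S3P[hx hz hi] g y w; have g0 : (0 < g)%N by rewrite gcdn_gt0; lia.
  have gy : (52 * D <= y <= 70 * D)%N by apply: quadruple_scale; rewrite ?dvdn_gcdr.
  have gw : (52 * D <= w <= 70 * D)%N by apply: quadruple_scale; rewrite ?dvdn_gcdl.
  have D52 : (10 * D <= 52 * D)%N by rewrite leq_mul2r orbT.
  split=> //.
    by case/andP: gy => gy _; case/andP: hx => _ hx; exact: leq_trans hx (leq_trans D52 gy).
  by case/andP: gw => gw _; case/andP: hz => _ hz; exact: leq_trans hz (leq_trans D52 gw).
have uS3 : uniq S3.
  rewrite filter_uniq //; apply: allpairs_uniq; rewrite ?iota_uniq //; last by move=> [? ?] [? ?] _ _ [-> ->].
  by apply: allpairs_uniq; rewrite ?iota_uniq // => -[? ?] [? ?] _ _ [-> ->].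
rewrite -(size_map quadruple S3); apply: uniq_leq_size.
  rewrite map_inj_in_uniq // => -[[x z] i] [[x' z'] i'] h h'.
  have [hx hz hi] := S3P _ _ _ h; have [hx' hz' hi'] := S3P _ _ _ h'.
  have [g0 _ _ xy zw] := geo _ _ _ h; have [g0' _ _ xy' zw'] := geo _ _ _ h'.
  rewrite /quadruple => -[e1 e2 e3 e4].
  have [ey ex] := sum_diff_inj _ _ _ _ xy xy' e1 e2.
  have [_ ez] := sum_diff_inj _ _ _ _ zw zw' e3 e4.
  move: ey; rewrite -ex -ez => /eqP; rewrite eqn_mul2l.
  have z0 : (0 < z)%N by move: hz D39; clear; lia.
  have -> : (z %/ gcdn x z == 0)%N = false.
    by apply/negbTE; rewrite -lt0n divn_gt0 // dvdn_leq ?dvdn_gcdr.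
  move=> /eqP ei; congr (_, _); rewrite -ex -ez in hi'; move: ei hi hi'.
  by move: (gcdn x z) => g; clear; lia.
move=> q /mapP[[[x z] i] h ->]; have [hx hz hi] := S3P _ _ _ h.
have [g0 gy gw xy zw] := geo _ _ _ h.
rewrite mem_filter; apply/andP; split.
  by rewrite /sol; apply/eqP; apply: (@quadruple_eq x z i).
apply/allpairsP; exists (quadruple (x, z, i)); rewrite /quadruple /=.
move: gy gw; move: (z %/ _ * _)%N (x %/ _ * _)%N => y w gy gw.
have range a b : (8 * D <= a <= 10 * D)%N -> (52 * D <= b <= 70 * D)%N ->
    (b + a)%N \in r /\ (b - a)%N \in r.
  by rewrite /r !mem_index_iota; move: K1 K2 D39; clear; lia.
have [r1 r2] := range x y hx gy; have [r3 r4] := range z w hz gw.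
by split=> //; apply/allpairsP; [exists (y + x, y - x)%N | exists (w + z, w - z)%N].
Qed.

Lemma quadruple_count_ge : exists2 c : R, 0 < c & exists K0 : nat,
  forall K : nat, (K0 <= K)%N ->
  c * (K%:R ^+ 2 * ln K%:R) <= quadruple_count R (index_iota K (2 * K).+1).
Proof.
exists ((80^-1) ^+ 2 / 8).
  by rewrite divr_gt0 // exprn_gt0 // invr_gt0.
(* For K >= 80^2 one has D >= K/80 >= K^(1/2), so ln D is at least half of ln K. *)
exists (80 * 80)%N => K hK.
pose D := (K %/ 40)%N.
have KD : (40 * D <= K < 40 * D + 40)%N.
  by have := divn_eq K 40; have := ltn_pmod K (isT : 0 < 40)%N; rewrite -/D; lia.
have D80 : (160 <= D)%N by lia.
have D0 : (0 < D)%N by lia.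
apply: le_trans (quadruple_count_gcd D K _ KD); last by lia.
have K0R : 0 < K%:R :> R by rewrite ltr0n; lia.
have D0R : 0 < D%:R :> R by rewrite ltr0n.
have h := sum_gcd_ge R D D0.
have KD80 : K%:R / 80 <= D%:R :> R.
  by rewrite ler_pdivrMr // -natrM ler_nat; lia.
have lnD : ln K%:R / 2 <= ln D%:R :> R.
  rewrite ler_pdivrMr // mulr_natr -[X in _ <= X *+ _]mulr1 -mulrnAr mulr_natr -lnXn //.
  rewrite ler_ln ?posrE ?exprn_gt0 // -natrX ler_nat; nia.
have lnK : 0 <= ln K%:R :> R by rewrite ln_ge0 // ler1n; lia.
have h1 : (80^-1) ^+ 2 * K%:R ^+ 2 <= D%:R ^+ 2 :> R.
  by rewrite -exprMn lerXn2r ?nnegrE ?mulr_ge0 ?invr_ge0 // ?(ltW K0R) // mulrC.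
have h2 : (80^-1) ^+ 2 * K%:R ^+ 2 * (ln K%:R / 2 / 2) <= D%:R ^+ 2 * (ln D%:R / 2) :> R.
  by apply: ler_pM => //; rewrite ?mulr_ge0 ?sqr_ge0 ?invr_ge0 // ler_pM2r ?invr_gt0.
set Z := \sum_(_ <= _ < _) _ in h *.
set e : R := (80^-1) ^+ 2 in h1 h2 *.
have : e / 8 * (K%:R ^+ 2 * ln K%:R) = (e * K%:R ^+ 2 * (ln K%:R / 2 / 2)) / 2 by field.
move=> ->; rewrite ler_pM2r ?invr_gt0 //; exact: le_trans h2 h.
Qed.

End QuadrupleCount.

(** * Complex moduli and passage to the limit *)

Section Modulus.
Variable R : realType.
Local Notation I01 := (`[0%R : R, 1%R : R]%classic).
Local Notation mfun01 := (@measurable_fun _ _ (measurableTypeR R) (measurableTypeR R) I01).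

Definition modulus (f g : R -> R) (x : R) : R := Num.sqrt (f x ^+ 2 + g x ^+ 2).

Lemma modulus_ge0 f g x : 0 <= modulus f g x. Proof. exact: sqrtr_ge0. Qed.

Lemma modulus_sq f g x : modulus f g x ^+ 2 = f x ^+ 2 + g x ^+ 2.
Proof. by rewrite sqr_sqrtr // addr_ge0 ?sqr_ge0. Qed.

Lemma Lnorm_powE q f g : Lnorm_pow q f g = Lp_pow R q (modulus f g).
Proof.
apply: eq_integral => x _; rewrite /cabs_pow (ger0_norm (modulus_ge0 f g x)).
rewrite /modulus -powR12_sqrt ?addr_ge0 ?sqr_ge0 // -powRrM; congr (_ `^ _)%:E; ring.
Qed.

Lemma norm_le_modulus f g x : `|f x| <= modulus f g x.
Proof. by rewrite -sqrtr_sqr ler_wsqrtr // lerDl sqr_ge0. Qed.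

Lemma norm_le_modulus_snd f g x : `|g x| <= modulus f g x.
Proof. by rewrite -sqrtr_sqr ler_wsqrtr // lerDr sqr_ge0. Qed.

Lemma modulus_le f g x : modulus f g x <= `|f x| + `|g x|.
Proof.
have h : 0 <= `|f x| + `|g x| by rewrite addr_ge0.
rewrite -[leRHS]ger0_norm // -sqrtr_sqr ler_wsqrtr //.
rewrite -(real_normK (num_real (f x))) -(real_normK (num_real (g x))).
have : 0 <= `|f x| * `|g x| by rewrite mulr_ge0.
rewrite sqrrD; lra.
Qed.

Lemma modulus_triangle (f g f' g' : R -> R) x :
  modulus f g x <= modulus f' g' x + modulus (fun y => f y - f' y) (fun y => g y - g' y) x.
Proof.
set A := modulus f' g' x; set B := modulus (fun y => f y - f' y) (fun y => g y - g' y) x.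
have A0 : 0 <= A := modulus_ge0 _ _ _; have B0 : 0 <= B := modulus_ge0 _ _ _.
have AE : A ^+ 2 = f' x ^+ 2 + g' x ^+ 2 := modulus_sq _ _ _.
have BE : B ^+ 2 = (f x - f' x) ^+ 2 + (g x - g' x) ^+ 2 := modulus_sq _ _ _.
set a := f' x in AE BE; set b := g' x in AE BE; set c := f x - a in BE; set d := g x - b in BE.
have CS : a * c + b * d <= A * B.
  have AB0 : 0 <= A * B by rewrite mulr_ge0.
  apply: le_trans (ler_norm _) _; rewrite -[leRHS]ger0_norm // -ler_sqr ?nnegrE // !real_normK ?num_real //.
  rewrite exprMn AE BE -subr_ge0.
  have -> : (a ^+ 2 + b ^+ 2) * (c ^+ 2 + d ^+ 2) - (a * c + b * d) ^+ 2 = (a * d - b * c) ^+ 2 by ring.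
  exact: sqr_ge0.
have AB : 0 <= A + B by rewrite addr_ge0.
rewrite -[leRHS]ger0_norm // -sqrtr_sqr ler_wsqrtr //.
have -> : f x = a + c by rewrite /c; ring.
have -> : g x = b + d by rewrite /d; ring.
have -> : (A + B) ^+ 2 = A ^+ 2 + B ^+ 2 + 2 * (A * B) by ring.
rewrite AE BE; lra.
Qed.

Lemma measurable_modulus f g : mfun01 f -> mfun01 g -> mfun01 (modulus f g).
Proof.
move=> mf mg; apply: (@measurableT_comp _ _ _ _ _ _ (@Num.sqrt R)).
  apply: continuous_measurable_fun; exact: sqrt_continuous.
by apply: measurable_funD; apply: measurable_funX.
Qed.

Lemma measurable_modulusB f g f' g' : mfun01 f -> mfun01 g -> mfun01 f' -> mfun01 g' ->
  mfun01 (modulus (fun x => f x - f' x) (fun x => g x - g' x)).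
Proof. by move=> mf mg mf' mg'; apply: measurable_modulus; apply: measurable_funB. Qed.

(** Monotonicity of norms on a space of measure one: the tangent line of v^(p/q) at v = b^q is
    integrated, [c] being the inverse of its slope. *)
Lemma Lp_pow_mono (q p b : R) (h : R -> R) : 0 < q -> q <= p -> 0 < b -> mfun01 h ->
  (Lp_pow R p h <= (b `^ p)%:E)%E -> (Lp_pow R q h <= (b `^ q)%:E)%E.
Proof.
move=> q0 qp b0 mh Hp; have p0 : 0 < p by apply: lt_le_trans qp.
pose r := p / q; have r1 : 1 <= r by rewrite ler_pdivlMr // mul1r.
have r0 : 0 < r by lra.
have u0 : 0 < b `^ q by rewrite powR_gt0.
have v0 : 0 < (b `^ q) `^ (r - 1) by rewrite powR_gt0.
pose c := (r * (b `^ q) `^ (r - 1))^-1; have c0 : 0 < c by rewrite invr_gt0 mulr_gt0.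
have rE x : 0 <= x -> (x `^ q) `^ r = x `^ p.
  by move=> x0; rewrite -powRrM /r mulrC divfK // gt_eqF.
have uE : (b `^ q) `^ r = b `^ q * (b `^ q) `^ (r - 1) by rewrite mulr_powRB1 // ltW.
have rinv : 0 <= 1 - r^-1 by rewrite subr_ge0 invf_le1.
have pw x : `|h x| `^ q <= (1 - r^-1) * b `^ q + c * `|h x| `^ p.
  have := powR_tangent R r (`|h x| `^ q) (b `^ q) r1 (powR_ge0 _ _) (ltW u0).
  rewrite uE (rE `|h x|) // => T.
  have : c * (b `^ q * (b `^ q) `^ (r - 1) + r * (b `^ q) `^ (r - 1) * (`|h x| `^ q - b `^ q)) <= c * `|h x| `^ p.
    by rewrite ler_pM2l.
  have -> : c * (b `^ q * (b `^ q) `^ (r - 1) + r * (b `^ q) `^ (r - 1) * (`|h x| `^ q - b `^ q)) =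
     `|h x| `^ q - (1 - r^-1) * b `^ q.
    by rewrite /c; field; rewrite !gt_eqF.
  lra.
have mI := measurable_I01 R.
apply: le_trans (_ : \int[@lebesgue_measure R]_(x in I01)
   (((1 - r^-1) * b `^ q)%:E + c%:E * (`|h x| `^ p)%:E) <= _)%E.
  apply: ge0_le_integral => //.
  - by apply/measurable_EFinP; exact: measurable_Lp_pow.
  - apply: emeasurable_funD => //; apply: measurable_funeM; apply/measurable_EFinP; exact: measurable_Lp_pow.
  - by move=> x _; rewrite -EFinM -EFinD lee_fin; exact: pw.
rewrite ge0_integralD; first last.
- by apply: measurable_funeM; apply/measurable_EFinP; exact: measurable_Lp_pow.
- by move=> x _; rewrite -EFinM lee_fin mulr_ge0 ?powR_ge0 // ltW.
- exact: measurable_cst.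
- by move=> x _; rewrite lee_fin mulr_ge0 ?powR_ge0.
- exact: mI.
rewrite integral01_cst ge0_integralZl_EFin; first last.
- exact: ltW.
- by apply/measurable_EFinP; exact: measurable_Lp_pow.
- by move=> x _; rewrite lee_fin powR_ge0.
- exact: mI.
apply: le_trans (_ : ((1 - r^-1) * b `^ q)%:E + c%:E * (b `^ p)%:E <= _)%E.
  by apply: leeD => //; apply: lee_wpmul2l => //; rewrite lee_fin ltW.
rewrite -EFinM -EFinD lee_fin -(rE b (ltW b0)) uE.
rewrite le_eqVlt; apply/orP; left; apply/eqP.
by rewrite /c; field; rewrite !gt_eqF.
Qed.

Definition pair_cvg (p : R) (u v : nat -> R -> R) (g h : R -> R) : Prop :=
  (Lnorm_pow p (fun x => (u M x - g x)%R) (fun x => (v M x - h x)%R) @[M --> \oo] --> 0%E)%classic.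

Lemma pair_cvg_near p u v g h (e : R) : pair_cvg p u v g h -> 0 < e ->
  exists M0 : nat, forall M : nat, (M0 <= M)%N ->
  (Lnorm_pow p (fun x => (u M x - g x)%R) (fun x => (v M x - h x)%R) <= e%:E)%E.
Proof.
move=> /fine_cvgP[fn /cvgrPdist_lt cv] e0.
have [M1 _ H1] := fn; have [M2 _ H2] := cv e e0.
exists (maxn M1 M2) => M; rewrite geq_max => /andP[h1 h2].
have := H1 M h1; have := H2 M h2; rewrite /= sub0r normrN => h3 h4.
rewrite -(fineK h4) lee_fin ltW //; exact: le_lt_trans (ler_norm _) h3.
Qed.

(** A single partial sum within b of the limit suffices, and the factor 2 pays for that distance.
    Closeness in L^p gives closeness in L^q, so the same limit can be measured in both norms of the
    flatness. *)
Lemma limit_upper (q p b : R) u v g h : 1 <= q -> q <= p -> 0 < b ->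
  (forall M, mfun01 (u M)) -> (forall M, mfun01 (v M)) -> mfun01 g -> mfun01 h ->
  pair_cvg p u v g h ->
  (exists M0 : nat, forall M : nat, (M0 <= M)%N -> (Lnorm_pow q (u M) (v M) <= (b `^ q)%:E)%E) ->
  (Lnorm_pow q g h <= ((2 * b) `^ q)%:E)%E.
Proof.
move=> q1 qp b0 mu mv mg mh cv [M0 HM].
have [M1 H1] := pair_cvg_near p u v g h (b `^ p) cv (powR_gt0 _ b0).
pose M := maxn M0 M1.
have md : mfun01 (modulus (fun x => u M x - g x) (fun x => v M x - h x)).
  by apply: measurable_modulusB.
rewrite Lnorm_powE; have -> : 2 * b = b + b by ring.
apply: (minkowski R q b b _ (modulus (u M) (v M)) _ q1 b0 b0 _ _ md).
- exact: measurable_modulus.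
- exact: measurable_modulus.
- move=> x _; rewrite !ger0_norm ?modulus_ge0 //.
  apply: le_trans (modulus_triangle g h (u M) (v M) x) _; rewrite lerD2l /modulus.
  by rewrite (_ : (g x - u M x) ^+ 2 + (h x - v M x) ^+ 2 = (u M x - g x) ^+ 2 + (v M x - h x) ^+ 2) //; ring.
- by rewrite -Lnorm_powE; apply: HM; exact: leq_maxl.
- apply: (Lp_pow_mono q p) => //; first by lra.
  by rewrite -Lnorm_powE; apply: H1; exact: leq_maxr.
Qed.

(** If the limit had norm below b/4, a partial sum within b/4 of it would have norm at most b/2 <
    b. *)
Lemma limit_lower (q p b : R) u v g h : 1 <= q -> q <= p -> 0 < b ->
  (forall M, mfun01 (u M)) -> (forall M, mfun01 (v M)) -> mfun01 g -> mfun01 h ->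
  pair_cvg p u v g h ->
  (exists M0 : nat, forall M : nat, (M0 <= M)%N -> ((b `^ q)%:E <= Lnorm_pow q (u M) (v M))%E) ->
  (((b / 4) `^ q)%:E <= Lnorm_pow q g h)%E.
Proof.
move=> q1 qp b0 mu mv mg mh cv [M0 HM]; rewrite leNgt; apply/negP => /ltW Hg.
have b4 : 0 < b / 4 by rewrite divr_gt0.
have [M1 H1] := pair_cvg_near p u v g h ((b / 4) `^ p) cv (powR_gt0 _ b4).
pose M := maxn M0 M1.
have md : mfun01 (modulus (fun x => u M x - g x) (fun x => v M x - h x)).
  by apply: measurable_modulusB.
have : (Lnorm_pow q (u M) (v M) <= ((b / 4 + b / 4) `^ q)%:E)%E.
  rewrite Lnorm_powE.
  apply: (minkowski R q _ _ _ (modulus g h) _ q1 b4 b4 _ _ md).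
  - exact: measurable_modulus.
  - exact: measurable_modulus.
  - move=> x _; rewrite !ger0_norm ?modulus_ge0 //; exact: modulus_triangle.
  - by rewrite -Lnorm_powE.
  - apply: (Lp_pow_mono q p) => //; first by lra.
    by rewrite -Lnorm_powE; apply: H1; exact: leq_maxr.
move=> /(le_trans (HM M (leq_maxl _ _))); rewrite lee_fin; apply/negP; rewrite -ltNge.
apply: gt0_ltr_powR; rewrite ?nnegrE; lra.
Qed.

End Modulus.

(** * Completeness of L^p *)

Section Completeness.
Variable R : realType.
Local Notation I01 := (`[0%R : R, 1%R : R]%classic).
Local Notation mfun01 := (@measurable_fun _ _ (measurableTypeR R) (measurableTypeR R) I01).

(** The sum of |w_(j+1) - w_j| has integral at most 2, so it is finite almost everywhere and the
    telescoping series converges absolutely there. *)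
Lemma ae_cvg_of_summable (w : nat -> R -> R) : (forall j, mfun01 (w j)) ->
  (forall j, (Lp_pow R 1 (fun x => (w j.+1 x - w j x)%R) <= ((2^-1) ^+ j)%:E)%E) ->
  {ae @lebesgue_measure R, forall x, I01 x -> cvgn (fun j => w j x)}.
Proof.
move=> mw Hw; have mI := measurable_I01 R.
pose d j x := w j.+1 x - w j x.
have md j : mfun01 (d j) by apply: measurable_funB; exact: mw.
pose F j x : \bar R := `|d j x|%:E.
have mF j : measurable_fun I01 (F j).
  by apply/measurable_EFinP; apply: (@measurableT_comp _ _ _ _ _ _ (@Num.norm R R)); [exact: normr_measurable|exact: md].
have intF j : (\int[@lebesgue_measure R]_(x in I01) F j x <= ((2^-1) ^+ j)%:E)%E.
  apply: le_trans (Hw j); apply: ge0_le_integral => //.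
  - by move=> x _; rewrite lee_fin.
  - exact: mF.
  - by apply/measurable_EFinP; apply: measurable_Lp_pow; exact: md.
  - by move=> x _; rewrite /F lee_fin powRr1.
have Sfin : (\int[@lebesgue_measure R]_(x in I01) \sum_(0 <= j <oo) F j x <= 2%:E)%E.
  rewrite integral_nneseries; [|exact: mI|by move=> j; exact: mF|by move=> j x _; rewrite lee_fin].
  apply: lime_le; first by apply: is_cvg_nneseries => n _ _; apply: integral_ge0 => x _; rewrite lee_fin.
  apply: nearW => n; apply: le_trans (_ : \sum_(0 <= j < n) ((2^-1) ^+ j)%:E <= _)%E.
    by apply: lee_sum => j _; exact: intF.
  rewrite sumEFin lee_fin; apply: le_trans (sum_geo_le R (2^-1) n _ _) _.
  - by rewrite invr_ge0.
  - by rewrite invf_lt1 // ltr1n.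
  - have -> : 1 - 2^-1 = 2^-1 :> R by field.
    by rewrite invrK.
have mS : measurable_fun I01 (fun x => \sum_(0 <= j <oo) F j x)%E.
  by apply: ge0_emeasurable_sum => [j x _ _|j _]; [rewrite lee_fin|exact: mF].
have iS : (@lebesgue_measure R).-integrable I01 (fun x => \sum_(0 <= j <oo) F j x)%E.
  apply/integrableP; split => //.
  under eq_integral do [rewrite gee0_abs; last by apply: nneseries_ge0 => j _ _; rewrite lee_fin].
  by apply: le_lt_trans Sfin _; rewrite ltry.
apply: (@filterS _ _ (ae_filter_ringOfSetsType (@lebesgue_measure R)) _ _ _ (integrable_ae mI iS)).
move=> x Hx Ix; have {Hx Ix} := Hx Ix => fx.
have c1 : cvgn (series (fun j => `|d j x|)).
  by apply: nnseries_is_cvg; [move=> i; exact: normr_ge0|rewrite ltey_eq fx].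
have c2 : cvgn (series (fun j => d j x)) by apply: normed_cvg.
have E : (fun j => w j x) = (fun j => w 0%N x + series (fun j => d j x) j).
  apply/funext => j; rewrite /series /= /d (telescope_sumr (fun k => w k x)) //.
  by rewrite addrC subrK.
rewrite E; apply: is_cvgD => //; exact: is_cvg_cst.
Qed.

(** The extended limsup is measurable without any convergence; [fine] makes it real, with value 0
    where it is infinite, which on [0, 1] is a null set. *)
Lemma measurable_ae_limit (w : nat -> R -> R) : (forall j, mfun01 (w j)) ->
  (forall j, (Lp_pow R 1 (fun x => (w j.+1 x - w j x)%R) <= ((2^-1) ^+ j)%:E)%E) ->
  exists2 g : R -> R, mfun01 g &
  {ae @lebesgue_measure R, forall x, I01 x -> (w j x @[j --> \oo] --> g x)%classic}.
Proof.
move=> mw Hw.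
exists (fun x => fine (limn_esup (fun j => (w j x)%:E))).
  apply: (@measurableT_comp _ _ _ _ _ _ (@fine R)); first exact: fine_measurable.
  by apply: measurable_fun_limn_esup => j; apply/measurable_EFinP; exact: mw.
apply: filterS (ae_cvg_of_summable w mw Hw); first exact: (ae_filter_ringOfSetsType (@lebesgue_measure R)).
move=> x Hx Ix.
have /cvg_ex[l wl] := Hx Ix.
have /cvg_limn_einf_sup[_ ->] : ((fun j => (w j x)%:E) @ \oo --> l%:E)%classic by apply: cvg_EFin wl; exact: nearW.
exact: wl.
Qed.

(** For l > 0 the power is differentiable at l; at l = 0 the comparison t^p <= t on [0, 1] takes
    over. *)
Lemma cvg_powR (m : nat -> R) (l p : R) : 1 <= p -> (forall j, 0 <= m j) ->
  (m j @[j --> \oo] --> l)%classic -> (m j `^ p @[j --> \oo] --> l `^ p)%classic.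
Proof.
move=> p1 m0 ml; have l0 : 0 <= l by apply: (cvgr_to_ge ml); exact: nearW.
have p0 : 0 < p by lra.
have [l00|l00] := eqVneq l 0; last first.
  have lp : 0 < l by rewrite lt0r l00.
  apply: (@cvg_comp _ _ _ m (fun y => y `^ p) _ _ _ ml).
  have [dl _] := @is_derive1_powR R p l lp.
  by move/derivable1_diffP/differentiable_continuous: dl; exact.
rewrite l00 powR0 ?gt_eqF //; rewrite l00 in ml.
apply/cvgrPdist_lt => e e0.
have e1 : 0 < Num.min e 1 by rewrite lt_min e0 ltr01.
have /cvgrPdist_lt /(_ _ e1) [N _ HN] := ml.
exists N => // j /HN /=; rewrite !sub0r !normrN (ger0_norm (m0 j)) (ger0_norm (powR_ge0 _ _)).
rewrite lt_min => /andP[h1 h2]; apply: le_lt_trans h1.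
have [->|mj] := eqVneq (m j) 0; first by rewrite powR0 // gt_eqF.
by apply: ge1r_powR => //; rewrite lt0r mj m0 ltW.
Qed.

Lemma fatou_bound (f : nat -> R -> R) (g : R -> R) (C : \bar R) :
  (forall i, mfun01 (f i)) -> mfun01 g -> (forall i x, 0 <= f i x) -> (forall x, 0 <= g x) ->
  {ae @lebesgue_measure R, forall x, I01 x -> (f i x @[i --> \oo] --> g x)%classic} ->
  (forall i, (\int[@lebesgue_measure R]_(x in I01) (f i x)%:E <= C)%E) ->
  (\int[@lebesgue_measure R]_(x in I01) (g x)%:E <= C)%E.
Proof.
move=> mf mg f0 g0 cv HC; have mI := measurable_I01 R.
have mE i : measurable_fun I01 (fun x => (f i x)%:E).
  by apply/measurable_EFinP; exact: mf.
apply: (@le_trans _ _ (\int[@lebesgue_measure R]_(x in I01) limn_einf (fun i => (f i x)%:E))%E).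
  apply: ae_ge0_le_integral => //.
  - by move=> x _; rewrite lee_fin.
  - by apply/measurable_EFinP; exact: mg.
  - move=> x _; rewrite limn_einf_lim; apply: lime_ge; first exact: is_cvg_einfs.
    apply: nearW => n; apply: le_ereal_inf_tmp => _ [k /= _ <-]; by rewrite lee_fin.
  - rewrite /limn_einf; apply: measurableT_comp => //.
    apply: (measurable_fun_limn_esup (f := fun i x => (- (f i x)%:E)%E)) => i.
    by apply: measurableT_comp.
  - apply: filterS cv; first exact: (ae_filter_ringOfSetsType (@lebesgue_measure R)).
    move=> x Hx Ix.
    have /cvg_limn_einf_sup[-> _] : ((fun j => (f j x)%:E) @ \oo --> (g x)%:E)%classic.
      by apply: cvg_EFin (Hx Ix); exact: nearW.
    by [].
apply: le_trans (fatou _ mI mE _) _ => [i x _|]; first by rewrite lee_fin.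
rewrite limn_einf_lim; apply: lime_le; first exact: is_cvg_einfs.
apply: nearW => n; apply: le_trans (HC n); apply: ereal_inf_lbound; by exists n => /=.
Qed.

(** Riesz-Fischer. Along a fast subsequence real and imaginary parts have summable L^1 increments,
    hence converge almost everywhere. Fatou along that subsequence, started at index j, then bounds
    the distance of every late term to the limit in L^p. *)
Lemma Lp_complete p (u v : nat -> R -> R) : 1 <= p ->
  (forall M, mfun01 (u M)) -> (forall M, mfun01 (v M)) ->
  (forall e : R, 0 < e -> exists M0 : nat, forall M M' : nat, (M0 <= M)%N -> (M0 <= M')%N ->
    (Lnorm_pow p (fun x => (u M x - u M' x)%R) (fun x => (v M x - v M' x)%R) <= (e `^ p)%:E)%E) ->
  exists g h : R -> R, [/\ mfun01 g, mfun01 h & pair_cvg R p u v g h].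
Proof.
move=> p1 mu mv cauchy; have mI := measurable_I01 R; have p0 : 0 < p by lra.
have hpos j : 0 < (2^-1) ^+ j :> R by rewrite exprn_gt0 // invr_gt0.
have [N0 HN0] := choice (fun j => cauchy _ (hpos j)).
(* The maximum places n j beyond all thresholds up to j, so the subsequence from j on respects the
   threshold of j. *)
pose n j := (\max_(i < j.+1) N0 i + j)%N.
have nN i j : (i <= j)%N -> (N0 i <= n j)%N.
  move=> ij; apply: leq_trans (leq_addr _ _).
  exact: (@leq_bigmax _ (fun i : 'I_j.+1 => N0 i) (Ordinal (ij : (i < j.+1)%N))).
have part (w : nat -> R -> R) : (forall M, mfun01 (w M)) ->
   (forall M M' x, `|w M x - w M' x| <= modulus R (fun x => u M x - u M' x) (fun x => v M x - v M' x) x) ->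
   exists2 g : R -> R, mfun01 g &
     {ae @lebesgue_measure R, forall x, I01 x -> (w (n j) x @[j --> \oo] --> g x)%classic}.
  move=> mw Hw; apply: (@measurable_ae_limit (fun j => w (n j))) => // j.
  have md M M' : mfun01 (modulus R (fun x => u M x - u M' x) (fun x => v M x - v M' x)).
    by apply: measurable_modulusB.
  apply: le_trans (_ : Lp_pow R 1 (modulus R (fun x => (u (n j.+1) x - u (n j) x)%R) (fun x => (v (n j.+1) x - v (n j) x)%R)) <= _)%E.
    apply: le_Lp_pow => //; first by apply: measurable_funB; exact: mw.
    by move=> x _; rewrite (ger0_norm (modulus_ge0 _ _ _ _)); exact: Hw.
  rewrite -[(2^-1) ^+ j]powRr1 ?(ltW (hpos j)) //.
  apply: (Lp_pow_mono R 1 p) => //.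
  by rewrite -Lnorm_powE; apply: HN0; apply: nN.
have [g mg Hg] := part u mu (fun M M' x => norm_le_modulus R (fun x => u M x - u M' x) (fun x => v M x - v M' x) x).
have [h mh Hh] := part v mv (fun M M' x => norm_le_modulus_snd R (fun x => u M x - u M' x) (fun x => v M x - v M' x) x).
exists g, h; split => //.
have bound j M : (N0 j <= M)%N ->
   (Lnorm_pow p (fun x => (u M x - g x)%R) (fun x => (v M x - h x)%R) <= (((2^-1) ^+ j) `^ p)%:E)%E.
  move=> jM; rewrite Lnorm_powE.
  pose phi i x : R := modulus R (fun x => u M x - u (n (j + i)%N) x) (fun x => v M x - v (n (j + i)%N) x) x.
  have mphi i : mfun01 (phi i) by apply: measurable_modulusB.
  have mlim : mfun01 (modulus R (fun x => u M x - g x) (fun x => v M x - h x)).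
    by apply: measurable_modulusB.
  apply: (fatou_bound (fun i x => `|phi i x| `^ p)).
  - by move=> i; exact: measurable_Lp_pow.
  - exact: measurable_Lp_pow.
  - by move=> i x; exact: powR_ge0.
  - by move=> x; exact: powR_ge0.
  - apply: filterS2 Hg Hh; first exact: (ae_filter_ringOfSetsType (@lebesgue_measure R)).
    move=> x Hgx Hhx Ix.
    have sh (w : nat -> R) (l : R) : (w i @[i --> \oo] --> l)%classic -> (w (j + i)%N @[i --> \oo] --> l)%classic.
      by move=> wl; under eq_fun do rewrite addnC; exact: (@cvg_comp _ _ _ (fun i => (i + j)%N) w _ _ _ (cvg_addnr j) wl).
    have cphi : (phi i x @[i --> \oo] --> modulus R (fun x => u M x - g x) (fun x => v M x - h x) x)%classic.
      apply: (@cvg_comp _ _ _ _ (@Num.sqrt R)); last exact: sqrt_continuous.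
      apply: cvgD.
        apply: cvgM; (apply: cvgB; [exact: cvg_cst|exact: (sh (fun i => u (n i) x) _ (Hgx Ix))]).
      apply: cvgM; (apply: cvgB; [exact: cvg_cst|exact: (sh (fun i => v (n i) x) _ (Hhx Ix))]).
    rewrite (ger0_norm (modulus_ge0 R _ _ x)).
    under eq_fun do rewrite (ger0_norm (modulus_ge0 R _ _ x)).
    exact: cvg_powR _ _ p p1 (fun i => modulus_ge0 R _ _ x) cphi.
  - move=> i; rewrite /phi -/(Lp_pow R p _) -Lnorm_powE; apply: HN0 => //.
    by apply: nN; exact: leq_addr.
rewrite /pair_cvg; apply/fine_cvgP.
have key j M : (N0 j <= M)%N -> Lnorm_pow p (fun x => (u M x - g x)%R) (fun x => (v M x - h x)%R) \is a fin_num
   /\ fine (Lnorm_pow p (fun x => (u M x - g x)%R) (fun x => (v M x - h x)%R)) <= ((2^-1) ^+ j) `^ p.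
  move=> /(bound j); have : (0 <= Lnorm_pow p (fun x => (u M x - g x)%R) (fun x => (v M x - h x)%R))%E.
    by rewrite Lnorm_powE; exact: Lp_pow_ge0.
  case: (Lnorm_pow _ _ _) => [r| |] //=.
split; first by exists (N0 0%N) => // M /= /key[].
apply/cvgrPdist_lt => e e0.
have : ((1 / 2) ^+ j @[j --> \oo] --> (0:R))%classic.
  by apply: cvg_expr; rewrite ger0_norm; lra.
move=> /(cvg_powR _ _ _ p1 (fun j => exprn_ge0 j (divr_ge0 ler01 (ler0n _ 2)))).
rewrite powR0 ?gt_eqF // => /cvgrPdist_lt /(_ e e0)[J _ HJ].
exists (N0 J) => // M /= /key[_ H2].
have := HJ J (leqnn J) => /=; rewrite !sub0r !normrN div1r (ger0_norm (powR_ge0 _ _)) => H3.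
rewrite ger0_norm; first exact: le_lt_trans H2 H3.
by apply: fine_ge0; rewrite Lnorm_powE; exact: Lp_pow_ge0.
Qed.

End Completeness.

(** * Two-sided bounds for the norms of the partial tails *)

Section TailNorms.
Variable R : realType.
Variable s : R.
Local Notation I01 := (`[0%R : R, 1%R : R]%classic).
Local Notation mfun01 := (@measurable_fun _ _ (measurableTypeR R) (measurableTypeR R) I01).

Lemma index_iota_cat (i j k : nat) : (i <= j)%N -> (j <= k)%N ->
  index_iota i k = index_iota i j ++ index_iota j k.
Proof.
move=> ij jk; rewrite /index_iota -{2}(subnKC ij) -iotaD; congr (iota _ _); lia.
Qed.

Definition coef (n : nat) : R := n%:R `^ (- (2 * s)).
Definition tail_re (K M : nat) : R -> R := cos_sum R coef (index_iota K M).
Definition tail_im (K M : nat) : R -> R := sin_sum R coef (index_iota K M).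
(** The order of the L^p norm of the tail starting at K; for p = 2 it is K^(1/2 - 2s). *)
Definition size_scale (p : R) (K : nat) : R := logfactor R p K%:R * K%:R `^ (expo R p - 2 * s).

Lemma coef_ge0 n : 0 <= coef n. Proof. exact: powR_ge0. Qed.

Lemma size_scale_gt0 p K : (0 < K)%N -> 0 < size_scale p K.
Proof.
move=> K0; rewrite mulr_gt0 ?powR_gt0 ?ltr0n //.
by apply: lt_le_trans (logfactor_ge1 R p K%:R _); rewrite ?ltr01 // ler1n.
Qed.

Lemma measurable_tail (K M : nat) (c : R) :
  mfun01 (fun x => \sum_(K <= n < M) coef n * cos (2 * pi * (n ^ 2)%:R * x + c)).
Proof.
apply: (@measurable_sum _ _ _ _ _ _ (fun n x => coef n * cos (2 * pi * (n ^ 2)%:R * x + c))) => n.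
by apply: measurable_mulC; apply: measurable_cos_comp; apply: measurable_funD => //; apply: measurable_mulC; exact: measurable_id01.
Qed.

Lemma tail_reE K M : tail_re K M = (fun x => \sum_(K <= n < M) coef n * cos (2 * pi * (n ^ 2)%:R * x + 0)).
Proof. by apply/funext => x; under eq_bigr do rewrite addr0. Qed.

(** A sine is a cosine shifted by pi/2, so the bound with free constant phase applies to imaginary
    parts. *)
Lemma tail_imE K M : tail_im K M =
  (fun x => \sum_(K <= n < M) coef n * cos (2 * pi * (n ^ 2)%:R * x + - (pi / 2))).
Proof. by apply/funext => x; apply: eq_bigr => n _; rewrite cosBpihalf. Qed.

Lemma measurable_tail_re K M : mfun01 (tail_re K M).
Proof. by rewrite tail_reE; exact: measurable_tail. Qed.

Lemma measurable_tail_im K M : mfun01 (tail_im K M).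
Proof. by rewrite tail_imE; exact: measurable_tail. Qed.

Lemma sum_fourth K M : \sum_(K <= n < M) coef n ^+ 2 = \sum_(K <= n < M) n%:R `^ (- (4 * s)).
Proof.
apply: eq_bigr => n _; rewrite /coef -powR_mulrn ?powR_ge0 // -powRrM.
by congr (_ `^ _); ring.
Qed.

Lemma Lnorm_pow2 K M : Lnorm_pow 2 (tail_re K M) (tail_im K M) =
  (\sum_(K <= n < M) n%:R `^ (- (4 * s)))%:E.
Proof.
rewrite -sum_fourth; have [_ <-] := mean_square R coef _ (iota_uniq K (M - K)).
apply: eq_integral => x _.
by rewrite /cabs_pow divff // powRr1 // addr_ge0 ?sqr_ge0.
Qed.

(** At p = 2 the dyadic shells no longer decay, so Parseval is used there: the tail of n^(-4s) is
    summable because s > 1/4. *)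
Lemma tail_norm_upper p : 2 <= p -> s_star p < s -> exists2 C : R, 0 < C &
  forall K M : nat, (0 < K)%N ->
  (Lnorm_pow p (tail_re K M) (tail_im K M) <= ((C * size_scale p K) `^ p)%:E)%E.
Proof.
move=> p2 hs; have [p2'|p2'] := ltP 2 p; last first.
  have -> : p = 2 by lra.
  have s4 : 1 / 4 < s by move: hs; rewrite /s_star; case: ifP => //; lra.
  pose g := 4 * s - 1; have g0 : 0 < g by rewrite /g; lra.
  have D0 : 0 < 2 `^ (g + 1) / g by rewrite divr_gt0 // powR_gt0.
  exists (Num.sqrt (2 `^ (g + 1) / g)) => [|K M K0]; first by rewrite sqrtr_gt0.
  rewrite Lnorm_pow2 lee_fin (_ : 4 * s = g + 1); last by rewrite /g; ring.
  apply: le_trans (sum_powR_tail R g K M g0 K0) _.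
  have S0 := ltW (size_scale_gt0 2 K K0).
  rewrite powR_mulrn; last by apply: mulr_ge0; rewrite ?sqrtr_ge0.
  rewrite exprMn sqr_sqrtr ?(ltW D0) // ler_wpM2l ?(ltW D0) //.
  rewrite /size_scale /logfactor /expo ifF; last by apply/eqP; lra.
  rewrite ifT; last by lra.
  rewrite mul1r -powR_mulrn ?powR_ge0 // -powRrM.
  by rewrite (_ : (1 / 2 - 2 * s) * 2 = - g) // /g; field.
have [C C0 HC] := tail_upper R p s p2' hs; exists (2 * C); first by rewrite mulr_gt0.
move=> K M K0; rewrite Lnorm_powE.
have b0 : 0 < C * size_scale p K by rewrite mulr_gt0 ?size_scale_gt0.
have -> : 2 * C * size_scale p K = C * size_scale p K + C * size_scale p K by ring.
have mr := measurable_tail_re K M; have mi := measurable_tail_im K M.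
apply: (minkowski R p _ _ _ (tail_re K M) (tail_im K M) _ b0 b0 (measurable_modulus R _ _ mr mi) mr mi).
- by lra.
- by move=> x _; rewrite ger0_norm ?modulus_ge0 // modulus_le.
- by have := HC K M 0 K0; rewrite tail_reE /size_scale mulrA.
- by have := HC K M (- (pi / 2)) K0; rewrite tail_imE /size_scale mulrA.
Qed.

Lemma sum_block_ge K M : 0 < s -> (0 < K)%N -> ((2 * K) < M)%N ->
  (2 `^ (- (2 * s)) * K%:R `^ (1 / 2 - 2 * s)) ^+ 2 <= \sum_(K <= n < M) n%:R `^ (- (4 * s)).
Proof.
move=> s0 K0 KM; have KR : 0 < K%:R :> R by rewrite ltr0n.
rewrite (big_cat_nat (n := (2 * K)%N)) ?(ltnW KM) ?leq_pmull //=.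
rewrite -[leLHS]addr0; apply: lerD; last by apply: sumr_ge0 => n _; exact: powR_ge0.
apply: le_trans (_ : \sum_(K <= n < 2 * K) (2 * K%:R) `^ (- (4 * s)) <= _); last first.
  apply: ler_sum_nat => n /andP[Kn nK]; apply: powR_anti; first by lra.
    by rewrite ltr0n (leq_trans K0).
  by rewrite -natrM ler_nat ltnW.
rewrite sumr_const_nat -[(2 * K - K)%N]/(K + (K + 0) - K)%N addn0 addnK.
rewrite powRM ?(ltW KR) // -[leRHS]mulr_natl exprMn -!powR_mulrn ?powR_ge0 // -!powRrM.
have -> : (1 / 2 - 2 * s) * 2%:R = 1 + - (4 * s) by field.
rewrite powRD_gt0 // powRr1 ?(ltW KR) //.
have -> : - (2 * s) * 2%:R = - (4 * s) by ring.
by rewrite mulrCA.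
Qed.

Lemma Lnorm2_lower K M : 0 < s -> (0 < K)%N -> (2 * K < M)%N ->
  (((2 `^ (- (2 * s)) * size_scale 2 K) `^ 2)%:E <= Lnorm_pow 2 (tail_re K M) (tail_im K M))%E.
Proof.
move=> s0 K0 KM; rewrite Lnorm_pow2 lee_fin.
rewrite powR_mulrn; last by rewrite mulr_ge0 ?powR_ge0 // ltW // size_scale_gt0.
have -> : size_scale 2 K = K%:R `^ (1 / 2 - 2 * s); last exact: sum_block_ge.
rewrite /size_scale /logfactor /expo ifF; last by apply/eqP; lra.
by rewrite ifT ?mul1r; lra.
Qed.

Lemma tail_norm_lower p : 2 <= p -> s_star p < s -> exists2 c : R, 0 < c &
  exists K0 : nat, forall K M : nat, (K0 <= K)%N -> (2 * K < M)%N ->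
  (((c * size_scale p K) `^ p)%:E <= Lnorm_pow p (tail_re K M) (tail_im K M))%E.
Proof.
move=> p2 hs; have s0 : 0 < s.
  move: hs; rewrite /s_star; case: ifP => [_|/negbT]; first by lra.
  rewrite -ltNge => p4 hs; apply: le_lt_trans hs.
  by rewrite subr_ge0 ler_pdivrMr; lra.
have mm K M := measurable_modulus R _ _ (measurable_tail_re K M) (measurable_tail_im K M).
have c20 : 0 < 2 `^ (- (2 * s)) :> R by rewrite powR_gt0.
have [p4|p4|p4] := ltgtP p 4.
(* For p < 4 the scales for p and for 2 coincide; halving the L^2 constant makes the contradiction
   strict. *)
- exists (2 `^ (- (2 * s)) / 2); first by rewrite divr_gt0.
  exists 1%N => K M K0 KM; rewrite leNgt; apply/negP => /ltW.
  rewrite Lnorm_powE.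
  have b0 : 0 < 2 `^ (- (2 * s)) / 2 * size_scale p K by rewrite mulr_gt0 ?size_scale_gt0 ?divr_gt0.
  move=> /(Lp_pow_mono R 2 p _ _ (ltr0n _ 2) p2 b0 (mm K M)); rewrite -Lnorm_powE.
  move=> /(le_trans (Lnorm2_lower K M s0 K0 KM)); rewrite lee_fin; apply/negP; rewrite -ltNge.
  have E : size_scale 2 K = size_scale p K.
    have e1 : (2 == 4 :> R) = false by apply/eqP; lra.
    have e2 : 2 <= 4 :> R by lra.
    by rewrite /size_scale /logfactor /expo (lt_eqF p4) (ltW p4) e1 e2.
  rewrite E; apply: gt0_ltr_powR; rewrite ?nnegrE ?(ltW b0) //.
    by rewrite mulr_ge0 // ltW // size_scale_gt0.
  by rewrite ltr_pM2r ?size_scale_gt0 // ltr_pdivrMr // ltr_pMr // ltr1n.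
(* The extra 1/8 absorbs the 8 in the degree of the kernel, since 8^(-p) <= 1/8; the K^2 in the
   degree accounts for the loss K^(-2/p) in the exponent. *)
- exists ((2 `^ (- (2 * s)) / 2) / 8); first by rewrite !divr_gt0.
  exists 1%N => K M K0 KM; have KR : 0 < K%:R :> R by rewrite ltr0n.
  have p0 : 0 < p by lra.
  pose t := 2 `^ (- (2 * s)) / 2 * K%:R `^ (1 - 2 * s).
  have t0 : 0 < t by rewrite mulr_gt0 ?divr_gt0 ?powR_gt0.
  have split_iota : index_iota K M = index_iota K (2 * K) ++ index_iota (2 * K) M.
    by apply: index_iota_cat; rewrite ?leq_pmull // ltnW.
  (* For n < 2K one has n^2 <= Q/2, so the kernel keeps at least half of each coefficient. *)
  pose Q := (8 * K ^ 2)%N.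
  have Q0 : (0 < Q)%N by rewrite muln_gt0 expn_gt0 K0.
  have QE : Q%:R = 8 * K%:R ^+ 2 :> R by rewrite natrM natrX.
  have Q0R : 0 < Q%:R :> R by rewrite ltr0n.
  have ht : t <= \sum_(n <- index_iota K (2 * K)) coef n * ((Q%:R - (n ^ 2)%:R) / Q%:R).
    apply: le_trans (_ : \sum_(K <= n < 2 * K) (2 * K%:R) `^ (- (2 * s)) * (1 / 2) <= _).
      rewrite sumr_const_nat -[(2 * K - K)%N]/(K + (K + 0) - K)%N addn0 addnK.
      rewrite powRM ?(ltW KR) // -[leRHS]mulr_natl /t powRD_gt0 // powRr1 ?(ltW KR) //.
      by rewrite le_eqVlt; apply/orP; left; apply/eqP; ring.
    apply: ler_sum_nat => n /andP[Kn nK]; apply: ler_pM; rewrite ?powR_ge0 //.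
      apply: powR_anti; [by lra|by rewrite ltr0n (leq_trans K0)|].
      by rewrite -natrM ler_nat ltnW.
    rewrite ler_pdivlMr // QE natrX.
    have : n%:R ^+ 2 <= (2 * K%:R) ^+ 2 :> R.
      by rewrite lerXn2r ?nnegrE ?mulr_ge0 // -natrM ler_nat ltnW.
    by rewrite exprMn; lra.
  rewrite Lnorm_powE.
  have hle x : I01 x -> `|cos_sum R coef (index_iota K (2 * K) ++ index_iota (2 * K) M) x| <=
      `|modulus R (tail_re K M) (tail_im K M) x|.
    by move=> _; rewrite -split_iota (ger0_norm (modulus_ge0 _ _ _ _)); exact: norm_le_modulus.
  apply: le_trans (Lp_lower_fejer R p t coef _ _ _ Q _ Q0 coef_ge0 (ltW t0) ht (mm K M) hle); last by lra.
  rewrite lee_fin QE.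
  have e1 : (p == 4) = false by apply/eqP; lra.
  have e2 : (p <= 4) = false by apply/negbTE; rewrite -ltNge.
  rewrite /size_scale /logfactor /expo e1 e2 mul1r.
  have -> : 2 `^ (- (2 * s)) / 2 / 8 * K%:R `^ (1 - 2 / p - 2 * s) = t * (8^-1 * K%:R `^ (- (2 / p))).
    have -> : 1 - 2 / p - 2 * s = (1 - 2 * s) + - (2 / p) by ring.
    by rewrite powRD_gt0 // /t; ring.
  rewrite powRM ?(ltW t0) ?mulr_ge0 ?powR_ge0 //; apply: ler_wpM2l; first exact: powR_ge0.
  rewrite powRM ?powR_ge0 // -powRrM (_ : - (2 / p) * p = - 2%:R); last by field; lra.
  rewrite powRN powR_mulrn ?(ltW KR) // (invfM 8) ler_wpM2r ?invr_ge0 ?exprn_ge0 ?(ltW KR) //.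
  by apply: ge1r_powR; lra.
- have [c0 c00 [K1 HK1]] := quadruple_count_ge R.
  (* 2^(-8s) is the fourth power of the loss on [K, 2K]; one factor 1/2 comes from [mean_fourth],
     the other from 1 + ln K <= 2 ln K, valid for K >= e. *)
  pose b := 2 `^ (- (8 * s)) * c0 / 4.
  have b0 : 0 < b by rewrite divr_gt0 ?mulr_gt0 ?powR_gt0.
  exists (b `^ (1 / 4)); first by rewrite powR_gt0.
  exists (maxn K1 (Num.bound (expR (1 : R))).+1) => K M; rewrite geq_max => /andP[KK1 K3] KM.
  have K0 : (0 < K)%N by apply: leq_trans K3.
  have KR : 0 < K%:R :> R by rewrite ltr0n.
  pose c := (2 * K%:R) `^ (- (2 * s)).
  have split_iota : index_iota K M = index_iota K (2 * K).+1 ++ index_iota (2 * K).+1 M.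
    by apply: index_iota_cat; rewrite // ltnW // ltnS leq_pmull.
  have ca n : n \in index_iota K (2 * K).+1 -> c <= coef n.
    rewrite mem_index_iota => /andP[Kn nK]; apply: powR_anti; [by lra|by rewrite ltr0n (leq_trans K0)|].
    by rewrite -natrM ler_nat.
  have [v vge [_ Iv]] := mean_fourth R coef _ (index_iota (2 * K).+1 M) c (powR_ge0 _ _) coef_ge0 ca.
  rewrite -split_iota in Iv.
  have -> : Lnorm_pow p (tail_re K M) (tail_im K M) = v%:E.
    rewrite -Iv; apply: eq_integral => x _; rewrite /cabs_pow p4.
    by rewrite (_ : 4 / 2 = 2%:R) ?powR_mulrn ?addr_ge0 ?sqr_ge0 //; field.
  rewrite lee_fin; apply: le_trans vge.
  apply: le_trans (_ : c ^+ 4 / 2 * (c0 * (K%:R ^+ 2 * ln K%:R)) <= _); last first.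
    by apply: ler_wpM2l; [rewrite divr_ge0 ?exprn_ge0 ?powR_ge0|exact: HK1].
  rewrite /size_scale /logfactor /expo p4 eqxx lexx.
  have l1 : 1 <= ln K%:R :> R.
    rewrite -[leLHS](@expRK R 1) ler_ln ?posrE ?expR_gt0 //.
    by apply: le_trans (ltW (archi_boundP (expR_ge0 1))) _; rewrite ler_nat ltnW.
  have -> : c ^+ 4 = 2 `^ (- (8 * s)) * K%:R `^ (- (8 * s)).
    rewrite -powR_mulrn ?powR_ge0 // -powRrM powRM ?(ltW KR) //.
    by have -> : - (2 * s) * 4 = - (8 * s) by ring.
  have fourth (u w : R) : 0 <= u -> 0 <= w ->
      (u `^ (1 / 4) * (w `^ (1 / 4) * K%:R `^ (1 / 2 - 2 * s))) `^ 4 =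
      u * (w * (K%:R ^+ 2 * K%:R `^ (- (8 * s)))).
    move=> u0 w0; rewrite powRM ?mulr_ge0 ?powR_ge0 // powRM ?powR_ge0 // -!powRrM.
    have -> : 1 / 4 * 4 = 1 :> R by field.
    have -> : (1 / 2 - 2 * s) * 4 = 2 + - (8 * s) by field.
    by rewrite powRD_gt0 // powR_mulrn ?(ltW KR) // !powRr1.
  rewrite fourth ?(ltW b0) //; last by lra.
  rewrite /b.
  set A := 2 `^ _; set B := K%:R `^ _; set D := K%:R ^+ 2.
  have AB : 0 <= A * B * c0 * D.
    by rewrite !mulr_ge0 ?powR_ge0 ?exprn_ge0 ?(ltW c00) ?(ltW KR).
  have : A * B * c0 * D * 1 <= A * B * c0 * D * ln K%:R by rewrite ler_wpM2l.
  lra.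
Qed.

End TailNorms.

(** * The high-pass filter: existence, size and rate *)

Section HighPassLimit.
Variable R : realType.
Local Notation I01 := (`[0%R : R, 1%R : R]%classic).
Local Notation mfun01 := (@measurable_fun _ _ (measurableTypeR R) (measurableTypeR R) I01).

(** K is the least positive integer with K^2 >= N. For K >= 2, minimality gives (K - 1)^2 < N, and K
    <= 2 (K - 1), so K^2 <= 4 N. *)
Lemma cutoff (N : nat) : exists2 K : nat, (0 < K)%N &
  (forall n, (0 < n)%N -> (N <= n ^ 2)%N = (K <= n)%N) /\
  ((0 < N)%N -> (N <= K ^ 2)%N /\ (K ^ 2 <= 4 * N)%N).
Proof.
have ex : exists n, (0 < n)%N && (N <= n ^ 2)%N by exists N.+1; nia.
case: (ex_minnP ex) => K /andP[K0 NK] Kmin; exists K => //; split.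
  move=> n n0; apply/idP/idP => [h|h]; first by apply: Kmin; rewrite n0.
  by apply: leq_trans NK _; rewrite leq_sqr.
move=> N0; split=> //; have [K1|K1] := leqP K 1; first by nia.
have : ~~ ((0 < K.-1)%N && (N <= K.-1 ^ 2)%N) by apply/negP => /Kmin; lia.
rewrite negb_and -!ltnNge => /orP[|]; first by lia.
by move: K1; clear; nia.
Qed.

Lemma HP_tail (s : R) (N K : nat) : (0 < K)%N ->
  (forall n, (0 < n)%N -> (N <= n ^ 2)%N = (K <= n)%N) ->
  HP_re s N = (fun M => tail_re R s K M.+1) /\ HP_im s N = (fun M => tail_im R s K M.+1).
Proof.
move=> K0 NK; split; apply/funext => M; apply/funext => x.
  rewrite /tail_re /cos_sum (big_nat_widenl _ 1) //= /HP_re [LHS]big_nat_cond [RHS]big_nat_cond.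
  by apply: eq_bigl => n; case: (posnP n) => [->|n0] //=; rewrite NK.
rewrite /tail_im /sin_sum (big_nat_widenl _ 1) //= /HP_im [LHS]big_nat_cond [RHS]big_nat_cond.
by apply: eq_bigl => n; case: (posnP n) => [->|n0] //=; rewrite NK.
Qed.

Lemma expo_lt (p s : R) : 2 <= p -> s_star p < s -> expo R p < 2 * s.
Proof. by move=> p2; rewrite /s_star /expo; case: ifP => _; lra. Qed.

Lemma s_star2_le (p : R) : 2 <= p -> s_star 2 <= s_star p.
Proof.
move=> p2; rewrite /s_star ifT; last by lra.
case: ifP => // /negbT; rewrite -ltNge => p4.
have : 1 / p <= 1 / 4 by rewrite !div1r lef_pV2 ?posrE; lra.
lra.
Qed.

(** The negative exponent is split into two halves: one M^(-d) beats the logarithm, the other tends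
    to 0. *)
Lemma size_scale_small (p s : R) : 2 <= p -> s_star p < s -> forall e : R, 0 < e ->
  exists M0 : nat, forall M : nat, (M0 <= M)%N -> size_scale R s p M <= e.
Proof.
move=> p2 hs e e0; have es := expo_lt p s p2 hs.
pose d := (2 * s - expo R p) / 2; have d0 : 0 < d by rewrite /d; lra.
have [C C0 HC] := logfactor_growth R p d d0.
exists (Num.bound ((C / e) `^ d^-1)).+1 => M hM.
have M1 : 1 <= M%:R :> R by rewrite ler1n; apply: leq_trans hM.
have M0 : 0 < M%:R :> R by lra.
have := HC 1 M%:R (lexx _) M1; rewrite divr1.
have -> : logfactor R p 1 = 1 by rewrite /logfactor ln1 addr0 powR1; case: ifP.
rewrite mulr1 => Hl.
have MC : C / e <= M%:R `^ d.
  have -> : C / e = ((C / e) `^ d^-1) `^ d.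
    by rewrite -powRrM mulVf ?gt_eqF // powRr1 // divr_ge0 ?(ltW C0) ?(ltW e0).
  apply: ge0_ler_powR; rewrite ?nnegrE ?powR_ge0 ?(ltW d0) ?(ltW M0) //.
  by apply: le_trans (ltW (archi_boundP (powR_ge0 _ _))) _; rewrite ler_nat ltnW.
have Md : 0 < M%:R `^ d by rewrite powR_gt0.
rewrite /size_scale (_ : expo R p - 2 * s = - d + - d); last by rewrite /d; field.
rewrite powRD_gt0 // powRN.
apply: le_trans (_ : C * M%:R `^ d * ((M%:R `^ d)^-1 * (M%:R `^ d)^-1) <= _).
  by rewrite ler_wpM2r // mulr_ge0 ?invr_ge0 ?(ltW Md).
have -> : C * M%:R `^ d * ((M%:R `^ d)^-1 * (M%:R `^ d)^-1) = C / M%:R `^ d by field; rewrite gt_eqF.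
by rewrite ler_pdivrMr // mulrC -ler_pdivrMr.
Qed.

Lemma Lnorm_powN (q : R) (f g f' g' : R -> R) :
  (forall x, f' x = - f x) -> (forall x, g' x = - g x) -> Lnorm_pow q f' g' = Lnorm_pow q f g.
Proof. by move=> hf hg; apply: eq_integral => x _; rewrite /cabs_pow hf hg !sqrrN. Qed.

(** A difference of two partial sums is, up to sign, again a tail; its norm is bounded by the scale
    at its starting point, uniformly in its end, and that scale tends to 0. *)
Lemma tail_limit_exists (p s : R) (K : nat) : 2 <= p -> s_star p < s ->
  exists g h : R -> R, [/\ mfun01 g, mfun01 h &
    pair_cvg R p (fun M => tail_re R s K M.+1) (fun M => tail_im R s K M.+1) g h].
Proof.
move=> p2 hs; apply: Lp_complete; first by lra.
- by move=> M; exact: measurable_tail_re.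
- by move=> M; exact: measurable_tail_im.
have [C C0 HC] := tail_norm_upper R s p p2 hs.
move=> e e0; have [M0 HM0] := size_scale_small p s p2 hs _ (divr_gt0 e0 C0).
have main M M' : (maxn K M0 <= M)%N -> (M <= M')%N ->
   (Lnorm_pow p (tail_re R s M.+1 M'.+1) (tail_im R s M.+1 M'.+1) <= (e `^ p)%:E)%E.
  rewrite geq_max => /andP[KM MM] _; apply: le_trans (HC M.+1 M'.+1 _) _ => //.
  have S0 := size_scale_gt0 R s p M.+1 (ltn0Sn M).
  rewrite lee_fin; apply: ge0_ler_powR; rewrite ?nnegrE ?(ltW e0) //; first by lra.
    by rewrite mulr_ge0 ?(ltW C0) ?(ltW S0).
  by rewrite mulrC -ler_pdivlMr //; apply: HM0; exact: leqW.
have cut M M' x : (K <= M)%N -> (M <= M')%N ->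
   tail_re R s K M'.+1 x = tail_re R s K M.+1 x + tail_re R s M.+1 M'.+1 x /\
   tail_im R s K M'.+1 x = tail_im R s K M.+1 x + tail_im R s M.+1 M'.+1 x.
  move=> KM MM'; rewrite /tail_re /tail_im /cos_sum /sin_sum.
  by rewrite !(index_iota_cat K M.+1 M'.+1) ?(leqW KM) // !big_cat.
exists (maxn K M0) => M M' hM hM'.
have KM : (K <= M)%N by move: hM; rewrite geq_max => /andP[].
have KM' : (K <= M')%N by move: hM'; rewrite geq_max => /andP[].
have [MM'|/ltnW MM'] := leqP M M'.
  rewrite (Lnorm_powN p (tail_re R s M.+1 M'.+1) (tail_im R s M.+1 M'.+1)); first exact: main.
    by move=> x; have [-> _] := cut M M' x KM MM'; ring.
  by move=> x; have [_ ->] := cut M M' x KM MM'; ring.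
have -> : (fun x => tail_re R s K M.+1 x - tail_re R s K M'.+1 x) = tail_re R s M'.+1 M.+1.
  by apply/funext => x; have [-> _] := cut M' M x KM' MM'; ring.
have -> : (fun x => tail_im R s K M.+1 x - tail_im R s K M'.+1 x) = tail_im R s M'.+1 M.+1.
  by apply/funext => x; have [_ ->] := cut M' M x KM' MM'; ring.
exact: main.
Qed.

(** Convergence is in L^p while the size is measured in L^q: q = p serves the numerator of the
    flatness and q = 2 the denominator. *)
Lemma tail_limit_size (p q s : R) : 2 <= q -> q <= p -> s_star q < s ->
  exists c C : R, [/\ 0 < c, 0 < C & exists K0 : nat, forall (K : nat) (g h : R -> R),
    (0 < K)%N -> (K0 <= K)%N -> mfun01 g -> mfun01 h ->
    pair_cvg R p (fun M => tail_re R s K M.+1) (fun M => tail_im R s K M.+1) g h ->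
    (c * size_scale R s q K) `^ q <= fine (Lnorm_pow q g h) <= (C * size_scale R s q K) `^ q].
Proof.
move=> q2 qp hs; have [C C0 HC] := tail_norm_upper R s q q2 hs.
have [c c0 [K0 HK0]] := tail_norm_lower R s q q2 hs.
exists (c / 4), (2 * C); split; rewrite ?divr_gt0 ?mulr_gt0 //.
exists K0 => K g h Kp KK0 mg mh cv; have S0 := size_scale_gt0 R s q K Kp.
have q1 : 1 <= q by lra.
have mu M := measurable_tail_re R s K M.+1; have mv M := measurable_tail_im R s K M.+1.
have cS : 0 < c * size_scale R s q K by rewrite mulr_gt0.
have CS : 0 < C * size_scale R s q K by rewrite mulr_gt0.
have up := limit_upper R q p _ _ _ g h q1 qp CS mu mv mg mh cv
  (ex_intro _ 0%N (fun M _ => HC K M.+1 Kp)).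
have evlow : exists M0 : nat, forall M : nat, (M0 <= M)%N ->
    (((c * size_scale R s q K) `^ q)%:E <= Lnorm_pow q (tail_re R s K M.+1) (tail_im R s K M.+1))%E.
  by exists (2 * K)%N => M hM; exact: HK0.
have low := limit_lower R q p _ _ _ g h q1 qp cS mu mv mg mh cv evlow.
move: up low; rewrite (_ : c / 4 * _ = c * size_scale R s q K / 4); last by field.
rewrite -(mulrA 2 C); case: (Lnorm_pow q g h) => [r| |] //=.
by rewrite !lee_fin => u1 u2; rewrite u1 u2.
Qed.

(** Raised to the power p, the power of K in the ratio is 1 for p <= 4 and (K^2)^(p/4 - 1) for p >
    4, with K^2 between N and 4N. At p = 4 the fourth root in [logfactor] is undone, leaving 1 + ln
    K. *)
Lemma size_ratio_rate (p s : R) : 2 <= p -> exists a A : R, [/\ 0 < a, 0 < A &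
  exists N0 : nat, forall N K : nat, (N0 <= N)%N -> (0 < N)%N -> (0 < K)%N ->
    (N <= K ^ 2)%N -> (K ^ 2 <= 4 * N)%N ->
    a * flat_rate p N <= (size_scale R s p K / size_scale R s 2 K) `^ p <= A * flat_rate p N].
Proof.
move=> p2; have p0 : 0 < p by lra.
have e1 : (2 == 4 :> R) = false by apply/eqP; lra.
have e2 : 2 <= 4 :> R by lra.
have ratioE K : (0 < K)%N -> size_scale R s p K / size_scale R s 2 K =
    logfactor R p K%:R * K%:R `^ (expo R p - 1 / 2).
  move=> K0; have KR : 0 < K%:R :> R by rewrite ltr0n.
  rewrite /size_scale {2}/logfactor {2}/expo e1 e2 mul1r -mulrA -powRN -powRD_gt0 //.
  by congr (_ * _ `^ _); ring.
have [p4|p4|p4] := ltgtP p 4.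
- exists 1, 1; split=> //; exists 0%N => N K _ _ K0 _ _; rewrite ratioE //.
  rewrite /logfactor /expo (lt_eqF p4) (ltW p4) /flat_rate p4 subrr powRr0 !mulr1 powR1.
  by rewrite lexx.
- pose b := p / 4 - 1; have b0 : 0 < b by rewrite subr_gt0 ltr_pdivlMr // mul1r.
  have eb : (1 - 2 / p - 1 / 2) * p = 2 * b by rewrite /b; field; rewrite gt_eqF.
  exists 1, (4 `^ b); split; rewrite ?powR_gt0 //; exists 0%N => N K _ N0 K0 NK KN.
  have KR : 0 < K%:R :> R by rewrite ltr0n.
  rewrite ratioE // /logfactor /expo (gt_eqF p4) (leNgt p 4) p4 /= mul1r.
  rewrite /flat_rate ltNge (ltW p4) (gt_eqF p4) /= mul1r -/b.
  have -> : (K%:R `^ (1 - 2 / p - 1 / 2)) `^ p = (K ^ 2)%:R `^ b.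
    have -> : (K ^ 2)%:R = K%:R `^ 2 :> R by rewrite natrX powR_mulrn // ltW.
    by rewrite -[LHS]powRrM -[RHS]powRrM eb.
  rewrite -powRM // -natrM.
  by apply/andP; split; (apply: ge0_ler_powR; rewrite ?nnegrE ?(ltW b0) ?ler_nat).
- exists (1 / 2), 2; split; rewrite ?divr_gt0 //.
  (* N >= 4 gives K^2 <= 4 N <= N^2, hence ln K <= ln N; N >= e absorbs the 1 in 1 + ln K. *)
  exists (maxn 4 (Num.bound (expR (1 : R))).+1) => N K; rewrite geq_max => /andP[N4 Ne] N0 K0 NK KN.
  have KR : 0 < K%:R :> R by rewrite ltr0n.
  have NR : 0 < N%:R :> R by rewrite ltr0n.
  have K1 : 1 <= K%:R :> R by rewrite ler1n.
  rewrite ratioE // /logfactor /expo /flat_rate p4 eqxx lexx ltxx subrr powRr0 mulr1 -powRrM.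
  have lK : 0 <= ln K%:R :> R by rewrite ln_ge0.
  rewrite (_ : 1 / 4 * 4 = 1); last by field.
  rewrite powRr1; last by lra.
  have l1 : 1 <= ln N%:R :> R.
    rewrite -[leLHS](@expRK R 1) ler_ln ?posrE ?expR_gt0 //.
    by apply: le_trans (ltW (archi_boundP (expR_ge0 1))) _; rewrite ler_nat ltnW.
  have lK2 : ln (K ^ 2)%:R = 2 * ln K%:R :> R by rewrite natrX lnXn // mulr_natl.
  have h1 : ln N%:R <= 2 * ln K%:R :> R by rewrite -lK2 ler_ln ?posrE ?ltr0n ?expn_gt0 ?K0 // ler_nat.
  have h2 : 2 * ln K%:R <= ln N%:R + ln N%:R :> R.
    rewrite -lK2 -lnM ?posrE // -natrM ler_ln ?posrE ?ltr0n ?expn_gt0 ?K0 ?muln_gt0 ?N0 // ler_nat.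
    by apply: leq_trans KN _; rewrite leq_mul2r N4 orbT.
  by apply/andP; split; lra.
Qed.

End HighPassLimit.

(** * The flatness quotient *)

Lemma ratio_bounds (R : realType) (p cp Cp c2 C2 S T X Y : R) : 0 < p ->
  0 < cp -> 0 < Cp -> 0 < c2 -> 0 < C2 -> 0 < S -> 0 < T ->
  (cp * S) `^ p <= X <= (Cp * S) `^ p -> (c2 * T) `^ 2 <= Y <= (C2 * T) `^ 2 ->
  (cp / C2) `^ p * (S / T) `^ p <= X / Y `^ (p / 2) /\
  X / Y `^ (p / 2) <= (Cp / c2) `^ p * (S / T) `^ p.
Proof.
move=> p0 cp0 Cp0 c20 C20 S0 T0 /andP[lp up] /andP[l2 u2].
have half (x : R) : (x `^ 2) `^ (p / 2) = x `^ p.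
  by rewrite -powRrM; congr (_ `^ _); field.
have Yl : (c2 * T) `^ p <= Y `^ (p / 2).
  rewrite -half; apply: ge0_ler_powR; rewrite ?nnegrE ?powR_ge0 //; first by rewrite divr_ge0 // ltW.
  exact: le_trans (powR_ge0 _ _) l2.
have Yu : Y `^ (p / 2) <= (C2 * T) `^ p.
  rewrite -[leRHS]half; apply: ge0_ler_powR; rewrite ?nnegrE ?powR_ge0 //; first by rewrite divr_ge0 // ltW.
  exact: le_trans (powR_ge0 _ _) l2.
have Y0 : 0 < Y `^ (p / 2) by apply: lt_le_trans Yl; apply: powR_gt0; exact: mulr_gt0.
have splitE (c d : R) : 0 < c -> 0 < d -> (c / d) `^ p * (S / T) `^ p * (d * T) `^ p = (c * S) `^ p.
  move=> cc dd; rewrite -!powRM ?mulr_ge0 ?invr_ge0 ?(ltW cc) ?(ltW dd) ?(ltW S0) ?(ltW T0) //.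
  by congr (_ `^ _); field; rewrite !gt_eqF.
split.
  rewrite ler_pdivlMr //; apply: le_trans lp; rewrite -(splitE cp C2) //.
  by rewrite ler_wpM2l // mulr_ge0 ?powR_ge0.
rewrite ler_pdivrMr //; apply: le_trans up _; rewrite -(splitE Cp c2) //.
by rewrite ler_wpM2l // mulr_ge0 ?powR_ge0.
Qed.

Theorem theoremA (R : realType) (p s : R) (hp : 2 <= p) (hs : s_star p < s) :
  (exists gr gi : nat -> R -> R, forall N : nat, is_HP_limit p s N (gr N) (gi N)) /\
  (forall gr gi : nat -> R -> R,
     (forall N : nat, is_HP_limit p s N (gr N) (gi N)) ->
     exists c C : R, 0 < c /\ 0 < C /\ exists N0 : nat, forall N : nat, (N0 <= N)%N ->
       c * flat_rate p N <= flatness p (gr N) (gi N) /\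
       flatness p (gr N) (gi N) <= C * flat_rate p N).
Proof.
have p0 : 0 < p by lra.
split.
  have ex N : exists gh : (R -> R) * (R -> R), is_HP_limit p s N gh.1 gh.2.
    have [K K0 [NK _]] := cutoff N; have [HR HI] := HP_tail R s N K K0 NK.
    have [g [h [mg mh cv]]] := tail_limit_exists R p s K hp hs.
    by exists (g, h); rewrite /is_HP_limit HR HI; split => //; split.
  have [f Hf] := choice ex; by exists (fun N => (f N).1), (fun N => (f N).2).
move=> gr gi Hg.
have hs2 : s_star 2 < s := le_lt_trans (s_star2_le R p hp) hs.
have [cp [Cp [cp0 Cp0 [Kp HKp]]]] := tail_limit_size R p p s hp (lexx p) hs.
have [c2 [C2 [c20 C20 [K2 HK2]]]] := tail_limit_size R p 2 s (lexx 2) hp hs2.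
have [a [A [a0 A0 [N1 HN1]]]] := size_ratio_rate R p s hp.
exists ((cp / C2) `^ p * a), ((Cp / c2) `^ p * A).
split; first by rewrite mulr_gt0 ?powR_gt0 ?divr_gt0.
split; first by rewrite mulr_gt0 ?powR_gt0 ?divr_gt0.
(* Since K^2 >= N, squaring the thresholds for K makes them thresholds for N. *)
exists (maxn N1 (maxn 1 (maxn Kp K2 ^ 2))) => N; rewrite !geq_max => /and3P[hN1 N0 hN2].
have [K K0 [NK /(_ N0)[NK2 KN4]]] := cutoff N; have [HR HI] := HP_tail R s N K K0 NK.
have : (maxn Kp K2 <= K)%N by rewrite -leq_sqr; apply: leq_trans hN2 NK2.
rewrite geq_max => /andP[hKp hK2].
have [mr [mi cv]] := Hg N; rewrite HR HI in cv.
have hX := HKp K _ _ K0 hKp mr mi cv.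
have hY := HK2 K _ _ K0 hK2 mr mi cv.
have /andP[lr ur] := HN1 N K hN1 N0 K0 NK2 KN4.
have S0 := size_scale_gt0 R s p K K0.
have T0 := size_scale_gt0 R s 2 K K0.
have [lo hi] := ratio_bounds R p _ _ _ _ _ _ _ _ p0 cp0 Cp0 c20 C20 S0 T0 hX hY.
split.
  by apply: le_trans lo; rewrite -mulrA ler_wpM2l // powR_ge0.
by apply: le_trans hi _; rewrite -mulrA ler_wpM2l // powR_ge0.
Qed.
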